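(* For every complex Banach space $X$ with type $2$, $$\operatorname{cot}(X)=\operatorname{cot}_{\mathfrak{F}}(X)=\operatorname{cot}_{\mathrm{Hyp}}(X).$$
   Context: $\mathbb{T}=\{z\in\mathbb{C}:|z|=1\}$; $\mathbb{T}^N$ and $\mathbb{T}^\infty$ carry the product of the normalized Lebesgue measure on $\mathbb{T}$, denoted $dz$. $\mathbb{N}_0^{(\mathbb{N})}$ is the set of finite multi-indices of nonnegative integers of arbitrary length; $|\alpha|=\alpha_1+\alpha_2+\cdots$ and $z^\alpha=z_1^{\alpha_1}z_2^{\alpha_2}\cdots$. For $q\ge 2$, $\frac1q+\frac1{q'}=1$. Type 2: there is $C>0$ with $\big(\int_{\mathbb{T}^N}\|\sum_{k=1}^Nx_kz_k\|^2dz\big)^{1/2}\le C\big(\sum_{k=1}^N\|x_k\|^2\big)^{1/2}$ for all $N$ and $x_1,\dots,x_N\in X$. Cotype $q$ ($2\le q<\infty$): there is $C>0$ with $\big(\sum_{k=1}^N\|x_k\|^q\big)^{1/q}\le C\big(\int_{\mathbb{T}^N}\|\sum_{k=1}^Nx_kz_k\|^2dz\big)^{1/2}$ for all $N$ and $x_1,\dots,x_N\in X$. Fourier cotype $q$ ($2\le q<\infty$): there is $C>0$ with $\big(\sum_{k=1}^N\|x_k\|^q\big)^{1/q}\le C\big(\int_{\mathbb{T}}\|\sum_{k=1}^Nx_kz^k\|^{q'}dz\big)^{1/q'}$ for all $N$ and $x_1,\dots,x_N\in X$. Hypercontractive homogeneous cotype $q$: there is $C>0$ such that for every $m\in\mathbb{N}$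 and every family $(x_\alpha)_{\alpha\in\mathbb{N}_0^{(\mathbb{N})},|\alpha|=m}\subset X$ with finitely many nonzero elements, $\big(\sum_{|\alpha|=m}\|x_\alpha\|^q\big)^{1/q}\le C^m\big(\int_{\mathbb{T}^\infty}\|\sum_{|\alpha|=m}x_\alpha z^\alpha\|^2dz\big)^{1/2}$. $\operatorname{cot}(X)$, $\operatorname{cot}_{\mathfrak{F}}(X)$, $\operatorname{cot}_{\mathrm{Hyp}}(X)$ denote the infimum of all $2\le q<\infty$ such that $X$ has, respectively, cotype $q$, Fourier cotype $q$, hypercontractive homogeneous cotype $q$ (with value $\infty$ if there is no such $q$). *)

(* Defs.v *)
From HB Require Import structures.
From mathcomp Require Import all_boot all_order all_algebra finmap.
From mathcomp Require Import all_classical all_reals all_analysis.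
From mathcomp Require Import measurable_realfun complex.
From mathcomp Require Import zify ring lra.

Set Implicit Arguments.
Unset Strict Implicit.
Unset Printing Implicit Defensive.
Import Order.TTheory GRing.Theory Num.Theory.
Import numFieldTopology.Exports numFieldNormedType.Exports.

Local Open Scope classical_set_scope.
Local Open Scope ring_scope.

Section finite_power.
Context d (T : measurableType d) (R : realType) (P : probability T R).

Definition tuple_cons n (x : T * n.-tuple T) : n.+1.-tuple T :=
  [the n.+1.-tuple T of x.1 :: x.2].

Let measurable_tuple_cons n : measurable_fun setT (@tuple_cons n).
Proof. exact: measurable_cons. Qed.

HB.instance Definition _ n :=
  isMeasurableFun.Build _ _ _ _ (@tuple_cons n) (@measurable_tuple_cons n).

Fixpoint power_prob n : probability (n.-tuple T) R :=
  if n is n'.+1 then distribution (P \x power_prob n')%E (@tuple_cons n')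
  else dirac ([tuple] : 0.-tuple T).

End finite_power.

(* The product sigma-algebra on sequences: the library has it on tuples only. *)
Definition cylinder d (T : measurableType d) : set_system (nat -> T) :=
  [set C | exists i A, measurable A /\ C = [set z | A (z i)]].

Definition sequence_space d (T : measurableType d) :=
  g_sigma_algebraType (@cylinder d T).

Section circle.
Context {R : realType}.

(* A point of the unit circle is given by its angle in turns: the normalized
   Lebesgue measure dz is the image of the uniform law on [0, 1] under
   t |-> exp (2 i pi t), so integrals over the circle, and over its finite and
   countable powers, are written as integrals over the angles. *)
Definition circle_point (t : R) : R[i] :=
  (cos (2 * pi * t) +i* sin (2 * pi * t))%C.

Definition circle_prob : probability (measurableTypeR R) R :=
  [the probability _ R of uniform_prob (@ltr01 R)].

Definition torus_prob (N : nat) :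
    probability (N.-tuple (measurableTypeR R)) R :=
  power_prob circle_prob N.

End circle.

(* The library has no infinite product of probability measures. The next three
   sections construct the one of countably many copies of circle_prob, as the
   law of an independent sequence of uniform variables extracted from the
   binary digits of a single one; the result is seq_prob_exists below. *)

Section digits.
Local Open Scope nat_scope.

Fixpoint dig (h : nat -> bool) m k :=
  if m is m'.+1 then (dig h m' (k %/ 4)).*2 + h k else 0.

Let h1 k := odd (k %/ 2).

Lemma dig_lt h m k : dig h m k < 2 ^ m.
Proof.
elim: m k => //= m IH k; rewrite expnS -mul2n; have := IH (k %/ 4).
case: (h k); lia.
Qed.

Lemma dig_inj m k k' : k < 4 ^ m -> k' < 4 ^ m ->
  dig h1 m k = dig h1 m k' -> dig odd m k = dig odd m k' -> k = k'.
Proof.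
elim: m k k' => [|m IH] k k'; first by rewrite expn0; lia.
rewrite expnS /= -!mul2n => lk lk' e1 e2.
have e : k %/ 4 = k' %/ 4.
  apply: IH; lia.
have {e1}e1 : odd (k %/ 2) = odd (k' %/ 2).
  by move: e1; rewrite e /h1; case: odd; case: odd; lia.
have {e2}e2 : odd k = odd k'.
  by move: e2; rewrite e; case: odd; case: odd; lia.
lia.
Qed.

Lemma dig_count m A B : A <= 2 ^ m -> B <= 2 ^ m ->
  #|[pred k : 'I_(4 ^ m) | (dig h1 m k < A) && (dig odd m k < B)]| = A * B.
Proof.
move=> leA leB.
pose f (k : 'I_(4 ^ m)) : 'I_(2 ^ m) * 'I_(2 ^ m) :=
  (Ordinal (dig_lt h1 m k), Ordinal (dig_lt odd m k)).
have fi : injective f.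
  by move=> k k' [e1 e2]; apply/val_inj/(dig_inj _ _ e1 e2).
have fb : bijective f.
  apply: inj_card_bij => //; rewrite card_prod !card_ord -expnD.
  by rewrite addnn -mul2n expnM.
have cnt C : C <= 2 ^ m -> #|[pred i : 'I_(2 ^ m) | i < C]| = C.
  by move=> leC; rewrite -sum1_card -(big_ord_widen _ (fun=> 1)) // sum1_card card_ord.
rewrite -[in RHS](cnt A leA) -[in RHS](cnt B leB) -cardX.
rewrite -(on_card_preimset (f := f)); last exact: onW_bij.
by apply: eq_card => k; rewrite !inE.
Qed.

End digits.

Section split.
Context {R : realType}.
Local Notation P := (@circle_prob R).
Implicit Types (x a b : R) (h : nat -> bool).

Lemma circle_prob_itv a b : 0 <= a -> a <= b -> b <= 1 ->
  P `[a, b[%classic = (b - a)%:E.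
Proof.
move=> a0 ab b1; rewrite /circle_prob /= /uniform_prob.
rewrite (eq_integral (fun=> 1%:E)); last first.
  move=> x; rewrite inE/= in_itv/= /uniform_pdf subr0 invr1 => /andP[ax xb].
  by rewrite (le_trans a0 ax) (le_trans (ltW xb) b1).
rewrite integral_cst//= mul1e lebesgue_measure_itv/= lte_fin.
have [//|ba] := ltP a b.
by rewrite (@le_anti _ _ a b) ?subrr// ab ba.
Qed.

Lemma circle_prob_I (A : set (measurableTypeR R)) : measurable A ->
  P A = P (A `&` `[0, 1[%classic).
Proof.
move=> mA.
have m01 : measurable (`[0, 1[%classic : set (measurableTypeR R)) by [].
rewrite [LHS](measureDI _ mA m01).
rewrite [X in (X + _)%E](_ : _ = 0%E) ?add0e//.
have: P (~` `[0, 1[%classic) = 0%E.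
  by rewrite probability_setC// circle_prob_itv// subr0 subee.
apply: subset_measure0; [exact: measurableD|exact: measurableC|by move=> x []].
Qed.

Definition dyad h m x : R := (dig h m (Num.truncn (4 ^+ m * x)))%:R / 2 ^+ m.

Lemma truncn_quarter m x :
  (Num.truncn (4 ^+ m.+1 * x) %/ 4)%N = Num.truncn (4 ^+ m * x).
Proof.
have [x0|x0] := leP 0 x; last first.
  have e k : Num.truncn (4 ^+ k * x) = 0%N.
    apply/truncn0Pn; rewrite -ltNge (le_lt_trans _ ltr01)//.
    by rewrite mulr_ge0_le0 ?exprn_ge0// ltW.
  by rewrite !e.
have p0 k : 0 <= 4 ^+ k * x by rewrite mulr_ge0// exprn_ge0.
apply/esym/truncn_def.
have /andP[] := truncn_itv (p0 m.+1).
set k := Num.truncn _; rewrite exprS -mulrA.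
have /(congr1 (fun n => n%:R : R)) := divn_eq k 4; rewrite natrD natrM.
have : ((k %% 4)%N%:R : R) <= 3 by rewrite ler_nat; lia.
have : (0 : R) <= (k %% 4)%N%:R by rewrite ler0n.
rewrite -[k.+1]addn1 -[(k %/ 4).+1]addn1 !natrD.
by move=> *; apply/andP; split; lra.
Qed.

Lemma dyadS h m x : dyad h m.+1 x =
  dyad h m x + (h (Num.truncn (4 ^+ m.+1 * x)))%:R / 2 ^+ m.+1.
Proof.
rewrite /dyad /= truncn_quarter natrD -mul2n natrM [2 ^+ m.+1]exprS.
by field; rewrite expf_eq0 pnatr_eq0 andbF.
Qed.

Lemma dyad_lt1 h m x : dyad h m x < 1.
Proof.
rewrite /dyad ltr_pdivrMr ?exprn_gt0// mul1r -(natrX _ 2) ltr_nat; exact: dig_lt.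
Qed.

Lemma dyad_nd h x : nondecreasing_seq (fun m => dyad h m x).
Proof.
by apply/nondecreasing_seqP => m; rewrite dyadS lerDl divr_ge0.
Qed.

Lemma dyad_ub h m k x : dyad h (m + k) x <= dyad h m x + 2 ^- m - 2 ^- (m + k).
Proof.
elim: k => [|k IH]; first by rewrite addn0 addrK.
rewrite addnS dyadS (le_trans (lerD IH (lexx _)))//.
have -> : 2 ^- (m + k) = 2 * 2 ^- (m + k).+1 :> R.
  by rewrite exprS invfM mulrA divff ?mul1r// pnatr_eq0.
have : 0 <= 2 ^- (m + k).+1 :> R by rewrite invr_ge0 exprn_ge0.
by case: (h _) => /=; lra.
Qed.

Definition split_half h x : R := limn (fun m => dyad h m x).

Lemma cvg_dyad h x : (fun m => dyad h m x) @ \oo --> split_half h x.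
Proof.
apply: (@nondecreasing_is_cvgn _ (fun m => dyad h m x)); first exact: dyad_nd.
by exists 1 => _ [m _ <-]; exact/ltW/dyad_lt1.
Qed.

Lemma dyad_le h m x : dyad h m x <= split_half h x.
Proof.
apply: (@nondecreasing_cvgn_le _ (fun m => dyad h m x)); first exact: dyad_nd.
exact: cvg_dyad.
Qed.

Lemma le_dyad h m x : split_half h x <= dyad h m x + 2 ^- m.
Proof.
apply: limr_le; first exact: cvg_dyad.
near=> k.
have mk : (m <= k)%N by near: k; exact: nbhs_infty_ge.
rewrite -(subnKC mk) (le_trans (dyad_ub _ _ _ _))// gerBl invr_ge0 exprn_ge0//.
Unshelve. all: by end_near. Qed.

Lemma measurable_trunc_set m (p : pred nat) :
  measurable ([set x | p (Num.truncn (4 ^+ m * x))] : set (measurableTypeR R)).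
Proof.
rewrite (_ : [set x | _] = \bigcup_(k in [set k | p k])
   [set x : R | Num.truncn (4 ^+ m * x) = k]); last first.
  by apply/seteqP; split => [x /= px|x [k /= pk ->//]]; exists (Num.truncn (4 ^+ m * x)).
apply: bigcup_measurable => k _.
have p4 : (0 : R) < 4 ^+ m by rewrite exprn_gt0.
case: k => [|k].
  rewrite (_ : [set x | _] = `]-oo, 4 ^- m[%classic); first exact: measurable_itv.
  apply/seteqP; split => x /=; rewrite in_itv/= -[4 ^- m]mulr1 ltr_pdivlMl//.
    by move=> /truncn0Pn; rewrite -ltNge.
  by move=> ?; apply/truncn0Pn; rewrite -ltNge.
rewrite (_ : [set x | _] = `[4 ^- m * k.+1%:R, 4 ^- m * k.+2%:R[%classic).
  exact: measurable_itv.
apply/seteqP; split => x /=; rewrite in_itv/= ler_pdivrMl// ltr_pdivlMl//.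
  move=> e; have x0 : 0 <= 4 ^+ m * x.
    by rewrite ltW// (lt_le_trans ltr01)// -truncn_gt0 e.
  by rewrite -truncn_eq// e.
by move=> /truncn_def.
Qed.

Lemma measurable_dyad h m :
  measurable_fun setT (dyad h m : measurableTypeR R -> measurableTypeR R).
Proof.
move=> _ Y _; rewrite setTI.
have := measurable_trunc_set m [pred k | (dig h m k)%:R / 2 ^+ m \in Y].
congr (measurable _); apply/seteqP; split => x /=; by rewrite inE.
Qed.

Lemma measurable_split_half h :
  measurable_fun setT (split_half h : measurableTypeR R -> measurableTypeR R).
Proof.
apply: (@measurable_fun_cvg _ _ _ setT (dyad h)).
  by move=> m; exact: measurable_dyad.
by move=> x _; exact: cvg_dyad.
Qed.

Lemma prob_trunc m (p : pred nat) :
  P [set x | p (Num.truncn (4 ^+ m * x))] =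
  (#|[pred k : 'I_(4 ^ m) | p k]|%:R / 4 ^+ m)%:E.
Proof.
rewrite circle_prob_I; last exact: measurable_trunc_set.
have p4 : (0 : R) < 4 ^+ m by rewrite exprn_gt0.
pose F (k : 'I_(4 ^ m)) := `[4 ^- m * k%:R, 4 ^- m * k.+1%:R[%classic : set R.
have FE k x : F k x <-> 0 <= x /\ Num.truncn (4 ^+ m * x) = k.
  rewrite /F /= in_itv/= ler_pdivrMl// ltr_pdivlMl//; split.
    move=> e; split; last exact/truncn_def.
    by move: e => /andP[+ _] => /(le_trans (ler0n _ _)); rewrite pmulr_rge0.
  by move=> [x0 e]; rewrite -truncn_eq ?e// mulr_ge0// ltW.
rewrite (_ : _ `&` _ = \big[setU/set0]_(k < 4 ^ m | p k) F k); last first.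
  apply/seteqP; split => x /=.
    rewrite in_itv/= => -[px /andP[x0 x1]].
    have lk : (Num.truncn (4 ^+ m * x) < 4 ^ m)%N.
      have x40 : 0 <= 4 ^+ m * x by rewrite mulr_ge0// ltW.
      by rewrite truncn_lt_nat// natrX gtr_pMr.
    by rewrite (bigD1 (Ordinal lk))//=; left; exact/FE.
  rewrite -bigcup_seq_cond => -[k /= /andP[_ pk] /FE[x0 e]]; rewrite e; split => //.
  have x40 : 0 <= 4 ^+ m * x by rewrite mulr_ge0// ltW.
  rewrite in_itv/= x0/= -(@ltr_pM2l _ (4 ^+ m))// mulr1.
  by rewrite -[ltRHS](natrX _ 4) -truncn_lt_nat// e.
rewrite measure_bigsetU_ord_cond//=.
- rewrite (eq_bigr (fun=> (4 ^- m)%:E)); last first.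
    move=> k _; rewrite circle_prob_itv.
    + by rewrite -mulrBr -natrB ?leqnSn// subSnn mulr1.
    + by rewrite mulr_ge0// invr_ge0 ltW.
    + by rewrite ler_wpM2l ?ler_nat// invr_ge0 ltW.
    + by rewrite ler_pdivrMl// mulr1 -natrX ler_nat ltn_ord.
  by rewrite sumEFin sumr_const; congr EFin; exact: (esym (mulr_natl _ _)).
- by move=> i _; exact: measurable_itv.
- by move=> i j pi pj [x [/FE[_ ei] /FE[_ ej]]]; apply: val_inj; rewrite /= -ei -ej.
Qed.

End split.

Section iid.
Context {R : realType}.
Local Notation P := (@circle_prob R).
Local Notation mR := (measurableTypeR R).
Implicit Types (a b : R).
Let h1 k := odd (k %/ 2).
Local Notation S1 := (@split_half R h1).
Local Notation S2 := (@split_half R odd).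

Let clamp a : R := Num.max 0 (Num.min a 1).

Lemma clamp01 a : 0 <= clamp a <= 1.
Proof. by rewrite /clamp le_max lexx/= ge_max ler01/= ge_min lexx orbT. Qed.

Lemma circle_prob_ray a : P `]-oo, a[%classic = (clamp a)%:E.
Proof.
rewrite circle_prob_I//; have /andP[c0 c1] := clamp01 a.
rewrite -[in RHS](subr0 (clamp a)) -circle_prob_itv//.
congr (P _); apply/seteqP; split => x /=; rewrite !in_itv/= /clamp.
  by move=> [xa /andP[x0 x1]]; rewrite x0/= lt_max lt_min xa x1 orbT.
by case/andP => x0; rewrite lt_max ltNge x0/= lt_min => /andP[-> ->].
Qed.

Lemma measurable_split_ray h a :
  measurable ([set x | split_half h x < a] : set mR).
Proof.
have := @measurable_split_half R h measurableT `]-oo, a[%classic.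
rewrite setTI => /(_ (measurable_itv _)); exact.
Qed.

Let N (m : nat) : R := 2 ^+ m.
Let lo m a := (Num.truncn (N m * clamp a)).-1.
Let hi m a := minn (Num.truncn (N m * clamp a)).+1 (2 ^ m).

Let N_gt0 m : 0 < N m. Proof. by rewrite exprn_gt0. Qed.

Lemma lo_ray h m a x : (dig h m (Num.truncn (4 ^+ m * x)) < lo m a)%N ->
  split_half h x < a.
Proof.
set k := dig _ _ _ => klo.
have c0 : 0 <= clamp a by case/andP: (clamp01 a).
have : (k.+1 < Num.truncn (N m * clamp a))%N by move: klo; rewrite /lo; lia.
rewrite truncn_gt_nat => kc.
have cpos : 0 < clamp a.
  by rewrite -(pmulr_rgt0 _ (N_gt0 m)) (lt_le_trans _ kc).
have ca : clamp a <= a.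
  by move: cpos; rewrite /clamp lt_max ltxx/= => m0; rewrite (max_r (ltW m0)) ge_min lexx.
apply: lt_le_trans ca; apply: (le_lt_trans (le_dyad h m x)).
rewrite /dyad -/k -[X in _ + X]mul1r -mulrDl ltr_pdivrMr// natr1.
by rewrite mulrC (lt_le_trans _ kc)// ltr_nat.
Qed.

Lemma hi_ray h m a x : split_half h x < a ->
  (dig h m (Num.truncn (4 ^+ m * x)) < hi m a)%N.
Proof.
move=> sa; set k := dig _ _ _.
rewrite /hi leq_min dig_lt andbT ltnS.
have c0 : 0 <= clamp a by case/andP: (clamp01 a).
rewrite truncn_ge_nat; last by rewrite mulr_ge0// ltW.
rewrite mulrC -ler_pdivrMr//.
have := dyad_le h m x; have := dyad_lt1 h m x; rewrite /dyad -/k -/(N m).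
move=> k1 kS; rewrite /clamp le_max le_min (le_trans kS (ltW sa)) (ltW k1).
by rewrite orbT.
Qed.

Lemma lo_bound m a : clamp a - 2 / N m <= (lo m a)%:R / N m <= clamp a.
Proof.
have /andP[c0 c1] := clamp01 a.
have Nc : 0 <= N m * clamp a by rewrite mulr_ge0// ltW.
have /andP[t1 t2] := truncn_itv Nc.
rewrite lerBlDr -mulrDl ler_pdivlMr// ler_pdivrMr// ![clamp a * _]mulrC.
apply/andP; split.
  rewrite (le_trans (ltW t2))// /lo -natrD ler_nat; lia.
by rewrite (le_trans _ t1)// ler_nat /lo leq_pred.
Qed.

Lemma hi_bound m a : (hi m a)%:R / N m <= clamp a + 1 / N m /\
  0 <= (hi m a)%:R / N m <= 1.
Proof.
have /andP[c0 c1] := clamp01 a.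
have Nc : 0 <= N m * clamp a by rewrite mulr_ge0// ltW.
have /andP[t1 t2] := truncn_itv Nc.
split.
  rewrite -lerBlDr -mulrBl ler_pdivrMr// [clamp a * _]mulrC (le_trans _ t1)//.
  rewrite lerBlDr natr1 ler_nat /hi geq_minl//.
apply/andP; split; first by rewrite divr_ge0// ltW.
rewrite ler_pdivrMr// mul1r /N -(natrX _ 2) ler_nat.
exact: geq_minr.
Qed.

Lemma split_rays a b :
  P ([set x | S1 x < a] `&` [set x | S2 x < b]) = (clamp a * clamp b)%:E.
Proof.
set Q := _ `&` _.
have mQ : measurable (Q : set mR) by apply: measurableI; exact: measurable_split_ray.
have cnt m A B : (A <= 2 ^ m)%N -> (B <= 2 ^ m)%N ->
    P [set x | [pred k | (dig h1 m k < A) && (dig odd m k < B)]%N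
       (Num.truncn (4 ^+ m * x))] = (A%:R / N m * (B%:R / N m))%:E.
  move=> lA lB; rewrite prob_trunc dig_count// natrM; congr EFin.
  have -> : 4 = 2 * 2 :> R by rewrite -natrM.
  rewrite exprMn invfM.
  by rewrite -!mulrA; congr (_ * _); rewrite mulrCA.
rewrite -(@fineK _ (P Q)) ?fin_num_measure//; congr EFin.
set q := fine _; apply/eqP; rewrite -subr_eq0 -normr_le0.
apply/ler_addgt0Pl => e e0; rewrite addr0.
have [m me] : exists m, 4 / N m <= e.
  exists (Num.truncn (4 / e)); rewrite ler_pdivrMr// mulrC -ler_pdivrMr//.
  rewrite (le_trans (ltW (truncnS_gt _)))// /N -(natrX _ 2) ler_nat.
  exact: ltn_expl.
rewrite (le_trans _ me)//.
have /andP[a0 a1] := clamp01 a; have /andP[b0 b1] := clamp01 b.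
have lo2 c : (lo m c <= 2 ^ m)%N.
  have /andP[_] := lo_bound m c; have /andP[_ c1] := clamp01 c.
  by move=> /le_trans/(_ c1); rewrite ler_pdivrMr// mul1r /N -(natrX _ 2) ler_nat.
have hi2 c : (hi m c <= 2 ^ m)%N by exact: geq_minr.
have lq : (lo m a)%:R / N m * ((lo m b)%:R / N m) <= q.
  rewrite -lee_fin fineK ?fin_num_measure// -cnt//.
  apply: le_measure; rewrite ?inE//; first exact: measurable_trunc_set.
  by move=> x /= /andP[xa xb]; split; apply: lo_ray; eassumption.
have uq : q <= (hi m a)%:R / N m * ((hi m b)%:R / N m).
  rewrite -lee_fin fineK ?fin_num_measure// -cnt//.
  apply: le_measure; rewrite ?inE//; first exact: measurable_trunc_set.
  by move=> x /= [xa xb]; apply/andP; split; apply: hi_ray.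
have /andP[la1 la2] := lo_bound m a; have /andP[lb1 lb2] := lo_bound m b.
have [ha1 /andP[ha2 ha3]] := hi_bound m a.
have [hb1 /andP[hb2 hb3]] := hi_bound m b.
have la0 : 0 <= (lo m a)%:R / N m by rewrite divr_ge0// ltW.
have lb0 : 0 <= (lo m b)%:R / N m by rewrite divr_ge0// ltW.
have i0 : 0 < (N m)^-1 by rewrite invr_gt0.
rewrite ler_norml; move: i0 lq uq la1 la2 lb1 lb2 ha1 ha2 ha3 hb1 hb2 hb3 la0 lb0.
set i := (N m)^-1; set u := _ / N m; set v := _ / N m.
set u' := _ / N m; set v' := _ / N m.
move=> *; apply/andP; split; nra.
Qed.

Lemma split_extend (f : mR -> mR) (c : R) (D : set mR) :
  measurable_fun setT f -> measurable D -> 0 <= c ->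
  (forall a, P (f @^-1` `]-oo, a[ `&` D) = (c%:E * P `]-oo, a[%classic)%E) ->
  forall A : set mR, measurable A -> P (f @^-1` A `&` D) = (c%:E * P A)%E.
Proof.
move=> mf mD c0 E A mA.
pose mu1 : {measure set mR -> \bar R} := pushforward (mrestr P mD) f.
pose mu2 : {measure set mR -> \bar R} := mscale (NngNum c0) P.
rewrite -[LHS]/(mu1 mf A) -[RHS]/(mu2 A).
apply: (@measure_unique _ R mR (@RGenInftyO.G R)
  (fun n => `]-oo, n%:R[%classic) _ _ _ _ (mu1 mf) mu2 _ _ A mA).
- exact: RGenInftyO.measurableE.
- move=> _ _ [x ->] [y ->]; exists (Num.min x y).
  by apply/seteqP; split => z /=; rewrite !in_itv/= lt_min => /andP.
- by move=> n; exists n%:R.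
- apply/seteqP; split => // x _; exists (Num.truncn x).+1 => //=.
  by rewrite in_itv/= truncnS_gt.
- by move=> _ [x ->]; exact: E.
- move=> n; apply: (@le_lt_trans _ _ 1%E); last exact: ltry.
  apply: probability_le1; apply: measurableI => //.
  by rewrite -[X in measurable X]setTI; exact: mf.
Qed.

Lemma split_indep (A B : set mR) : measurable A -> measurable B ->
  P (S1 @^-1` A `&` S2 @^-1` B) = (P A * P B)%E.
Proof.
move=> mA mB.
have mS1A : measurable (S1 @^-1` A : set mR).
  by rewrite -[X in measurable X]setTI; exact: measurable_split_half.
have ray b : P (S1 @^-1` A `&` S2 @^-1` `]-oo, b[) =
             (P A * P `]-oo, b[%classic)%E.
  rewrite circle_prob_ray [in RHS]muleC.
  apply: (split_extend (measurable_split_half h1)) => //.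
  - exact: (measurable_split_ray odd b).
  - by case/andP: (clamp01 b).
  - move=> a; rewrite circle_prob_ray muleC -EFinM -split_rays.
    by congr (P _); apply/seteqP; split => x /=; rewrite !in_itv.
rewrite setIC -(fineK (fin_num_measure P _ mA)).
apply: (split_extend (measurable_split_half odd)) => //.
- exact: fine_ge0.
- by move=> b; rewrite setIC ray fineK// fin_num_measure.
Qed.

Let rest n : R -> R := iter n S2.
Definition iid_seq (t : R) : nat -> R := fun n => S1 (iter n S2 t).

Lemma measurable_iter_S2 n : measurable_fun setT (iter n S2 : mR -> mR).
Proof.
elim: n => [|n IH]; first exact: measurable_id.
by apply: (measurableT_comp _ IH); exact: measurable_split_half.
Qed.

Lemma iid_seq_box n (A : nat -> set mR) (B : set mR) :
  (forall i, measurable (A i)) -> measurable B ->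
  P ([set t | forall i, (i < n)%N -> A i (iid_seq t i)] `&` iter n S2 @^-1` B) =
  ((\prod_(i < n) fine (P (A i)))%:E * P B)%E.
Proof.
elim: n A B => [|n IH] A B mA mB.
  rewrite big_ord0 mul1e; congr (P _).
  by apply/seteqP; split => x //= [].
rewrite [X in P X](_ : _ = S1 @^-1` A 0%N `&` S2 @^-1`
   ([set t | forall i, (i < n)%N -> A i.+1 (iid_seq t i)] `&` iter n S2 @^-1` B)).
  rewrite split_indep//; last first.
    apply: measurableI; last first.
      by rewrite -[X in measurable X]setTI; exact: measurable_iter_S2.
    rewrite (_ : mkset _ = \bigcap_(i < n) (iid_seq ^~ i) @^-1` A i.+1) //.
    apply: bigcap_measurableType => i _.
    rewrite -[X in measurable X]setTI.
    have mi := measurableT_comp (measurable_split_half h1) (measurable_iter_S2 i).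
    exact: (mi measurableT _ (mA i.+1)).
  rewrite [X in (_ * X)%E](IH (fun i => A i.+1) B (fun i => mA i.+1) mB) big_ord_recl/= EFinM -muleA fineK// fin_num_measure//.
apply/seteqP; split => t /=.
  move=> [At Bt]; split; first exact: (At 0%N).
  split; last by rewrite -iterSr.
  by move=> i ni; have := At i.+1 ni; rewrite /iid_seq iterSr.
move=> [A0 [At Bt]]; split; last by rewrite -iterS iterSr.
by move=> [|i] ni //; rewrite /iid_seq iterSr; exact: At.
Qed.

End iid.

Lemma seq_prob_exists (R : realType) :
  exists mu : probability (sequence_space (measurableTypeR R)) R,
  forall n (A : nat -> set (measurableTypeR R)), (forall i, measurable (A i)) ->
    mu [set z : nat -> R | forall i, (i < n)%N -> A i (z i)] =
    (\prod_(i < n) circle_prob (A i))%E.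
Proof.
pose f : measurableTypeR R -> sequence_space (measurableTypeR R) := iid_seq.
have mf : measurable_fun setT f.
  apply: (@measurability _ _ _ (sequence_space (measurableTypeR R)) setT f
            (@cylinder _ (measurableTypeR R))); first by [].
  move=> _ [_ [i [A [mA ->]]] <-].
  have mi := measurableT_comp
    (@measurable_split_half R (fun k => odd (k %/ 2)%N)) (measurable_iter_S2 i).
  exact: (mi measurableT _ mA).
pose F : {mfun measurableTypeR R >-> sequence_space (measurableTypeR R)} :=
  @mfun_Sub _ _ _ _ f (mem_set mf).
exists (distribution circle_prob F) => n A mA.
have := iid_seq_box n mA measurableT.
rewrite preimage_setT setIT probability_setT mule1 => E.
rewrite [LHS]E -prodEFin; apply: eq_bigr => i _.
by rewrite fineK// fin_num_measure.
Qed.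

(* The countable product of circle_prob: it is determined by torus_oo_probE,
   since the boxes are stable by intersection and generate the sigma-algebra. *)
Definition torus_oo_prob {R : realType} :
    probability (sequence_space (measurableTypeR R)) R :=
  sval (cid (@seq_prob_exists R)).

Lemma torus_oo_probE (R : realType) n (A : nat -> set (measurableTypeR R)) :
  (forall i, measurable (A i)) ->
  torus_oo_prob [set z : nat -> R | forall i, (i < n)%N -> A i (z i)] =
  (\prod_(i < n) circle_prob (A i))%E.
Proof. exact: (svalP (cid (@seq_prob_exists R))). Qed.

(* Multi-indices of arbitrary length, i.e. finitely supported sequences. *)
Definition mindex := {fsfun nat -> nat with 0%N}.

Definition mdeg (a : mindex) : nat := (\sum_(i <- finsupp a) a i)%N.

Definition monomial (R : realType) (a : mindex) (z : nat -> R[i]) : R[i] :=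
  \prod_(i <- finsupp a) z i ^+ a i.

Section type_cotype.
Context {R : realType} (X : completeNormedModType R[i]).

(* `|x| lives in R[i], where it is real and nonnegative. *)
Definition rnorm (x : X) : R := complex.Re `|x|.

(* The L^2 norm on the N-torus of the function sum_k x_k z_k. *)
Definition linear_L2 (N : nat) (x : 'I_N -> X) : R :=
  Num.sqrt (\int[torus_prob N]_t
    (rnorm (\sum_(k < N) circle_point (tnth t k) *: x k) ^+ 2)).

Definition has_type2 : Prop :=
  exists2 C : R, 0 < C & forall (N : nat) (x : 'I_N -> X),
    linear_L2 x <= C * Num.sqrt (\sum_(k < N) rnorm (x k) ^+ 2).

Definition has_cotype (q : R) : Prop :=
  exists2 C : R, 0 < C & forall (N : nat) (x : 'I_N -> X),
    (\sum_(k < N) rnorm (x k) `^ q) `^ q^-1 <= C * linear_L2 x.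

(* The solution q' of 1 / q + 1 / q' = 1. *)
Definition conj_exponent (q : R) : R := (1 - q^-1)^-1.

(* The vectors x_1, ..., x_N are indexed from 0, hence the powers z ^+ k.+1. *)
Definition has_fourier_cotype (q : R) : Prop :=
  exists2 C : R, 0 < C & forall (N : nat) (x : 'I_N -> X),
    (\sum_(k < N) rnorm (x k) `^ q) `^ q^-1 <=
    C * (\int[circle_prob]_t
          (rnorm (\sum_(k < N) circle_point t ^+ k.+1 *: x k)
             `^ conj_exponent q)) `^ (conj_exponent q)^-1.

(* Only the values of x at multi-indices of degree m matter. *)
Definition has_hyp_cotype (q : R) : Prop :=
  exists2 C : R, 0 < C & forall (m : nat) (x : mindex -> X),
    (0 < m)%N -> finite_set [set a | mdeg a = m /\ x a != 0] ->
    (\sum_(a \in [set a | mdeg a = m]) rnorm (x a) `^ q) `^ q^-1 <=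
    C ^+ m * Num.sqrt (\int[torus_oo_prob]_t
      (rnorm (\sum_(a \in [set a | mdeg a = m])
         monomial a (fun i => circle_point (t i)) *: x a) ^+ 2)).

Definition inf_exponent (p : R -> Prop) : \bar R :=
  ereal_inf [set q%:E | q in [set q : R | 2 <= q /\ p q]].

Definition cot : \bar R := inf_exponent has_cotype.
Definition cot_fourier : \bar R := inf_exponent has_fourier_cotype.
Definition cot_hyp : \bar R := inf_exponent has_hyp_cotype.

End type_cotype.

(* Main.v *)
(* The three exponents satisfy cot <= cot_hyp <= cot_fourier <= cot; type 2 is
   used in the last inequality only.

   The case m = 1 of the hypercontractive inequality is the cotype inequality.
   Substituting z_i w^(M^i) for z_i in a homogeneous polynomial of degree less
   than M turns its monomials into distinct powers of w, so Fourier cotype q,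
   applied in w and averaged over z, gives hypercontractive cotype q, even with
   a constant independent of m.

   Let X have type 2 and cotype q, and let r > q. The law of a Gaussian sum
   sum_k g_k x_k is not changed by a unitary transformation of (x_k). For the
   discrete Fourier transform on Z/L with L = 2^s this is seen on its butterflies,
   which are plane rotations. Cotype q bounds from below the Gaussian average
   of the transform, type 2 bounds from above the one of the original tuple, and so
     (sum_l |y^(l)|^q)^(1/q) <= C L^(1/2) (sum_w |y(w)|^2)^(1/2).
   On Z/p with p prime, let |f| <= 1_A and let L be a power of 2 comparable to
   |A|. For a suitable multiplier a, the set a A falls into L windows of
   length p/L with O(|A|) pairs of points in the same window. On a block of L
   consecutive frequencies the transform of f combines, boundedly, transforms on Z/L
   of sums of f over the windows, so that
     sum_k |f^(k)|^q <= C p |A|^(q-1).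
   Real interpolation with the bound of the sup norm of f^ by the l_1 norm of f
   gives the Fourier cotype inequality with exponent r on Z/p, and its average
   over the translates of the grid of p-th roots of unity gives it on the circle. *)
Require Import Defs.
From HB Require Import structures.
From mathcomp Require Import all_boot all_order all_algebra finmap.
From mathcomp Require Import all_classical all_reals all_analysis.
From mathcomp Require Import measurable_realfun complex.
From mathcomp Require Import zify ring lra.

Set Implicit Arguments.
Unset Strict Implicit.
Unset Printing Implicit Defensive.
Import Order.TTheory GRing.Theory Num.Theory.
Import numFieldTopology.Exports numFieldNormedType.Exports.

Local Open Scope classical_set_scope.
Local Open Scope ring_scope.

(** Circle averages are not invariant under unitary maps, Gaussian averages are; the passage between
    them may cost only a constant. A complex Gaussian is a modulus times an independent phase, and
    the modulus can be moved into the vector, so a bound that is linear in the squared norms of the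
    vectors integrates exactly and brings in only a second moment. Type 2 has this form. Cotype q
    does not, and is first linearized by fixed Hoelder weights. On Z/p itself the transform bound
    would give p^(1/2) |A|^(1/2), while p^(1/q) |A|^(1-1/q) is needed: for q > 2 the two agree only
    if |A| is comparable to p. The hashing creates this favourable case on a group of size L ~ |A|,
    where each of the O(p/L) blocks of frequencies gives O(|A|^q). The prime modulus makes
    multiplication by a nonzero residue a permutation, of the points as of the frequencies. The
    bound obtained concerns functions dominated by an indicator. Passing to all functions through
    dyadic level sets costs an arbitrarily small increase of the exponent, which infima do not
    see. *)

Section real_complex.
Context {R : realType}.
Implicit Types a b : R.

Lemma realCD a b : (a + b)%:C%C = a%:C%C + b%:C%C.
Proof. exact: (rmorphD (real_complex R)). Qed.

Lemma realCM a b : (a * b)%:C%C = a%:C%C * b%:C%C.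
Proof. exact: (rmorphM (real_complex R)). Qed.

End real_complex.

(** * Real-valued norms and points of the circle *)

Section rnorm_theory.
Context {R : realType} (X : completeNormedModType R[i]).
Implicit Types (x y : X) (a : R[i]) (r : R).

Lemma rnormE x : `|x| = (rnorm x)%:C%C.
Proof. by rewrite /rnorm RRe_real// normr_real. Qed.

Lemma rnorm_ge0 x : 0 <= rnorm x.
Proof. by rewrite -(@ler0c R) -rnormE. Qed.

Lemma rnormD x y : rnorm (x + y) <= rnorm x + rnorm y.
Proof. by rewrite -(@lecR R) realCD -!rnormE ler_normD. Qed.

Lemma rnorm0 : rnorm (0 : X) = 0.
Proof. by rewrite /rnorm normr0. Qed.

Lemma rnormN x : rnorm (- x) = rnorm x.
Proof. by rewrite /rnorm normrN. Qed.

Lemma rnorm_eq0 x : (rnorm x == 0) = (x == 0).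
Proof. by rewrite -[RHS]normr_eq0 rnormE; apply/eqP/eqP => [->//|/(@complexI R)]. Qed.

Lemma rnormZ a x : rnorm (a *: x) = complex.Re `|a| * rnorm x.
Proof.
apply: (@complexI R); rewrite realCM -!rnormE normrZ RRe_real//.
Qed.

Lemma rnormZr r x : rnorm (r%:C%C *: x) = `|r| * rnorm x.
Proof. by rewrite rnormZ normc_def /= expr0n addr0 sqrtr_sqr. Qed.

Lemma rnormZ1 a x : `|a| = 1 -> rnorm (a *: x) = rnorm x.
Proof. by move=> a1; rewrite rnormZ a1 mul1r. Qed.

Lemma rnormB x y : `|rnorm x - rnorm y| <= rnorm (x - y).
Proof.
rewrite ler_norml; apply/andP; split.
  rewrite lerNl opprB lerBlDr -[rnorm (x - y)]rnormN opprB.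
  by have := rnormD (y - x) x; rewrite subrK.
by rewrite lerBlDr; have := rnormD (x - y) y; rewrite subrK.
Qed.

Lemma rnorm_sum (I : Type) (s : seq I) (P : pred I) (F : I -> X) :
  rnorm (\sum_(i <- s | P i) F i) <= \sum_(i <- s | P i) rnorm (F i).
Proof.
elim/big_rec2: _ => [|i r y _ h]; first by rewrite rnorm0.
by rewrite (le_trans (rnormD _ _))// lerD2l.
Qed.

End rnorm_theory.

Section circle_theory.
Context {R : realType}.
Implicit Types (s t : R).
Local Notation e := (@circle_point R).

Lemma circle_pointD s t : e (s + t) = e s * e t.
Proof. by rewrite /circle_point mulrDr cosD sinD; congr Complex; rewrite addrC mulrC. Qed.

Lemma circle_point0 : e 0 = 1.
Proof. by rewrite /circle_point mulr0 cos0 sin0. Qed.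

Lemma circle_point1 : e 1 = 1.
Proof. by rewrite /circle_point mulr1 mulr_natl -[_ *+ 2]add0r cosD2pi sinD2pi cos0 sin0. Qed.

Lemma circle_pointMn t n : e (t *+ n) = e t ^+ n.
Proof.
elim: n => [|n IH]; first by rewrite mulr0n circle_point0.
by rewrite mulrS circle_pointD IH exprS.
Qed.

Lemma circle_point_nat n : e n%:R = 1.
Proof. by rewrite circle_pointMn circle_point1 expr1n. Qed.

Lemma norm_circle_point t : `|e t| = 1.
Proof. by rewrite normc_def /= cos2Dsin2 sqrtr1. Qed.

Lemma circle_point_neq0 t : e t != 0.
Proof. by rewrite -normr_gt0 norm_circle_point. Qed.

Lemma cos_lipschitz s t : `|cos s - cos t| <= `|s - t|.
Proof.
wlog st : s t / s <= t => [h|].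
  by have [/h//|/ltW/h] := leP s t; rewrite distrC [leRHS]distrC.
have [c _ h] := @MVT_segment R cos (-%R \o sin) s t st
  (fun x _ => is_derive_cos x) (continuous_subspaceT (@continuous_cos R)).
by rewrite distrC h normrM [leRHS]distrC ler_piMl// normrN ler_norml sin_geN1 sin_le1.
Qed.

Lemma circle_point_lipschitz s t :
  complex.Re `|e s - e t| <= 4 * pi * `|s - t|.
Proof.
(* The sine is a shifted cosine, and a modulus is at most the sum of the moduli of the two parts:
   hence 4 pi instead of the sharp 2 pi. *)
have sinE (x : R) : sin x = cos (x - pi / 2) by rewrite cosBpihalf.
have aux (a b : R) : complex.Re `|(a +i* b)%C| <= `|a| + `|b|.
  rewrite normc_def /= -[leRHS]ger0_norm ?addr_ge0// -sqrtr_sqr ler_wsqrtr//.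
  rewrite -(real_normK (num_real a)) -(real_normK (num_real b)).
  have := normr_ge0 a; have := normr_ge0 b; nra.
apply: le_trans (aux _ _) _; rewrite !sinE.
apply: le_trans (lerD (cos_lipschitz _ _) (cos_lipschitz _ _)) _.
have -> : 2 * pi * s - pi / 2 - (2 * pi * t - pi / 2) = 2 * pi * (s - t) :> R by ring.
rewrite -mulrBr normrM ger0_norm ?mulr_ge0 ?pi_ge0//; lra.
Qed.

End circle_theory.

(** * Averages along measurable curves *)

(** A Caratheodory argument: rounding [phi] down to multiples of 1/(k+1) leaves only countably many
    sections [g ^~ a], and the Lipschitz bound makes the rounded compositions converge as k
    grows. *)
Lemma lipschitz_measurable d (T : measurableType d) (R : realType)
    (g : T -> R -> R) (K : R) (phi : T -> R) :
  (forall a, measurable_fun setT (g ^~ a)) ->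
  (forall t a b, `|g t a - g t b| <= K * `|a - b|) ->
  measurable_fun setT phi -> measurable_fun setT (fun t => g t (phi t)).
Proof.
move=> mg lip mphi.
pose fl k t := Num.floor (k.+1%:R * phi t).
pose phik k t : R := (fl k t)%:~R / k.+1%:R.
apply: (@measurable_fun_cvg _ _ _ setT (fun k t => g t (phik k t))).
  move=> k _ Y mY; rewrite setTI.
  rewrite (_ : _ @^-1` Y = \bigcup_(z : int)
    ((phi @^-1` `[z%:~R / k.+1%:R, (z + 1)%:~R / k.+1%:R[) `&`
     ((g ^~ (z%:~R / k.+1%:R)) @^-1` Y))).
    apply: countable_bigcupT_measurable => // z; apply: measurableI.
      by rewrite -[X in measurable X]setTI; apply: mphi => //; exact: measurable_itv.
    by rewrite -[X in measurable X]setTI; exact: mg.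
  have flE t z : `[z%:~R / k.+1%:R, (z + 1)%:~R / k.+1%:R[%classic (phi t) <->
      fl k t = z.
    rewrite /= in_itv/= ler_pdivrMr// ltr_pdivlMr// ![phi t * _]mulrC.
    split; first exact: floor_def.
    by move=> <-; exact: floor_itv.
  apply/seteqP; split => [t /= Yt|t [z _ [/= /flE fz]]].
    by exists (fl k t) => //; split => //; apply/flE.
  by rewrite /phik fz.
move=> t _.
have hK : `|K| * harmonic k @[k --> \oo] --> (0 : R).
  by rewrite -(mulr0 `|K|); apply: cvgMr; exact: cvg_harmonic.
apply/cvgrPdist_le => e e0.
move/cvgrPdist_le : hK => /(_ _ e0); apply: filterS => k.
rewrite sub0r normrN => /(le_trans (ler_norm _)) /(le_trans _) -> //.
apply: le_trans (lip _ _ _) _.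
apply: le_trans (ler_wpM2r _ (ler_norm K)) _ => //.
rewrite ler_wpM2l// /phik /=.
have /andP[f1 f2] := floor_itv (k.+1%:R * phi t).
have -> : phi t - (fl k t)%:~R / k.+1%:R =
   (k.+1%:R * phi t - (fl k t)%:~R) / k.+1%:R by rewrite mulrBl mulrAC divff ?mul1r// pnatr_eq0.
rewrite normrM normfV normr_nat ler_pdivrMr// mulVf ?pnatr_eq0//.
move: f1 f2; rewrite -/(fl k t) intrD => *.
by rewrite ler_norml; apply/andP; split; lra.
Qed.

Section curves.
Context {R : realType} (X : completeNormedModType R[i]).

Definition cmeasurable d (T : measurableType d) (f : T -> R[i]) :=
  measurable_fun setT (fun t => complex.Re (f t)) /\
  measurable_fun setT (fun t => complex.Im (f t)).

(* Maps into a finite dimensional subspace of X, with measurable coordinates: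
   there is no sigma-algebra on X, functions on X are tested along them. *)
Inductive curve d (T : measurableType d) : (T -> X) -> Prop :=
| curve_cst v : curve (fun=> v)
| curve_add (g : T -> X) (f : T -> R) (u : X) : curve g -> measurable_fun setT f ->
    curve (fun t => g t + (f t)%:C%C *: u).

(** The class of test functions is stable under the averages below. Nonnegativity belongs to it so
    that these averages always exist in the extended reals and commute by Tonelli's theorem. *)
Definition curve_measurable (h : X -> \bar R) := (forall v, 0 <= h v)%E /\
  forall d (T : measurableType d) (g : T -> X), curve g ->
    measurable_fun setT (fun t => h (g t)).

Lemma curve_comp d d' (T : measurableType d) (T' : measurableType d')
    (g : T -> X) (p : T' -> T) :
  curve g -> measurable_fun setT p -> curve (fun t => g (p t)).
Proof.
move=> cg mp; elim: cg => [v|{}g f u _ IH mf]; first exact: curve_cst.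
exact: (curve_add u IH (measurableT_comp mf mp)).
Qed.

Lemma curveD d (T : measurableType d) (g g' : T -> X) :
  curve g -> curve g' -> curve (fun t => g t + g' t).
Proof.
move=> cg; elim => [v|{}g' f u _ IH mf].
  rewrite (_ : (fun t => _) = fun t => g t + (cst 1 t : R)%:C%C *: v).
    exact: curve_add.
  by apply/funext => t; rewrite /= scale1r.
rewrite (_ : (fun t => _) = fun t => (g t + g' t) + (f t)%:C%C *: u).
  exact: curve_add.
by apply/funext => t; rewrite addrA.
Qed.

Lemma curveZ d (T : measurableType d) (f : T -> R[i]) (u : X) :
  cmeasurable f -> curve (fun t => f t *: u).
Proof.
move=> [mr mi].
rewrite (_ : (fun t => _) = fun t => (0 + (complex.Re (f t))%:C%C *: u) +
    (complex.Im (f t))%:C%C *: ('i%C *: u)).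
  exact: curve_add (curve_add _ (curve_cst _ _) mr) mi.
apply/funext => t; rewrite add0r scalerA -scalerDl; congr (_ *: _).
by rewrite [LHS]complexE mulrC.
Qed.

Lemma curve_sum d (T : measurableType d) (I : Type) (s : seq I) (P : pred I)
    (F : I -> T -> X) :
  (forall i, curve (F i)) -> curve (fun t => \sum_(i <- s | P i) F i t).
Proof.
move=> cF; elim: s => [|i s IH].
  rewrite (_ : (fun t => _) = fun=> 0); first exact: curve_cst.
  by apply/funext => t; rewrite big_nil.
have [Pi|Pi] := boolP (P i).
  rewrite (_ : (fun t => _) = fun t => F i t + \sum_(i <- s | P i) F i t).
    exact: curveD.
  by apply/funext => t; rewrite big_cons Pi.
rewrite (_ : (fun t => _) = fun t => \sum_(i <- s | P i) F i t) //.
by apply/funext => t; rewrite big_cons (negbTE Pi).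
Qed.

Lemma measurable_rnorm_curve d (T : measurableType d) (g : T -> X) :
  curve g -> measurable_fun setT (fun t => rnorm (g t)).
Proof.
move=> cg.
(* The free vector [v] absorbs the last term of the curve once its coefficient is frozen to a
   constant, which is what the induction hypothesis must accept. *)
suff: forall v, measurable_fun setT (fun t => rnorm (g t + v)).
  by move=> /(_ 0); under eq_fun do rewrite addr0.
elim: cg => [u|{}g f u _ IH mf] v; first exact: measurable_cst.
apply: (@lipschitz_measurable _ _ _
  (fun t a => rnorm (g t + a%:C%C *: u + v)) (rnorm u)) => //.
  by move=> a; under eq_fun do rewrite -addrA; exact: IH.
move=> t a b; apply: le_trans (rnormB _ _) _.
rewrite opprD addrACA subrr addr0 opprD addrACA subrr add0r -scalerBl.
by rewrite -rmorphB rnormZr mulrC.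
Qed.

Lemma curve_measurable_powR (p : R) :
  curve_measurable (fun v => (rnorm v `^ p)%:E).
Proof.
split=> [v|d T g cg]; first by rewrite lee_fin powR_ge0.
apply/measurable_EFinP.
by apply: (measurableT_comp (measurable_powR p)); exact: measurable_rnorm_curve.
Qed.

Lemma curve_measurable_sqr : curve_measurable (fun v => (rnorm v ^+ 2)%:E).
Proof.
split=> [v|d T g cg]; first by rewrite lee_fin sqr_ge0.
by apply/measurable_EFinP/measurable_funX; exact: measurable_rnorm_curve.
Qed.

End curves.

Section averages.
Context {R : realType} (X : completeNormedModType R[i]).

(** The weight [w] is a density with respect to [rho], so that Gaussian averages (Lebesgue measure
    with the normal density) and circle averages (weight 1) are instances of one operator. *)
Definition avg d (O : measurableType d) (rho : {measure set O -> \bar R})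
    (w : O -> R) (phi : O -> R[i]) (y : X) (h : X -> \bar R) (v : X) : \bar R :=
  (\int[rho]_t ((w t)%:E * h (v + phi t *: y)%R))%E.

(** A curve on T and the direction [phi t *: y] form a curve on the product space, to which
    Tonelli's theorem applies; this is why curves are allowed on arbitrary measurable spaces. *)
Lemma curve_measurable_avg d (O : measurableType d)
    (rho : {sigma_finite_measure set O -> \bar R}) (w : O -> R) (phi : O -> R[i])
    (y : X) (h : X -> \bar R) :
  measurable_fun setT w -> (forall t, 0 <= w t) -> cmeasurable phi ->
  curve_measurable h -> curve_measurable (avg rho w phi y h).
Proof.
move=> mw w0 mphi [h0 mh]; split=> [v|d' T g cg].
  by apply: integral_ge0 => t _; rewrite mule_ge0// lee_fin.
pose f (p : T * O) := ((w p.2)%:E * h (g p.1 + phi p.2 *: y)%R)%E.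
apply: (@measurable_fun_fubini_tonelli_F _ _ _ _ _ rho f) => /=.
  apply: emeasurable_funM.
    by apply/measurable_EFinP; exact: measurableT_comp mw measurable_snd.
  apply: mh; apply: curveD; first exact: curve_comp cg measurable_fst.
  apply: (curve_comp (g := fun t => phi t *: y)) measurable_snd.
  exact: curveZ.
by move=> p; rewrite mule_ge0// lee_fin.
Qed.

Lemma avgC d d' (O : measurableType d) (O' : measurableType d')
    (rho : {sigma_finite_measure set O -> \bar R})
    (rho' : {sigma_finite_measure set O' -> \bar R})
    (w : O -> R) (phi : O -> R[i]) (w' : O' -> R) (phi' : O' -> R[i])
    (y y' : X) (h : X -> \bar R) (v : X) :
  measurable_fun setT w -> (forall t, 0 <= w t) -> cmeasurable phi ->
  measurable_fun setT w' -> (forall t, 0 <= w' t) -> cmeasurable phi' ->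
  curve_measurable h ->
  avg rho w phi y (avg rho' w' phi' y' h) v =
  avg rho' w' phi' y' (avg rho w phi y h) v.
Proof.
move=> mw w0 mphi mw' w'0 mphi' [h0 mh].
pose f (p : O * O') :=
  ((w p.1 * w' p.2)%R%:E * h (v + phi p.1 *: y + phi' p.2 *: y')%R)%E.
have mc1 : measurable_fun setT (fun p : O * O' => h (v + phi p.1 *: y + phi' p.2 *: y')%R).
  apply: mh; apply: curveD.
    apply: curveD; first exact: curve_cst.
    by apply: (curve_comp (g := fun t => phi t *: y)) measurable_fst; exact: curveZ.
  by apply: (curve_comp (g := fun t => phi' t *: y')) measurable_snd; exact: curveZ.
have := @fubini_tonelli _ _ _ _ _ rho rho' f; rewrite /f /=.
move=> E; rewrite /avg.
transitivity (\int[rho]_x \int[rho']_y0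
    ((w x * w' y0)%R%:E * h (v + phi x *: y + phi' y0 *: y')%R))%E.
  apply: eq_integral => x _; rewrite -ge0_integralZl//=.
  - by apply: eq_integral => z _; rewrite EFinM muleA.
  - apply: emeasurable_funM; first exact/measurable_EFinP.
    apply: mh; apply: curveD; first exact: curve_cst.
    exact: curveZ.
  - by move=> z _; rewrite mule_ge0// lee_fin.
  - by rewrite lee_fin.
etransitivity; first apply: E.
- apply: emeasurable_funM => //; apply/measurable_EFinP.
  apply: measurable_funM; first exact: measurableT_comp mw measurable_fst.
  exact: measurableT_comp mw' measurable_snd.
- by move=> p; rewrite mule_ge0// lee_fin mulr_ge0.
- apply: eq_integral => x _; rewrite -ge0_integralZl//=.
  + apply: eq_integral => z _; rewrite EFinM muleA addrAC; congr (_ * _)%E.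
    by rewrite muleC.
  + apply: emeasurable_funM; first exact/measurable_EFinP.
    apply: mh; apply: curveD; first exact: curve_cst.
    exact: curveZ.
  + by move=> z _; rewrite mule_ge0// lee_fin.
  + by rewrite lee_fin.
Qed.

End averages.

(** * Gaussian averages and the discrete Fourier transform *)

Section lebesgue_rotation.
Context {R : realType}.
Local Notation mu := (@lebesgue_measure R).
Local Notation mR := (measurableTypeR R).

Lemma measurable_addr (c : R) :
  measurable_fun setT ((fun x => x + c) : mR -> mR).
Proof. exact: measurable_funD. Qed.

Lemma lebesgue_measure_translate (c : R) (A : set mR) : measurable A ->
  mu A = pushforward mu ((fun x => x + c) : mR -> mR) A.
Proof.
move=> mA.
have mc := measurable_addr c.
pose nu : {measure set mR -> \bar R} := pushforward mu ((fun x => x + c) : mR -> mR).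
refine (@lebesgue_measure_unique R (nu mc) _ _ mA) => _ [[a b] /= _ <-].
rewrite /nu /= /pushforward /=.
rewrite (_ : _ @^-1` _ = `]a - c, b - c]%classic).
  rewrite !lebesgue_measure_itv/= !lte_fin ltrD2r; case: ifP => // _.
  by rewrite -!EFinB opprB addrA subrK.
by apply/seteqP; split => x /=; rewrite !in_itv/= ltrBlDr lerBrDr.
Qed.

Lemma ge0_integral_translate (c : R) (f : mR -> \bar R) :
  measurable_fun setT f -> (forall x, 0 <= f x)%E ->
  (\int[mu]_x f (x + c)%R = \int[mu]_x f x)%E.
Proof.
move=> mf f0; have mc := measurable_addr c.
rewrite [RHS](eq_measure_integral
  (pushforward mu ((fun x => x + c) : mR -> mR))); last first.
  by move=> A mA _; exact: lebesgue_measure_translate.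
by rewrite ge0_integral_pushforward.
Qed.

Let I (G : mR * mR -> \bar R) : \bar R := (\int[mu]_x \int[mu]_y G (x, y))%E.

Let shearx (t : R) (p : mR * mR) : mR * mR := (p.1 + t * p.2, p.2).
Let sheary (t : R) (p : mR * mR) : mR * mR := (p.1, p.2 + t * p.1).

Let mshearx t : measurable_fun setT (shearx t).
Proof.
apply/measurable_fun_pairP; split; last exact: measurable_snd.
apply: measurable_funD; first exact: measurable_fst.
by apply: measurable_funM => //; exact: measurable_snd.
Qed.

Let msheary t : measurable_fun setT (sheary t).
Proof.
apply/measurable_fun_pairP; split; first exact: measurable_fst.
apply: measurable_funD; first exact: measurable_snd.
by apply: measurable_funM => //; exact: measurable_fst.
Qed.

Let I_sheary t G : measurable_fun setT G -> (forall p, 0 <= G p)%E ->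
  I (G \o sheary t) = I G.
Proof.
move=> mG G0; apply: eq_integral => x _.
rewrite -(ge0_integral_translate (t * x) (f := fun y => G (x, y)))//.
exact: measurable_fun_pair2.
Qed.

Let I_shearx t G : measurable_fun setT G -> (forall p, 0 <= G p)%E ->
  I (G \o shearx t) = I G.
Proof.
move=> mG G0; rewrite /I (fubini_tonelli (G \o shearx t)).
- rewrite (fubini_tonelli G mG G0); apply: eq_integral => y _.
  rewrite -(ge0_integral_translate (t * y) (f := fun x => G (x, y)))//.
  exact: measurable_fun_pair1.
- exact: measurableT_comp mG (mshearx t).
- by move=> p; exact: G0.
Qed.

(* A rotation of angle other than pi is a product of three shears. *)
Lemma integral_rotation (c s : R) (G : mR * mR -> \bar R) :
  c ^+ 2 + s ^+ 2 = 1 -> 1 + c != 0 ->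
  measurable_fun setT G -> (forall p, 0 <= G p)%E ->
  (\int[mu]_x \int[mu]_y G (c * x - s * y, s * x + c * y)%R =
   \int[mu]_x \int[mu]_y G (x, y))%E.
Proof.
(* If c and s are the cosine and sine of an angle, [t] is minus the tangent of the half angle,
   infinite exactly at angle pi. *)
move=> cs c1 mG G0; pose t := - (s / (1 + c)).
have mG1 := measurableT_comp mG (mshearx t).
have mG2 := measurableT_comp mG1 (msheary s).
have E3 := @I_shearx t _ mG2 (fun p => G0 _).
have E2 := @I_sheary s _ mG1 (fun p => G0 _).
have E1 := @I_shearx t _ mG G0.
apply: (eq_trans _ (eq_trans E3 (eq_trans E2 E1))).
apply: eq_integral => x _; apply: eq_integral => y _.
rewrite /= /sheary /shearx /=.
have e1 : 1 + s * t = c.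
  have : (1 + c) * (1 + s * t - c) = 1 - c ^+ 2 - s ^+ 2 by rewrite /t; field.
  have -> : 1 - c ^+ 2 - s ^+ 2 = 0 by rewrite -cs; ring.
  by move/eqP; rewrite mulf_eq0 (negbTE c1)/= subr_eq0 => /eqP.
have e2 : 2 * t + t ^+ 2 * s = - s.
  have -> : 2 * t + t ^+ 2 * s = t * (1 + (1 + s * t)) by ring.
  by rewrite e1 /t; field.
congr (G (_, _)).
  rewrite -e1 -[- (s * y)]mulNr -e2; ring.
rewrite -e1; ring.
Qed.

End lebesgue_rotation.

Section gaussian_averages.
Context {R : realType} (X : completeNormedModType R[i]).
Local Notation mR := (measurableTypeR R).
Implicit Types (u w y v : X) (h : X -> \bar R) (s : seq X).

Let pdf : R -> R := normal_pdf 0 1.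

Let pdf_ge0 x : 0 <= pdf x. Proof. exact: normal_pdf_ge0. Qed.

Let mpdf : measurable_fun setT (pdf : mR -> R).
Proof. exact: measurable_normal_pdf. Qed.

Lemma cmeasurable_real :
  cmeasurable ((fun a => a%:C%C) : mR -> R[i]).
Proof. by split => /=; [exact: measurable_id|exact: measurable_cst]. Qed.

Definition gavg (y : X) (h : X -> \bar R) : X -> \bar R :=
  avg (@lebesgue_measure R) (normal_pdf 0 1) (fun a => a%:C%C) y h.

Lemma curve_measurable_gavg y h :
  curve_measurable h -> curve_measurable (gavg y h).
Proof. by move=> mh; apply: curve_measurable_avg => //; exact: cmeasurable_real. Qed.

Lemma gavgC u w h : curve_measurable h -> gavg u (gavg w h) = gavg w (gavg u h).
Proof.
move=> mh; apply/funext => v.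
by apply: avgC => //; exact: cmeasurable_real.
Qed.

Let pdf_rot (c s x y : R) : c ^+ 2 + s ^+ 2 = 1 ->
  pdf (c * x - s * y) * pdf (s * x + c * y) = pdf x * pdf y.
Proof.
move=> cs; rewrite /pdf normal_pdfE ?oner_neq0// /normal_fun !subr0.
rewrite [LHS]mulrACA [RHS]mulrACA -!expRD; congr (_ * expR _).
rewrite -!mulNr -!mulrDl; congr (_ / _).
rewrite -[RHS]mulr1 -cs; ring.
Qed.

Lemma gavg_gavgE u w h v : curve_measurable h ->
  gavg u (gavg w h) v = (\int[lebesgue_measure]_a \int[lebesgue_measure]_b
    ((pdf a * pdf b)%R%:E * h (v + a%:C%C *: u + b%:C%C *: w)%R))%E.
Proof.
move=> [h0 mh]; apply: eq_integral => a _; rewrite -ge0_integralZl//=.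
- by apply: eq_integral => b _; rewrite EFinM muleA.
- apply: emeasurable_funM; first exact/measurable_EFinP.
  apply: mh; apply: curveD; first exact: curve_cst.
  exact: curveZ cmeasurable_real.
- by move=> b _; rewrite mule_ge0// lee_fin.
- by rewrite lee_fin.
Qed.

(** The product of two normal densities depends only on x^2 + y^2, and Lebesgue measure on the plane
    is rotation invariant. *)
Let gavg_rotation0 (c s : R) u w h : c ^+ 2 + s ^+ 2 = 1 -> 1 + c != 0 ->
  curve_measurable h ->
  gavg (c%:C%C *: u + s%:C%C *: w) (gavg (- s%:C%C *: u + c%:C%C *: w) h) =
  gavg u (gavg w h).
Proof.
move=> cs c1 mh; apply/funext => v.
rewrite (gavg_gavgE _ _ v mh).
rewrite (gavg_gavgE _ _ v mh).
pose G (p : mR * mR) :=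
  ((pdf p.1 * pdf p.2)%R%:E * h (v + p.1%:C%C *: u + p.2%:C%C *: w)%R)%E.
have mG : measurable_fun setT G.
  case: mh => h0 mh; apply: emeasurable_funM.
    apply/measurable_EFinP; apply: measurable_funM.
      exact: measurableT_comp mpdf measurable_fst.
    exact: measurableT_comp mpdf measurable_snd.
  apply: mh; apply: curveD.
    apply: curveD; first exact: curve_cst.
    apply: (curve_comp (g := fun t : mR => t%:C%C *: u)) measurable_fst.
    exact: curveZ cmeasurable_real.
  apply: (curve_comp (g := fun t : mR => t%:C%C *: w)) measurable_snd.
  exact: curveZ cmeasurable_real.
have G0 p : (0 <= G p)%E.
  by case: mh => h0 _; rewrite mule_ge0// lee_fin mulr_ge0.
apply: (eq_trans _ (integral_rotation cs c1 mG G0)).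
apply: eq_integral => x _; apply: eq_integral => y _.
rewrite /G /= pdf_rot//; congr (_ * h _)%E.
rewrite -!addrA; congr (_ + _); rewrite !scalerDr !scalerA addrACA -!scalerDl.
congr (_ *: _ + _ *: _); rewrite realCD !realCM ?rmorphN /= ?realCM.
  by rewrite mulrN mulrC [y%:C%C * _]mulrC.
by rewrite mulrC [y%:C%C * _]mulrC.
Qed.

Let real0C : (0 : R)%:C%C = 0. Proof. by []. Qed.
Let real1C : (1 : R)%:C%C = 1. Proof. by []. Qed.

Lemma gavg_rotation (c s : R) u w h : c ^+ 2 + s ^+ 2 = 1 ->
  curve_measurable h ->
  gavg (c%:C%C *: u + s%:C%C *: w) (gavg (- s%:C%C *: u + c%:C%C *: w) h) =
  gavg u (gavg w h).
Proof.
move=> cs mh; have [c1|c1] := eqVneq (1 + c) 0; last exact: gavg_rotation0.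
have cE : c = - 1 by lra.
have sE : s = 0.
  by apply/eqP; rewrite -sqrf_eq0; apply/eqP; move: cs; rewrite cE; lra.
(* The half turn, excluded from the decomposition into shears, is the square of the quarter turn. *)
have quarter (u' w' : X) : gavg w' (gavg (- u') h) = gavg u' (gavg w' h).
  have := @gavg_rotation0 0 1 u' w' h.
  rewrite real0C real1C !scale0r !addr0 add0r scaleNr !scale1r; apply => //.
    by rewrite expr0n add0r expr1n.
rewrite cE sE real0C !scale0r oppr0 !scale0r addr0 add0r.
rewrite (_ : (-1)%:C%C = -1); last by rewrite rmorphN.
by rewrite !scaleN1r quarter quarter.
Qed.

Definition gavgs s h : X -> \bar R := foldr gavg h s.

Lemma curve_measurable_gavgs s h :
  curve_measurable h -> curve_measurable (gavgs s h).
Proof. by move=> mh; elim: s => //= y s IH; exact: curve_measurable_gavg. Qed.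

Lemma gavgs_cat s1 s2 h : gavgs (s1 ++ s2) h = gavgs s1 (gavgs s2 h).
Proof. exact: foldr_cat. Qed.

Lemma gavgsC s1 s2 h : curve_measurable h ->
  gavgs s1 (gavgs s2 h) = gavgs s2 (gavgs s1 h).
Proof.
elim: s1 s2 h => //= y s1 IH s2 h mh; rewrite IH//.
elim: s2 => //= z s2 IH2; rewrite gavgC; last first.
  by do 2 apply: curve_measurable_gavgs.
by rewrite IH2.
Qed.

Lemma gavgs_perm s1 s2 h : curve_measurable h -> perm_eq s1 s2 ->
  gavgs s1 h = gavgs s2 h.
Proof.
move=> mh; apply: (catCA_perm_subst (F := fun s => gavgs s h)) => t1 t2 t3.
by rewrite !gavgs_cat gavgsC//; exact: curve_measurable_gavgs.
Qed.

(* Tuples with the same Gaussian averages, i.e. defining Gaussian vectors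
   of X with the same law. *)
Definition gequiv s1 s2 := forall h, curve_measurable h -> gavgs s1 h = gavgs s2 h.

Lemma gequiv_sym s1 s2 : gequiv s1 s2 -> gequiv s2 s1.
Proof. by move=> e h mh; rewrite e. Qed.

Lemma gequiv_trans s2 s1 s3 : gequiv s1 s2 -> gequiv s2 s3 -> gequiv s1 s3.
Proof. by move=> e1 e2 h mh; rewrite e1// e2. Qed.

Lemma gequiv_perm s1 s2 : perm_eq s1 s2 -> gequiv s1 s2.
Proof. by move=> p h mh; exact: gavgs_perm. Qed.

Lemma gequiv_cat s1 s2 t1 t2 : gequiv s1 s2 -> gequiv t1 t2 ->
  gequiv (s1 ++ t1) (s2 ++ t2).
Proof.
move=> e1 e2 h mh; rewrite !gavgs_cat e1 ?e2//.
exact: curve_measurable_gavgs.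
Qed.

Lemma gequiv_rotation (c s : R) u w : c ^+ 2 + s ^+ 2 = 1 ->
  gequiv [:: c%:C%C *: u + s%:C%C *: w; - s%:C%C *: u + c%:C%C *: w] [:: u; w].
Proof. by move=> cs h mh /=; rewrite gavg_rotation. Qed.

(* The two real directions of a complex Gaussian variable times y. *)
Definition cpair y : seq X := [:: y; 'i%C *: y].

(** Multiplication by a unit complex number is a rotation of the pair y, iy. This is the reason for
    working with complex Gaussians. *)
Lemma gequiv_phase (t : R) y : gequiv (cpair (circle_point t *: y)) (cpair y).
Proof.
have := @gequiv_rotation (cos (2 * pi * t)) (sin (2 * pi * t)) y ('i%C *: y)
  (cos2Dsin2 _).
apply: gequiv_trans; rewrite /cpair /circle_point.
set c := cos _; set s := sin _.
have -> : c%:C%C *: y + s%:C%C *: ('i%C *: y) = (c +i* s)%C *: y.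
  by rewrite scalerA -scalerDl; congr (_ *: _); rewrite [RHS]complexE/= mulrC.
have -> : - s%:C%C *: y + c%:C%C *: ('i%C *: y) = 'i%C *: ((c +i* s)%C *: y).
  rewrite !scalerA -scalerDl; congr (_ *: _).
  by rewrite [(c +i* s)%C]complexE/= mulrDr mulrA -expr2 sqr_i mulN1r addrC mulrC.
exact: gequiv_perm.
Qed.

Let r2 : R := (Num.sqrt 2)^-1.

(** A rotation by pi/4 of the pair w, u, performed once on the vectors and once on their multiples
    by i. The order w, u gives the second output the sign of u - w. *)
Lemma gequiv_butterfly u w :
  gequiv (cpair (r2%:C%C *: (u + w)) ++ cpair (r2%:C%C *: (u - w)))
         (cpair u ++ cpair w).
Proof.
have r22 : r2 ^+ 2 + r2 ^+ 2 = 1.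
  by rewrite /r2 exprVn sqr_sqrtr//; lra.
have rot u' w' : gequiv [:: r2%:C%C *: (u' + w'); r2%:C%C *: (u' - w')] [:: u'; w'].
  apply: gequiv_trans (_ : gequiv [:: w'; u'] _); last first.
    by apply: gequiv_perm; apply/permP => q /=; lia.
  apply: gequiv_trans (gequiv_rotation w' u' r22).
  by rewrite scalerDr scalerBr addrC [- _ *: _ + _]addrC scaleNr.
have p a b : perm_eq (cpair a ++ cpair b) ([:: a; b] ++ [:: 'i%C *: a; 'i%C *: b]).
  by apply/permP => q /=; lia.
apply: gequiv_trans (gequiv_perm (p _ _)) _.
apply: gequiv_trans; last first.
  by apply: gequiv_perm; rewrite perm_sym; exact: p.
apply: gequiv_cat; first exact: rot.
rewrite !['i%C *: (r2%:C%C *: _)]scalerA mulrC -!scalerA scalerDr scalerBr.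
exact: rot.
Qed.

End gaussian_averages.

Section fourier_gaussian.
Context {R : realType} (X : completeNormedModType R[i]).
Implicit Types (y z : nat -> X).
Local Notation e := (@circle_point R).

(** Unnormalized and defined at all natural frequencies, so that halving, cutting into blocks and
    multipliers act on frequencies by plain arithmetic. *)
Definition dft (n : nat) (y : nat -> X) (l : nat) : X :=
  \sum_(0 <= w < n) e ((w * l)%:R / n%:R) *: y w.

Definition cpairs (f : nat -> X) n : seq X :=
  flatten [seq cpair (f l) | l <- iota 0 n].

Lemma cpairsS f n : cpairs f n.+1 = cpairs f n ++ cpair (f n).
Proof. by rewrite /cpairs -addn1 iotaD map_cat flatten_cat. Qed.

Lemma cpairsD f m n : cpairs f (m + n) = cpairs f m ++ cpairs (fun l => f (m + l)%N) n.
Proof.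
elim: n => [|n IH]; first by rewrite addn0 cats0.
by rewrite addnS !cpairsS IH catA.
Qed.

Lemma eq_cpairs f g n : (forall l, (l < n)%N -> f l = g l) -> cpairs f n = cpairs g n.
Proof.
move=> fg; congr flatten; apply/eq_in_map => l; rewrite mem_iota => /andP[_ ln].
by rewrite fg.
Qed.

Lemma gequiv_pairs f g f' g' n :
  (forall l, (l < n)%N ->
     gequiv (cpair (f l) ++ cpair (g l)) (cpair (f' l) ++ cpair (g' l))) ->
  gequiv (cpairs f n ++ cpairs g n) (cpairs f' n ++ cpairs g' n).
Proof.
elim: n => [//|n IH] fg; rewrite !cpairsS.
have p (a b c d : seq X) : perm_eq ((a ++ b) ++ (c ++ d)) ((a ++ c) ++ (b ++ d)).
  by apply/permP => q; rewrite !count_cat; lia.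
apply: gequiv_trans (gequiv_perm (p _ _ _ _)) _.
apply: gequiv_trans (gequiv_perm (p _ _ _ _)).
apply: gequiv_cat; last exact: fg.
by apply: IH => l ln; apply: fg; rewrite ltnS ltnW.
Qed.

Lemma perm_cpairs_parity y n : perm_eq (cpairs y n.*2)
  (cpairs (fun w => y w.*2) n ++ cpairs (fun w => y w.*2.+1) n).
Proof.
elim: n => // n IH; rewrite doubleS !cpairsS.
apply/permP => q; move/permP: IH => /(_ q); rewrite !count_cat; lia.
Qed.

Lemma sum_parity (V : nmodType) (F : nat -> V) n :
  \sum_(0 <= w < n.*2) F w =
  \sum_(0 <= w < n) F w.*2 + \sum_(0 <= w < n) F w.*2.+1.
Proof.
elim: n => [|n IH]; first by rewrite !big_geq// addr0.
by rewrite doubleS !big_nat_recr//= IH -!addrA; congr (_ + _); rewrite addrCA.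
Qed.

Lemma dft_parity n y l : (0 < n)%N -> dft n.*2 y l =
  dft n (fun w => y w.*2) l + e (l%:R / n.*2%:R) *: dft n (fun w => y w.*2.+1) l.
Proof.
move=> n0; have nn0 : n%:R != 0 :> R by rewrite pnatr_eq0 -lt0n.
have n2 : n.*2%:R = 2 * n%:R :> R by rewrite -mul2n natrM.
rewrite /dft sum_parity scaler_sumr; congr (_ + _); apply: eq_bigr => w _.
  by congr (e _ *: _); rewrite n2 -mul2n -mulnA natrM; field.
rewrite scalerA -circle_pointD; congr (e _ *: _).
by rewrite n2 mulSn natrD mulrDl -mul2n -mulnA natrM; congr (_ + _); field.
Qed.

Lemma dft_periodic n y l : (0 < n)%N -> dft n y (l + n) = dft n y l.
Proof.
move=> n0; have nn0 : n%:R != 0 :> R by rewrite pnatr_eq0 -lt0n.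
apply: eq_bigr => w _; congr (_ *: _).
rewrite mulnDr natrD mulrDl circle_pointD [X in _ * e X](_ : _ = w%:R).
  by rewrite circle_point_nat mulr1.
by rewrite natrM mulfK.
Qed.

Lemma circle_point_half : e 2^-1 = - 1.
Proof.
rewrite /circle_point (_ : 2 * pi * 2^-1 = pi); last by field.
rewrite cospi sinpi.
by apply/eqP; rewrite eq_complex /= oppr0 !eqxx.
Qed.

Lemma dft_parity_shift n y l : (0 < n)%N -> dft n.*2 y (n + l) =
  dft n (fun w => y w.*2) l - e (l%:R / n.*2%:R) *: dft n (fun w => y w.*2.+1) l.
Proof.
move=> n0; have nn0 : n%:R != 0 :> R by rewrite pnatr_eq0 -lt0n.
have n2 : n.*2%:R = 2 * n%:R :> R by rewrite -mul2n natrM.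
rewrite dft_parity// addnC !dft_periodic//; congr (_ + _).
rewrite natrD mulrDl circle_pointD [X in _ * e X](_ : _ = 2^-1).
  by rewrite circle_point_half mulrN1 scaleNr.
by rewrite n2; field.
Qed.

(* The butterflies of the fast Fourier transform are rotations. *)
Lemma gequiv_dft s y :
  gequiv (cpairs (fun l => ((Num.sqrt 2)^-1 ^+ s)%:C%C *: dft (2 ^ s) y l) (2 ^ s))
         (cpairs y (2 ^ s)).
Proof.
elim: s y => [|s IH] y.
  move=> h _; rewrite (@eq_cpairs _ y)// => l; rewrite expn0 ltnS leqn0 => /eqP ->.
  by rewrite expr0 scale1r /dft big_nat1 mul0n mul0r circle_point0 scale1r.
rewrite expnS mul2n; set n := (2 ^ s)%N; set r := (Num.sqrt 2)^-1.
have n0 : (0 < n)%N by rewrite expn_gt0.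
pose E l := (r ^+ s)%:C%C *: dft n (fun w => y w.*2) l.
pose O l := (r ^+ s)%:C%C *: dft n (fun w => y w.*2.+1) l.
have rS : (r ^+ s.+1)%:C%C = r%:C%C * (r ^+ s)%:C%C by rewrite exprS realCM.
rewrite -addnn cpairsD addnn.
rewrite (@eq_cpairs _ (fun l => r%:C%C *: (E l + e (l%:R / n.*2%:R) *: O l))); last first.
  move=> l _; rewrite dft_parity// rS -scalerA scalerDr; congr (_ *: (_ + _)).
  by rewrite !scalerA mulrC.
rewrite (@eq_cpairs (fun l => (r ^+ s.+1)%:C%C *: dft n.*2 y (n + l))
   (fun l => r%:C%C *: (E l - e (l%:R / n.*2%:R) *: O l))); last first.
  move=> l _; rewrite dft_parity_shift// rS -scalerA scalerBr; congr (_ *: (_ - _)).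
  by rewrite !scalerA mulrC.
apply: gequiv_trans (gequiv_sym (gequiv_perm (perm_cpairs_parity _ _))).
apply: gequiv_trans (gequiv_cat (IH _) (IH _)).
apply: gequiv_pairs => l _.
(* The twiddle factor of the odd half is a phase, absorbed by [gequiv_phase]. *)
apply: gequiv_trans (gequiv_butterfly _ _) _.
by apply: gequiv_cat; [move=> h _|exact: gequiv_phase].
Qed.

End fourier_gaussian.

Section complex_measurability.
Context {R : realType} d (T : measurableType d).

Lemma cmeasurable_cst (c : R[i]) : cmeasurable (fun _ : T => c).
Proof. by split; exact: measurable_cst. Qed.

Lemma cmeasurableM (f g : T -> R[i]) :
  cmeasurable f -> cmeasurable g -> cmeasurable (fun t => f t * g t).
Proof.
move=> [fr fi] [gr gi]; split.
  rewrite (_ : (fun t => _) = (fun t => complex.Re (f t)) \* (fun t => complex.Re (g t)) \-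
     (fun t => complex.Im (f t)) \* (fun t => complex.Im (g t))).
    by apply: measurable_funB; exact: measurable_funM.
  by apply/funext => t /=; case: (f t) => a b; case: (g t).
rewrite (_ : (fun t => _) = (fun t => complex.Re (f t)) \* (fun t => complex.Im (g t)) \+
   (fun t => complex.Im (f t)) \* (fun t => complex.Re (g t))).
  by apply: measurable_funD; exact: measurable_funM.
by apply/funext => t /=; case: (f t) => a b; case: (g t).
Qed.

Lemma cmeasurable_comp d' (T' : measurableType d') (f : T -> R[i]) (p : T' -> T) :
  cmeasurable f -> measurable_fun setT p -> cmeasurable (fun t => f (p t)).
Proof.
move=> [fr fi] mp; split; [exact: measurableT_comp fr mp|].
exact: measurableT_comp fi mp.
Qed.

Lemma cmeasurable_exp (f : T -> R[i]) n :
  cmeasurable f -> cmeasurable (fun t => f t ^+ n).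
Proof.
move=> mf; elim: n => [|n IH]; first exact: cmeasurable_cst.
under eq_fun do rewrite exprS.
exact: cmeasurableM.
Qed.

Lemma cmeasurable_prod (I : Type) (s : seq I) (F : I -> T -> R[i]) :
  (forall i, cmeasurable (F i)) -> cmeasurable (fun t => \prod_(i <- s) F i t).
Proof.
move=> mF; elim: s => [|i s IH].
  by under eq_fun do rewrite big_nil; exact: cmeasurable_cst.
under eq_fun do rewrite big_cons.
exact: cmeasurableM.
Qed.

End complex_measurability.

Lemma cmeasurable_circle_point {R : realType} :
  cmeasurable (circle_point : measurableTypeR R -> R[i]).
Proof.
have ml : measurable_fun setT ((fun t => 2 * pi * t) : measurableTypeR R -> measurableTypeR R).
  by apply: measurable_funM.
split.
  exact: measurableT_comp (continuous_measurable_fun (@continuous_cos R)) ml.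
exact: measurableT_comp (continuous_measurable_fun (@continuous_sin R)) ml.
Qed.

(** * Second moment of the normal law *)

Section gauss_moment.
Context {R : realType}.
Local Notation mR := (measurableTypeR R).
Local Notation mu := (@lebesgue_measure R).
Local Notation pdf := (@normal_pdf R 0 1).

(** Positivity and finiteness are enough: the lower and upper Gaussian bounds share this factor,
    which cancels between them. *)
Definition gauss_moment : R := fine (\int[mu]_x (pdf x * x ^+ 2)%:E).

Let pdf_ge0 x : 0 <= pdf x. Proof. exact: normal_pdf_ge0. Qed.

Let mpdf : measurable_fun setT (pdf : mR -> R).
Proof. exact: measurable_normal_pdf. Qed.

Let mpdf2 : measurable_fun setT ((fun x => pdf x * x ^+ 2) : mR -> R).
Proof. by apply: measurable_funM => //; exact: measurable_funX. Qed.

Let integral_gt0 : (0 < \int[mu]_x (pdf x * x ^+ 2)%:E)%E.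
Proof.
(* On [1, 2] the density is at least its value at 2, and x^2 is at least 1. *)
pose c : R := normal_peak 1 * expR (- 2).
have c0 : 0 < c by rewrite mulr_gt0 ?expR_gt0// normal_peak_gt0// oner_neq0.
apply: (@lt_le_trans _ _ (\int[mu]_(x in `[1%R, 2%R]) c%:E)%E).
  rewrite integral_cst//= lebesgue_measure_itv/= lte_fin.
  have -> : (1 : R) < 2 by lra.
  by rewrite -EFinB -EFinM lte_fin; apply: mulr_gt0 => //; lra.
apply: (@le_trans _ _ (\int[mu]_(x in `[1%R, 2%R]) (pdf x * x ^+ 2)%:E)%E).
  apply: ge0_le_integral => //.
  - by move=> x _; rewrite lee_fin ltW.
  - by apply: measurable_funTS; apply/measurable_EFinP.
  - move=> x /=; rewrite in_itv/= => /andP[x1 x2]; rewrite lee_fin.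
    rewrite normal_pdfE ?oner_neq0// /normal_fun subr0.
    have p0 : 0 <= (normal_peak 1 : R) by exact: normal_peak_ge0.
    apply: (@le_trans _ _ (normal_peak 1 * expR (- x ^+ 2 / (1 ^+ 2 *+ 2)))).
      by rewrite ler_wpM2l// ler_expR; nra.
    rewrite ler_peMr//; last by nra.
    by rewrite mulr_ge0// expR_ge0.
apply: ge0_subset_integral => //; first exact/measurable_EFinP.
by move=> x _; rewrite lee_fin mulr_ge0// sqr_ge0.
Qed.

Let integral_lty : (\int[mu]_x (pdf x * x ^+ 2)%:E < +oo)%E.
Proof.
(* Since x^2 <= 4 exp (x^2/4), the integrand is at most a multiple of the normal density of variance
   2. *)
pose r2 : R := Num.sqrt 2.
have r20 : r2 != 0 by rewrite gt_eqF// sqrtr_gt0.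
have r22 : r2 ^+ 2 = 2 by rewrite sqr_sqrtr.
have p1 : 0 < (normal_peak 1 : R) by rewrite normal_peak_gt0// oner_neq0.
have p2 : 0 < normal_peak r2 by rewrite normal_peak_gt0.
pose K := 4 * (normal_peak 1 / normal_peak r2).
have K0 : 0 <= K by rewrite mulr_ge0// divr_ge0// ltW.
apply: (@le_lt_trans _ _ (\int[mu]_x (K%:E * (normal_pdf 0 r2 x)%:E))%E).
  apply: ge0_le_integral => //.
  - by move=> x _; rewrite lee_fin mulr_ge0// sqr_ge0.
  - exact/measurable_EFinP.
  - apply: emeasurable_funM => //.
    by apply/measurable_EFinP; exact: measurable_normal_pdf.
  - move=> x _; rewrite -EFinM lee_fin !normal_pdfE ?oner_neq0// /normal_fun subr0.
    rewrite r22 expr1n /K.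
    have -> : 4 * (normal_peak 1 / normal_peak r2) *
        (normal_peak r2 * expR (- x ^+ 2 / (2 *+ 2))) =
      normal_peak 1 * (4 * expR (- x ^+ 2 / (2 *+ 2))).
      by field; rewrite gt_eqF.
    rewrite -mulrA ler_wpM2l ?(ltW p1)//.
    have -> : - x ^+ 2 / (1 *+ 2) = - (x ^+ 2 / 4) + - (x ^+ 2 / 4) :> R by lra.
    have -> : - x ^+ 2 / (2 *+ 2) = - (x ^+ 2 / 4) :> R by lra.
    rewrite expRD -mulrA mulrCA [leRHS]mulrC ler_wpM2l ?expR_ge0//.
    rewrite expRN mulrC ler_pdivrMr ?expR_gt0//.
    have := expR_ge1Dx (x ^+ 2 / 4); lra.
rewrite ge0_integralZl//.
- by rewrite integral_normal_pdf mule1 ltry.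
- by apply/measurable_EFinP; exact: measurable_normal_pdf.
- by move=> x _; rewrite lee_fin normal_pdf_ge0.
Qed.

Lemma gauss_momentE : (\int[mu]_x (pdf x * x ^+ 2)%:E)%E = gauss_moment%:E.
Proof. by rewrite fineK// ge0_fin_numE// ltW. Qed.

Lemma gauss_moment_gt0 : 0 < gauss_moment.
Proof. by rewrite -lte_fin -gauss_momentE. Qed.

Lemma integral_gauss_affine (a b : R) : 0 <= a -> 0 <= b ->
  (\int[mu]_x ((pdf x)%:E * (a + b * x ^+ 2)%:E) = (a + b * gauss_moment)%:E)%E.
Proof.
move=> a0 b0.
transitivity (\int[mu]_x (a%:E * (pdf x)%:E + b%:E * (pdf x * x ^+ 2)%:E))%E.
  by apply: eq_integral => x _; rewrite -!EFinM -EFinD; congr EFin; ring.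
rewrite ge0_integralD//.
- rewrite ge0_integralZl// ?ge0_integralZl//.
  + by rewrite integral_normal_pdf gauss_momentE mule1.
  + exact/measurable_EFinP.
  + by move=> x _; rewrite lee_fin mulr_ge0// sqr_ge0.
  + exact/measurable_EFinP.
  + by move=> x _; rewrite lee_fin.
- by move=> x _; rewrite -EFinM lee_fin mulr_ge0.
- by apply: emeasurable_funM => //; exact/measurable_EFinP.
- by move=> x _; rewrite -EFinM lee_fin mulr_ge0// mulr_ge0// sqr_ge0.
- by apply: emeasurable_funM => //; exact/measurable_EFinP.
Qed.

Definition gauss2 (f : R -> R -> \bar R) : \bar R :=
  (\int[mu]_a \int[mu]_b ((pdf a * pdf b)%R%:E * f a b))%E.

Lemma le_gauss2 (f g : R -> R -> \bar R) :
  measurable_fun setT (fun p : mR * mR => f p.1 p.2) ->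
  measurable_fun setT (fun p : mR * mR => g p.1 p.2) ->
  (forall a b, 0 <= f a b)%E -> (forall a b, f a b <= g a b)%E ->
  (gauss2 f <= gauss2 g)%E.
Proof.
move=> mf mg f0 fg.
have g0 a b : (0 <= g a b)%E by exact: le_trans (fg a b).
have mF (k : R -> R -> \bar R) : measurable_fun setT (fun p : mR * mR => k p.1 p.2) ->
    measurable_fun setT (fun p : mR * mR => ((pdf p.1 * pdf p.2)%R%:E * k p.1 p.2)%E).
  move=> mk; apply: emeasurable_funM => //; apply/measurable_EFinP.
  apply: measurable_funM; first exact: measurableT_comp mpdf measurable_fst.
  exact: measurableT_comp mpdf measurable_snd.
have F0 (k : R -> R -> \bar R) : (forall a b, 0 <= k a b)%E ->
    forall p : mR * mR, (0 <= (pdf p.1 * pdf p.2)%R%:E * k p.1 p.2)%E.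
  by move=> k0 p; rewrite mule_ge0// lee_fin mulr_ge0.
apply: ge0_le_integral => //.
- by move=> a _; apply: integral_ge0 => b _; exact: (F0 f f0 (a, b)).
- exact: (@measurable_fun_fubini_tonelli_F _ _ _ _ _ mu _ (mF f mf) (F0 f f0)).
- exact: (@measurable_fun_fubini_tonelli_F _ _ _ _ _ mu _ (mF g mg) (F0 g g0)).
- move=> a _; apply: ge0_le_integral => //.
  + by move=> b _; exact: (F0 f f0 (a, b)).
  + exact: (measurable_fun_pair2 a (mF f mf)).
  + exact: (measurable_fun_pair2 a (mF g mg)).
  + by move=> b _; rewrite lee_wpmul2l// lee_fin mulr_ge0.
Qed.

Lemma gauss2_affine (a b : R) : 0 <= a -> 0 <= b ->
  gauss2 (fun x y => (a + b * (x ^+ 2 + y ^+ 2))%:E) =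
  (a + b * (2 * gauss_moment))%:E.
Proof.
move=> a0 b0; rewrite /gauss2.
transitivity (\int[mu]_x ((pdf x)%:E * (a + b * gauss_moment + b * x ^+ 2)%:E))%E.
  apply: eq_integral => x _.
  transitivity (\int[mu]_y ((pdf x)%:E * ((pdf y)%:E * (a + b * x ^+ 2 + b * y ^+ 2)%:E)))%E.
    by apply: eq_integral => y _; rewrite muleA; congr (_ * _%:E)%E; ring.
  have c0 : 0 <= a + b * x ^+ 2 by rewrite addr_ge0// mulr_ge0// sqr_ge0.
  rewrite ge0_integralZl//.
  - by rewrite integral_gauss_affine//; congr (_ * _%:E)%E; ring.
  - apply: emeasurable_funM; first exact/measurable_EFinP.
    apply/measurable_EFinP; apply: measurable_funD => //.
    by apply: measurable_funM => //; exact: measurable_funX.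
  - by move=> y _; rewrite mule_ge0// lee_fin// addr_ge0// mulr_ge0// sqr_ge0.
  - by rewrite lee_fin.
rewrite integral_gauss_affine//; first by congr EFin; ring.
by rewrite addr_ge0// mulr_ge0// ltW// gauss_moment_gt0.
Qed.

End gauss_moment.

(** * Transfer of inequalities from circle averages to Gaussian averages *)

Section circle_averages.
Context {R : realType} (X : completeNormedModType R[i]).
Local Notation mR := (measurableTypeR R).
Local Notation mu := (@lebesgue_measure R).
Local Notation pdf := (@normal_pdf R 0 1).
Local Notation P := (@circle_prob R).
Implicit Types (y v : X) (h : X -> \bar R) (s : seq X).

Definition cavg (y : X) (h : X -> \bar R) : X -> \bar R :=
  avg P (cst 1) circle_point y h.

Definition cavgs s h : X -> \bar R := foldr cavg h s.

Lemma cavgE y h v : cavg y h v = (\int[P]_t h (v + circle_point t *: y)%R)%E.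
Proof. by apply: eq_integral => t _; rewrite mul1e. Qed.

Lemma curve_measurable_cavg y h :
  curve_measurable h -> curve_measurable (cavg y h).
Proof.
move=> mh; apply: curve_measurable_avg mh; first exact: measurable_cst.
  by move=> t /=.
exact: cmeasurable_circle_point.
Qed.

Lemma curve_measurable_cavgs s h :
  curve_measurable h -> curve_measurable (cavgs s h).
Proof. by move=> mh; elim: s => //= y s IH; exact: curve_measurable_cavg. Qed.

Lemma cavg_gavgs y s h : curve_measurable h ->
  cavg y (gavgs s h) = gavgs s (cavg y h).
Proof.
move=> mh; elim: s => //= z s <-; apply/funext => v.
have mg := curve_measurable_gavgs s mh.
apply: avgC mg; first exact: measurable_cst.
- by move=> t /=.
- exact: cmeasurable_circle_point.
- exact: measurable_normal_pdf.
- by move=> t; exact: normal_pdf_ge0.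
- exact: cmeasurable_real.
Qed.

Let pdf_ge0 x : 0 <= pdf x. Proof. exact: normal_pdf_ge0. Qed.

Let mpdf : measurable_fun setT (pdf : mR -> R).
Proof. exact: measurable_normal_pdf. Qed.

(* A complex Gaussian variable is the product of an independent uniform phase
   and of its copy. *)
Lemma gavgs_cpair y h v : curve_measurable h ->
  gavgs (cpair y) h v =
  gauss2 (fun a b => cavg ((a +i* b)%C *: y) h v).
Proof.
move=> mh.
pose F (t a b : R) := ((pdf a * pdf b)%R%:E *
  h (v + (circle_point t * (a +i* b)%C) *: y)%R)%E.
have F0 t a b : (0 <= F t a b)%E.
  by case: mh => h0 _; rewrite mule_ge0// lee_fin mulr_ge0.
have mF d (T : measurableType d) (t a b : T -> mR) :
    measurable_fun setT t -> measurable_fun setT a -> measurable_fun setT b ->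
    measurable_fun setT (fun p => F (t p) (a p) (b p)).
  move=> mt ma mb; case: mh => h0 mh; apply: emeasurable_funM.
    apply/measurable_EFinP; apply: measurable_funM.
      exact: measurableT_comp mpdf ma.
    exact: measurableT_comp mpdf mb.
  apply: mh; apply: curveD; first exact: curve_cst.
  apply: curveZ; apply: cmeasurableM; last by [].
  exact: cmeasurable_comp cmeasurable_circle_point mt.
have m1 d1 d2 (T1 : measurableType d1) (T2 : measurableType d2) :
  measurable_fun setT (fst : T1 * T2 -> T1) by exact: measurable_fst.
have m2 d1 d2 (T1 : measurableType d1) (T2 : measurableType d2) :
  measurable_fun setT (snd : T1 * T2 -> T2) by exact: measurable_snd.
transitivity (\int[P]_t \int[mu]_a \int[mu]_b F t a b)%E.
  (* The Gaussian average does not change when y is multiplied by a phase, so it equals its mean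
     over all phases. *)
  transitivity (\int[P]_t (gavgs (cpair y) h v))%E.
    by rewrite (integral_cst P measurableT) [X in (_ * X)%E](_ : _ = 1%E) ?mule1//; exact: (probability_setT P).
  apply: eq_integral => t _.
  rewrite -(gequiv_phase t y mh) /= (gavg_gavgE _ _ v mh).
  apply: eq_integral => a _; apply: eq_integral => b _.
  rewrite /F; congr (_ * h _)%E; rewrite -addrA; congr (_ + _).
  rewrite !scalerA -!scalerDl; congr (_ *: _).
  rewrite [(a +i* b)%C]complexE/=; ring.
rewrite /gauss2.
pose G1 (p : mR * mR) := (\int[mu]_b F p.1 p.2 b)%E.
have mG1 : measurable_fun setT G1.
  apply: (@measurable_fun_fubini_tonelli_F _ _ _ _ _ mu
    (fun p : (mR * mR) * mR => F p.1.1 p.1.2 p.2)); last by move=> p; exact: F0.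
  by apply: mF => //; [exact: measurableT_comp (m1 _ _ _ _) (m1 _ _ _ _)
    |exact: measurableT_comp (m2 _ _ _ _) (m1 _ _ _ _)].
have G10 p : (0 <= G1 p)%E by apply: integral_ge0 => b _; exact: F0.
apply: (eq_trans (@fubini_tonelli _ _ _ _ _ P mu G1 mG1 G10)).
apply: eq_integral => a _.
pose G2 (p : mR * mR) := F p.1 a p.2.
have mG2 : measurable_fun setT G2 by apply: mF => //; exact: measurable_cst.
have G20 p : (0 <= G2 p)%E by exact: F0.
apply: (eq_trans (@fubini_tonelli _ _ _ _ _ P mu G2 mG2 G20)).
apply: eq_integral => b _.
rewrite cavgE -ge0_integralZl//.
- by apply: eq_integral => t _; rewrite /G2 /F /= -scalerA.
- case: mh => h0 mh; apply: mh; apply: curveD; first exact: curve_cst.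
  exact: curveZ cmeasurable_circle_point.
- by move=> t _; case: mh.
- by rewrite lee_fin mulr_ge0.
Qed.

Lemma rnorm_complexZ (a b : R) y :
  rnorm ((a +i* b)%C *: y) ^+ 2 = (a ^+ 2 + b ^+ 2) * rnorm y ^+ 2.
Proof.
by rewrite rnormZ exprMn normc_def /= sqr_sqrtr// addr_ge0// sqr_ge0.
Qed.

Let m_cavg2 y v h : curve_measurable h ->
  measurable_fun setT (fun p : mR * mR => cavg ((p.1 +i* p.2)%C *: y) h v).
Proof.
move=> [h0 mh]; under eq_fun do rewrite cavgE.
apply: (@measurable_fun_fubini_tonelli_F _ _ _ _ _ P
  (fun p : (mR * mR) * mR => h (v + circle_point p.2 *: ((p.1.1 +i* p.1.2)%C *: y)))) => //.
apply: mh; apply: curveD; first exact: curve_cst.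
under eq_fun do rewrite scalerA.
apply: curveZ; apply: cmeasurableM.
  exact: cmeasurable_comp cmeasurable_circle_point measurable_snd.
by split; [exact: measurableT_comp measurable_fst measurable_fst
          |exact: measurableT_comp measurable_snd measurable_fst].
Qed.

Let m_affine (c d : R) :
  measurable_fun setT (fun p : mR * mR => (c + d * (p.1 ^+ 2 + p.2 ^+ 2))%:E).
Proof.
apply/measurable_EFinP; apply: measurable_funD => //.
apply: measurable_funM => //; apply: measurable_funD.
  by apply: measurable_funX; exact: measurable_fst.
by apply: measurable_funX; exact: measurable_snd.
Qed.

Let M : R := 2 * gauss_moment.

Let M_ge0 : 0 <= M. Proof. by rewrite mulr_ge0// ltW// gauss_moment_gt0. Qed.

(** The entries pass one at a time from a Gaussian list to a circle list: by [gavgs_cpair] the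
    Gaussian variable of y becomes a uniform phase with the vector [(a +i* b)%C *: y]. The
    hypothesis being affine in the squared norm of this vector, only the second moment of a and b
    enters. *)
Lemma gauss_le_of_circle_le h (K : R) : curve_measurable h -> 0 <= K ->
  (forall s, (cavgs s h 0%R <= (K * \sum_(x <- s) rnorm x ^+ 2)%:E)%E) ->
  forall s, (gavgs (flatten [seq cpair y | y <- s]) h 0%R <=
    (K * (2 * gauss_moment) * \sum_(x <- s) rnorm x ^+ 2)%:E)%E.
Proof.
move=> mh K0 H s.
(* The induction needs mixed averages: [s] is still Gaussian, [s'] is already on the circle. *)
suff: forall s', (gavgs (flatten [seq cpair y | y <- s]) (cavgs s' h) 0%R <=
    (K * (M * \sum_(x <- s) rnorm x ^+ 2 + \sum_(x <- s') rnorm x ^+ 2))%:E)%E.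
  by move=> /(_ [::]) /=; rewrite big_nil addr0 mulrA.
elim: s => [s'|y s IH s']; first by rewrite big_nil mulr0 add0r; exact: H.
have mh' := curve_measurable_cavgs s' mh.
rewrite /= -/(cpair y) -[flatten _]/(flatten [seq cpair y | y <- s]).
rewrite -[gavg y _]/(gavgs (cpair y) (gavgs (flatten [seq cpair y | y <- s]) (cavgs s' h))).
rewrite gavgs_cpair; last exact: curve_measurable_gavgs.
pose A := K * (M * \sum_(x <- s) rnorm x ^+ 2 + \sum_(x <- s') rnorm x ^+ 2).
pose B := K * rnorm y ^+ 2.
have S0 (t : seq X) : 0 <= \sum_(x <- t) rnorm x ^+ 2.
  by apply: sumr_ge0 => x _; exact: sqr_ge0.
have A0 : 0 <= A by rewrite mulr_ge0// addr_ge0// mulr_ge0.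
have B0 : 0 <= B by rewrite mulr_ge0// sqr_ge0.
apply: (@le_trans _ _ (gauss2 (fun a b => (A + B * (a ^+ 2 + b ^+ 2))%:E))).
  apply: le_gauss2 => //.
  - by apply: m_cavg2; exact: curve_measurable_gavgs.
  - move=> a b.
    by case: (curve_measurable_cavg ((a +i* b)%C *: y)
      (curve_measurable_gavgs (flatten [seq cpair y | y <- s]) mh')).
  - move=> a b; rewrite cavg_gavgs//.
    have := IH ((a +i* b)%C *: y :: s'); rewrite /= => /le_trans; apply.
    by rewrite lee_fin big_cons rnorm_complexZ /A /B; lra.
rewrite gauss2_affine// lee_fin big_cons /A /B -/M; lra.
Qed.

(* The induction moves the entries one at a time from the Gaussian list to the
   circle list, which reverses their order. *)
Lemma gauss_ge_of_circle_ge h (K : R) (W : seq R -> Prop) :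
  curve_measurable h -> 0 <= K ->
  (forall w, W w -> all (fun c => 0 <= c) w) ->
  (forall s : seq (R * X), W (map fst s) ->
    ((K * \sum_(p <- s) p.1 * rnorm p.2 ^+ 2)%:E <= cavgs (map snd s) h 0%R)%E) ->
  forall s : seq (R * X), W (rev (map fst s)) ->
    ((K * (2 * gauss_moment) * \sum_(p <- s) p.1 * rnorm p.2 ^+ 2)%:E <=
     gavgs (flatten [seq cpair p.2 | p <- s]) h 0%R)%E.
Proof.
move=> mh K0 W0 H s.
suff: forall s' : seq (R * X), W (map fst (catrev s s')) ->
    ((K * (M * \sum_(p <- s) p.1 * rnorm p.2 ^+ 2 +
           \sum_(p <- s') p.1 * rnorm p.2 ^+ 2))%:E <=
     gavgs (flatten [seq cpair p.2 | p <- s]) (cavgs (map snd s') h) 0%R)%E.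
  move=> /(_ [::]); rewrite -[catrev s [::]]/(rev s) map_rev => HH Ws.
  by have := HH Ws; rewrite /= big_nil addr0 mulrA.
elim: s => [|y s IH] s'; first by move=> Ws; rewrite big_nil mulr0 add0r; exact: H.
move=> Ws.
have mh' := curve_measurable_cavgs (map snd s') mh.
set L := flatten [seq cpair p.2 | p <- s].
rewrite -[gavgs _ _]/(gavgs (cpair y.2) (gavgs L (cavgs (map snd s') h))).
rewrite gavgs_cpair; last exact: curve_measurable_gavgs.
pose A := K * (M * \sum_(p <- s) p.1 * rnorm p.2 ^+ 2 +
           \sum_(p <- s') p.1 * rnorm p.2 ^+ 2).
pose B := K * (y.1 * rnorm y.2 ^+ 2).
have := W0 _ Ws; rewrite catrevE map_cat all_cat map_rev all_rev /=.
move=> /andP[/andP[y0 s0] s'0].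
have S0 (t : seq (R * X)) : all (fun c => 0 <= c) (map fst t) ->
    0 <= \sum_(p <- t) p.1 * rnorm p.2 ^+ 2.
  rewrite all_map => /allP t0; rewrite big_seq; apply: sumr_ge0 => p pt.
  by rewrite mulr_ge0 ?sqr_ge0//; exact: t0.
have Ss := S0 _ s0; have Ss' := S0 _ s'0.
have A0 : 0 <= A by rewrite mulr_ge0// addr_ge0// mulr_ge0.
have B0 : 0 <= B by rewrite mulr_ge0// mulr_ge0// sqr_ge0.
apply: (@le_trans _ _ (gauss2 (fun a b => (A + B * (a ^+ 2 + b ^+ 2))%:E))).
  rewrite gauss2_affine// lee_fin big_cons /A /B -/M; lra.
apply: le_gauss2 => //.
- by apply: m_cavg2; exact: curve_measurable_gavgs.
- move=> a b; rewrite lee_fin addr_ge0// mulr_ge0// addr_ge0// sqr_ge0//.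
- move=> a b; rewrite cavg_gavgs//.
  have Ws2 : W (map fst (catrev s ((y.1, (a +i* b)%C *: y.2) :: s'))).
    by move: Ws; rewrite /= !catrevE !map_cat.
  have := IH _ Ws2; rewrite /=; apply: le_trans.
  by rewrite lee_fin big_cons /= rnorm_complexZ /A /B; lra.
Qed.

End circle_averages.

(** * Inequalities between powers *)

Section power_inequalities.
Context {R : realType}.
Implicit Types (x y b p q : R).

Lemma ler_powR2r p x y : 0 <= p -> 0 <= x -> x <= y -> x `^ p <= y `^ p.
Proof. by move=> p0 x0 xy; apply: ge0_ler_powR => //; rewrite nnegrE// (le_trans x0). Qed.

Lemma powRrVK p x : 0 <= x -> p != 0 -> (x `^ p^-1) `^ p = x.
Proof. by move=> x0 p0; rewrite -powRrM mulVf// powRr1. Qed.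

Lemma powR_invr p x : 0 <= x -> x^-1 `^ p = (x `^ p)^-1.
Proof.
move=> x0; rewrite -powR_inv1// -powRrM mulrC powRrM powR_inv1//.
exact: powR_ge0.
Qed.

(** Young's inequality for the product of x and 1, with exponents p and p/(p-1). *)
Lemma powR_bernoulli p x : 1 <= p -> 0 <= x -> 1 + p * (x - 1) <= x `^ p.
Proof.
rewrite le_eqVlt => /orP[/eqP <-|p1] x0; first by rewrite powRr1//; lra.
have p0 : 0 < p by lra.
have q0 : 0 < p / (p - 1) by rewrite divr_gt0//; lra.
have E : p^-1 + (p / (p - 1))^-1 = 1 by field; apply/andP; split; lra.
have := conjugate_powR x0 (ler01 : (0 : R) <= 1) p0 q0 E.
rewrite powR1 mulr1 -(ler_pM2l p0) => h; apply: le_trans (_ : p * x - (p - 1) <= _).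
  by lra.
rewrite lerBlDr (le_trans h)// mulrDr mulrC divfK ?gt_eqF//.
rewrite lerD2l mul1r invf_div mulrCA divff ?gt_eqF// mulr1.
exact: lexx.
Qed.

(** The convex function x^p lies above its tangent at the weighted mean [T / S]. This tangent is
    Bernoulli's inequality after rescaling, and its linear part averages out. *)
Lemma jensen_powR (I : eqType) (s : seq I) (c f : I -> R) p : 1 <= p ->
  (forall i, i \in s -> 0 <= c i) -> (forall i, i \in s -> 0 <= f i) ->
  0 < \sum_(i <- s) c i ->
  (\sum_(i <- s) c i * f i) `^ p <=
  (\sum_(i <- s) c i) `^ (p - 1) * \sum_(i <- s) c i * f i `^ p.
Proof.
move=> p1 c0 f0; set S := \sum_(i <- s) c i => S0.
set T := \sum_(i <- s) c i * f i.
have p0 : p != 0 by rewrite gt_eqF//; lra.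
have T0 : 0 <= T by rewrite /T big_seq sumr_ge0// => i si; rewrite mulr_ge0 ?c0 ?f0.
have R0 : 0 <= \sum_(i <- s) c i * f i `^ p.
  by rewrite big_seq sumr_ge0// => i si; rewrite mulr_ge0 ?c0 ?powR_ge0.
move: T0; rewrite le_eqVlt => /orP[/eqP <-|T0].
  by rewrite powR0// mulr_ge0// powR_ge0.
have m0 : 0 < T / S by rewrite divr_gt0.
have key : (T / S) `^ p * S <= \sum_(i <- s) c i * f i `^ p.
  have -> : (T / S) `^ p * S = \sum_(i <- s) c i * ((T / S) `^ p * (1 + p * (f i / (T / S) - 1))).
    transitivity ((T / S) `^ p * ((1 - p) * S + p / (T / S) * T)).
      by congr (_ * _); field; rewrite !gt_eqF.
    rewrite /S /T !mulr_sumr -big_split mulr_sumr /=.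
    by apply: eq_bigr => i _; rewrite -/S -/T; ring.
  rewrite big_seq [leRHS]big_seq; apply: ler_sum => i si.
  rewrite ler_wpM2l ?c0//.
  have fi : f i = (T / S) * (f i / (T / S)) by rewrite mulrCA divff ?mulr1// gt_eqF.
  have fi0 : 0 <= f i / (T / S) by rewrite divr_ge0 ?f0 // (ltW m0).
  rewrite [in leRHS]fi (powRM _ (ltW m0) fi0).
  by rewrite ler_wpM2l ?powR_ge0// powR_bernoulli.
have -> : T = S * (T / S) by rewrite mulrCA divff ?mulr1// gt_eqF.
rewrite (powRM _ (ltW S0) (ltW m0)) (_ : S `^ p = S `^ (p - 1) * S); last first.
  rewrite -{1}(subrK 1 p) (@powRD _ S (p - 1) 1); last by rewrite (gt_eqF S0) implybT.
  by rewrite powRr1 ?(ltW S0).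
by rewrite -mulrA ler_wpM2l ?powR_ge0// mulrC.
Qed.

(** Young's inequality with exponents q/2 and q/(q-2); the second is infinite at q = 2, which is
    treated apart. *)
Lemma young_weight q x b : 2 <= q -> 0 <= x -> 0 <= b ->
  b `^ (q - 2) * x ^+ 2 <= (2 / q) * x `^ q + (1 - 2 / q) * b `^ q.
Proof.
rewrite le_eqVlt => /orP[/eqP <-|q2] x0 b0.
  by rewrite subrr powRr0 divff// subrr mul0r addr0 !mul1r powR_mulrn.
have p0 : 0 < q / 2 by lra.
have p'0 : 0 < q / (q - 2) by rewrite divr_gt0//; lra.
have E : (q / 2)^-1 + (q / (q - 2))^-1 = 1.
  by field; apply/andP; split; rewrite gt_eqF//; lra.
have := conjugate_powR (sqr_ge0 x) (powR_ge0 b (q - 2)) p0 p'0 E.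
rewrite -powRrM -(powR_mulrn 2 x0) -powRrM.
have -> : (q - 2) * (q / (q - 2)) = q by field; rewrite gt_eqF//; lra.
have -> : 2 * (q / 2) = q by field.
rewrite mulrC => /le_trans; apply.
rewrite le_eqVlt; apply/orP; left; apply/eqP; field.
by apply/andP; split; rewrite gt_eqF//; lra.
Qed.

(** It linearizes the q-norm: for fixed weights the left-hand side is linear in the squares, hence
    compatible with Gaussian averages, and nothing is lost when b is proportional to x. *)
Lemma holder_weight (I : Type) (s : seq I) (b x : I -> R) q : 2 <= q ->
  (forall i, 0 <= b i) -> (forall i, 0 <= x i) ->
  \sum_(i <- s) b i `^ q = 1 ->
  \sum_(i <- s) b i `^ (q - 2) * x i ^+ 2 <= (\sum_(i <- s) x i `^ q) `^ (2 / q).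
Proof.
move=> q2 b0 x0 b1; set S := \sum_(i <- s) x i `^ q.
have q0 : q != 0 by rewrite gt_eqF//; lra.
have key (z : I -> R) : (forall i, 0 <= z i) -> \sum_(i <- s) z i `^ q <= 1 ->
    \sum_(i <- s) b i `^ (q - 2) * z i ^+ 2 <= 1.
  move=> z0 z1.
  apply: le_trans (_ : \sum_(i <- s) ((2 / q) * z i `^ q + (1 - 2 / q) * b i `^ q) <= _).
    by apply: ler_sum => i _; exact: young_weight.
  rewrite big_split/= -!mulr_sumr b1 mulr1.
  have : 0 <= 2 / q by rewrite divr_ge0//; lra.
  by move=> ?; nra.
have S0 : 0 <= S by apply: sumr_ge0 => i _; exact: powR_ge0.
(* Normalizing by any t >= S, rather than by S, lets the case S = 0 follow when t tends to 0. *)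
have pos t : 0 < t -> S <= t -> \sum_(i <- s) b i `^ (q - 2) * x i ^+ 2 <= t `^ (2 / q).
  move=> t0 St; pose u := t `^ q^-1.
  have u0 : 0 < u by rewrite powR_gt0.
  have -> : t `^ (2 / q) = u ^+ 2 by rewrite -powR_mulrn ?ltW// -powRrM mulrC.
  have := key (fun i => x i / u) (fun i => divr_ge0 (x0 i) (ltW u0)).
  rewrite (eq_bigr (fun i => x i `^ q / t)); last first.
    move=> i _; rewrite powRM// ?invr_ge0 ?(ltW u0)// powR_invr ?(ltW u0)//.
    by rewrite /u powRrVK// ltW.
  rewrite -mulr_suml ler_pdivrMr// mul1r => /(_ St).
  rewrite (eq_bigr (fun i => b i `^ (q - 2) * x i ^+ 2 / u ^+ 2)); last first.
    by move=> i _; rewrite expr_div_n mulrA.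
  by rewrite -mulr_suml ler_pdivrMr ?exprn_gt0// mul1r.
move: S0; rewrite le_eqVlt => /orP[/eqP SE|S0]; last exact: pos.
rewrite -SE powR0; last by rewrite mulf_neq0 ?invr_eq0 ?pnatr_eq0.
apply/ler_addgt0Pl => e e0; rewrite addr0.
have := pos (e `^ (q / 2)); rewrite -powRrM (_ : q / 2 * (2 / q) = 1); last first.
  by field; rewrite q0.
by rewrite powRr1 ?(ltW e0)//; apply; rewrite ?powR_gt0// -SE powR_ge0.
Qed.

End power_inequalities.

(** * Type 2 and cotype q applied to the transform on Z/2^m *)

Section dft_estimate.
Context {R : realType} (X : completeNormedModType R[i]).
Local Notation P := (@circle_prob R).
Implicit Types (x v : X) (s : seq X) (h : X -> \bar R).

Let sqn : X -> \bar R := fun v => (rnorm v ^+ 2)%:E.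

Lemma integral_torus_cavgs h s v : curve_measurable h ->
  (\int[torus_prob (size s)]_t
     h (v + \sum_(k < size s) circle_point (tnth t k) *: s`_k)%R)%E = cavgs s h v.
Proof.
move=> mh; elim: s v => [|x s IH] v.
  rewrite /torus_prob /= integral_dirac//.
    by rewrite diracT mul1e big_ord0 addr0.
  by under eq_fun do rewrite big_ord0 addr0; exact: measurable_cst.
have [h0 mhc] := mh.
have mT d (T : measurableType d) n (t : T -> n.-tuple (measurableTypeR R)) (w : X) s' :
    measurable_fun setT t ->
    measurable_fun setT (fun p => h (w + \sum_(k < n) circle_point (tnth (t p) k) *: s'`_k)).
  move=> mt; apply: mhc; apply: curveD; first exact: curve_cst.
  apply: curve_sum => k; apply: curveZ.
  apply: (cmeasurable_comp cmeasurable_circle_point).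
  exact: (measurableT_comp (measurable_tnth k) mt).
rewrite [LHS]ge0_integral_distribution; first last.
- by move=> t; exact: h0.
- exact: (mT _ _ (size s).+1 id v (x :: s) (@measurable_id _ _ setT)).
match goal with |- @integral _ _ _ _ _ ?f = _ => pose G := f end.
have GE t z : G (t, z) =
    h ((v + circle_point t *: x) + \sum_(k < size s) circle_point (tnth z k) *: s`_k).
  rewrite /G /= big_ord_recl /= tnth0 addrA; congr h; congr (_ + _).
  by apply: eq_bigr => k _; rewrite tnthS.
have mG : measurable_fun setT G.
  apply: (mT _ _ (size s).+1 _ v (x :: s)).
  exact: measurable_cons.
have G0 p : (0 <= G p)%E by exact: h0.
rewrite (@fubini_tonelli1 _ _ _ _ _ P (power_prob P (size s)) G mG G0).
rewrite [RHS]/= cavgE; apply: eq_integral => t _.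
by rewrite -IH; apply: eq_integral => z _; rewrite -GE.
Qed.

(** This gives finiteness, so that the real integral in [linear_L2] agrees with the extended one. *)
Lemma cavgs_ub s v : (cavgs s sqn v <= ((rnorm v + \sum_(x <- s) rnorm x) ^+ 2)%:E)%E.
Proof.
have mh := @curve_measurable_sqr R X.
elim: s v => [|x s IH] v; first by rewrite big_nil addr0.
rewrite /= cavgE.
have [c0 mc] := curve_measurable_cavgs s mh.
apply: (@le_trans _ _ (\int[P]_t
    (((rnorm v + \sum_(x <- x :: s) rnorm x) ^+ 2)%:E))%E).
  apply: ge0_le_integral => //.
  - apply: mc; apply: curveD; first exact: curve_cst.
    exact: curveZ cmeasurable_circle_point.
  - move=> t _; apply: le_trans (IH _) _; rewrite lee_fin big_cons.
    have S0 : 0 <= \sum_(x <- s) rnorm x by apply: sumr_ge0 => y _; exact: rnorm_ge0.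
    rewrite ler_sqr ?nnegrE ?addr_ge0 ?rnorm_ge0// addrA lerD2r.
    by rewrite (le_trans (rnormD _ _))// rnormZ1// norm_circle_point.
rewrite (integral_cst P measurableT) [X in (_ * X)%E](_ : _ = 1%E) ?mule1//.
exact: (probability_setT P).
Qed.

Lemma linear_L2E s :
  ((linear_L2 (fun k : 'I_(size s) => s`_k) ^+ 2)%:E = cavgs s sqn 0%R)%E.
Proof.
have mh := @curve_measurable_sqr R X.
have [c0 _] := curve_measurable_cavgs s mh.
rewrite /linear_L2 sqr_sqrtr; last by apply: Rintegral_ge0 => t _; exact: sqr_ge0.
rewrite /Rintegral -(integral_torus_cavgs s 0 mh) fineK.
  by apply: eq_integral => t _; rewrite add0r.
rewrite (_ : (\int[_]_x _)%E = cavgs s sqn 0%R).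
  rewrite ge0_fin_numE//; apply: le_lt_trans (cavgs_ub _ _) _; exact: ltry.
rewrite -(integral_torus_cavgs s 0 mh).
by apply: eq_integral => t _; rewrite add0r.
Qed.

Lemma sum_nth_seq (V : nmodType) (F : X -> V) s :
  \sum_(k < size s) F s`_k = \sum_(x <- s) F x.
Proof. by rewrite [RHS](big_nth 0) big_mkord. Qed.

Lemma has_type2_cavgs : has_type2 X -> exists2 K : R, 0 < K &
  forall s, (cavgs s sqn 0%R <= (K * \sum_(x <- s) rnorm x ^+ 2)%:E)%E.
Proof.
move=> [C C0 H]; exists (C ^+ 2); first by rewrite exprn_gt0.
move=> s; rewrite -linear_L2E lee_fin -(sum_nth_seq (fun x => rnorm x ^+ 2)).
have S0 : 0 <= \sum_(k < size s) rnorm s`_k ^+ 2.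
  by apply: sumr_ge0 => k _; exact: sqr_ge0.
have := H _ (fun k : 'I_(size s) => s`_k).
have L0 : 0 <= linear_L2 (fun k : 'I_(size s) => s`_k) by exact: sqrtr_ge0.
have R0 := mulr_ge0 (ltW C0) (sqrtr_ge0 (\sum_(k < size s) rnorm s`_k ^+ 2)).
by move=> h; rewrite -(sqr_sqrtr S0) -exprMn ler_sqr ?nnegrE.
Qed.

Lemma has_cotype_cavgs q : 2 <= q -> has_cotype X q -> exists2 K : R, 0 < K &
  forall s, ((K * (\sum_(x <- s) rnorm x `^ q) `^ (2 / q))%:E <= cavgs s sqn 0%R)%E.
Proof.
move=> q2 [C C0 H]; exists (C ^- 2); first by rewrite invr_gt0 exprn_gt0.
move=> s; rewrite -linear_L2E lee_fin -(sum_nth_seq (fun x => rnorm x `^ q)).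
have S0 : 0 <= \sum_(k < size s) rnorm s`_k `^ q.
  by apply: sumr_ge0 => k _; exact: powR_ge0.
have := H _ (fun k : 'I_(size s) => s`_k).
have L0 : 0 <= linear_L2 (fun k : 'I_(size s) => s`_k) by exact: sqrtr_ge0.
have R0 := mulr_ge0 (ltW C0) L0.
move=> h; rewrite ler_pdivrMl ?exprn_gt0// -exprMn.
rewrite [2 / q]mulrC powRrM powR_mulrn ?powR_ge0// ler_sqr ?nnegrE ?powR_ge0//.
Qed.

(* The lower bound is tested on the weights b^(q-2), with b proportional to the
   norms of the coefficients: they are extremal in Hoelder's inequality. *)
Lemma dft_estimate q : 2 <= q -> has_type2 X -> has_cotype X q ->
  exists2 D : R, 0 < D & forall (m : nat) (y : nat -> X),
    \sum_(0 <= l < 2 ^ m) rnorm (dft (2 ^ m) y l) `^ q <=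
    D * ((2 ^ m)%:R * \sum_(0 <= w < 2 ^ m) rnorm (y w) ^+ 2) `^ (q / 2).
Proof.
move=> q2 /has_type2_cavgs[K K0 HK] /(has_cotype_cavgs q2)[K1 K10 HK1].
have q0 : 0 < q by lra.
have mh := @curve_measurable_sqr R X.
exists ((K / K1) `^ (q / 2)); first by rewrite powR_gt0// divr_gt0.
move=> m y; set n := (2 ^ m)%N; set S := \sum_(0 <= l < n) _.
have S0 : 0 <= S by apply: sumr_ge0 => i _; exact: powR_ge0.
have n0 : 0 < n%:R :> R by rewrite ltr0n expn_gt0.
have Y0 : 0 <= \sum_(0 <= w < n) rnorm (y w) ^+ 2.
  by apply: sumr_ge0 => i _; exact: sqr_ge0.
rewrite -(powRM _ (ltW (divr_gt0 K0 K10)) (mulr_ge0 (ltW n0) Y0)).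
suff : S `^ (2 / q) <= K / K1 * (n%:R * \sum_(0 <= w < n) rnorm (y w) ^+ 2).
  have q20 : 0 <= q / 2 by lra.
  move=> /(ler_powR2r q20 (powR_ge0 _ _)); rewrite -powRrM.
  have -> : 2 / q * (q / 2) = 1 by field; rewrite gt_eqF.
  by rewrite powRr1.
move: (S0); rewrite le_eqVlt => /orP[/eqP <-|Sp].
  rewrite powR0 ?mulf_neq0 ?invr_eq0 ?pnatr_eq0 ?gt_eqF//.
  by rewrite !mulr_ge0// ?invr_ge0 ltW.
pose a l := rnorm (dft n y l).
have a0 l : 0 <= a l by exact: rnorm_ge0.
pose b l := a l / S `^ q^-1.
have Sq0 : 0 < S `^ q^-1 by rewrite powR_gt0.
have b0 l : 0 <= b l by rewrite divr_ge0// ltW.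
have bq l : b l `^ q = a l `^ q / S.
  by rewrite powRM// ?invr_ge0 ?(ltW Sq0)// powR_invr ?(ltW Sq0)// powRrVK// gt_eqF.
have sb : \sum_(l <- iota 0 n) b l `^ q = 1.
  under eq_bigr do rewrite bq.
  by rewrite -mulr_suml [X in X / _](_ : _ = S) ?divff ?gt_eqF// /S /index_iota subn0.
(* The factor n^(-1/2), which makes the transform unitary. *)
pose r : R := (Num.sqrt 2)^-1 ^+ m.
have r2 : r ^+ 2 = n%:R^-1.
  by rewrite /r -exprM mulnC exprM exprVn sqr_sqrtr// exprVn natrX.
pose z l := r%:C%C *: dft n y l.
(* The weights for which [holder_weight] applies. Absorbing moduli changes the vectors only, so the
   weights remain in this class along the induction. *)
pose W (w : seq R) := exists2 c : seq R, all (fun t => 0 <= t) c &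
  w = [seq t `^ (q - 2) | t <- c] /\ \sum_(t <- c) t `^ q = 1.
pose ps := [seq (b l `^ (q - 2), z l) | l <- iota 0 n].
have W0 w : W w -> all (fun c => 0 <= c) w.
  by move=> [c _ [-> _]]; rewrite all_map; apply/allP => t _ /=; exact: powR_ge0.
have HW (s : seq (R * X)) : W (map fst s) ->
    ((K1 * \sum_(p <- s) p.1 * rnorm p.2 ^+ 2)%:E <= cavgs (map snd s) sqn 0%R)%E.
  move=> [c c0 [cs c1]]; apply: le_trans (HK1 _); rewrite lee_fin ler_pM2l//.
  have sz : size c = size s by rewrite -[RHS](size_map fst) cs size_map.
  rewrite big_map (big_nth (0, 0)) [in X in _ <= X](big_nth (0, 0)).
  apply: le_trans (holder_weight (b := fun i => c`_i)
     (x := fun i => rnorm (nth (0, 0) s i).2) q2 _ _ _) => /=.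
  - rewrite big_seq [leRHS]big_seq le_eqVlt; apply/orP; left; apply/eqP.
    apply: eq_bigr => i; rewrite mem_index_iota => /andP[_ si].
    rewrite -(nth_map (0, 0) 0 fst si) cs (nth_map 0) ?sz//.
  - move=> i; have [ci|ci] := ltnP i (size c); last by rewrite nth_default.
    by move/allP: c0; apply; exact: mem_nth.
  - by move=> i; exact: rnorm_ge0.
  - by rewrite -[RHS]c1 [RHS](big_nth 0) sz.
have Wps : W (rev (map fst ps)).
  exists (rev [seq b l | l <- iota 0 n]).
    by rewrite all_rev all_map; apply/allP => l _ /=.
  split; first by rewrite map_rev /ps -!map_comp.
  by rewrite (perm_big [seq b l | l <- iota 0 n]) ?perm_rev//= big_map.
have lower := gauss_ge_of_circle_ge mh (ltW K10) W0 HW Wps.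
have upper := gauss_le_of_circle_le mh (ltW K0) HK [seq y w | w <- iota 0 n].
have gE : gavgs (flatten [seq cpair p.2 | p <- ps]) sqn =
          gavgs (flatten [seq cpair x | x <- [seq y w | w <- iota 0 n]]) sqn.
  rewrite /ps -!map_comp.
  exact: (@gequiv_dft R X m y sqn mh).
rewrite gE in lower; have := le_trans lower upper; rewrite lee_fin.
have M0 : 0 < 2 * gauss_moment :> R by rewrite mulr_gt0// gauss_moment_gt0.
set M := 2 * gauss_moment in M0 *.
rewrite !(mulrAC _ M) ler_pM2r// !big_map.
rewrite (eq_bigr (fun l => S `^ (2 / q) / n%:R * (b l `^ q))); last first.
  move=> l _ /=; rewrite /z rnormZr exprMn real_normK ?num_real// r2.
  have -> : S `^ (2 / q) = (S `^ q^-1) ^+ 2.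
    by rewrite -powR_mulrn ?(ltW Sq0)// -powRrM mulrC.
  have -> : rnorm (dft n y l) = b l * S `^ q^-1 by rewrite /b divfK ?gt_eqF.
  have -> : b l `^ q = b l `^ (q - 2) * b l ^+ 2.
    rewrite -powR_mulrn//; have [->|bl] := eqVneq (b l) 0.
      by rewrite [0 `^ q]powR0 ?gt_eqF// [0 `^ 2%:R]powR0 ?pnatr_eq0// mulr0.
    by rewrite -powRD ?subrK// bl implybT.
  by ring.
rewrite -mulr_sumr sb mulr1 => h.
move: h; rewrite /index_iota subn0; set Y := \sum_(_ <- _) _ => h.
have -> : K / K1 * (n%:R * Y) = n%:R * (K * Y) / K1 by field; rewrite gt_eqF.
rewrite ler_pdivlMr// -ler_pdivrMl//; apply: le_trans h.
rewrite le_eqVlt; apply/orP; left; apply/eqP; field; rewrite gt_eqF//.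
Qed.

End dft_estimate.

(** * Fourier cotype on a cyclic group of prime order *)

Section hashing.
Local Open Scope nat_scope.
Local Open Scope set_scope.

Let bucket p L i := i * L %/ p.

Lemma sum_pos_const p c : 0 < p -> \sum_(a < p | 0 < a) c = p.-1 * c.
Proof.
case: p => // n _; rewrite big_mkcond big_ord_recl /= add0n.
by rewrite sum_nat_const card_ord.
Qed.

Lemma card_lt_div p L K : 0 < L -> (forall d : 'I_p, 0 < d -> d * L < p -> d <= K) ->
  #|[set d : 'I_p | (0 < d) && (d * L < p)]| <= K.
Proof.
move=> L0 h; rewrite cardE -(size_map val) -(size_iota 1 K).
apply: uniq_leq_size; first by rewrite map_inj_uniq ?enum_uniq//; exact: val_inj.
move=> _ /mapP[d + ->]; rewrite mem_enum inE => /andP[d0 dL].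
by rewrite mem_iota add1n ltnS d0 h.
Qed.

(** Multiplication by c permutes the residues, so the count is that of the nonzero residues at
    distance less than p/L from 0 modulo p; [neg] exchanges the two sides of 0. *)
Lemma card_collision p L c : prime p -> 0 < L -> 0 < c < p ->
  #|[set a : 'I_p | let d := a * c %% p in
      (0 < d) && ((d * L < p) || ((p - d) * L < p))]| <= 2 * (p %/ L).
Proof.
move=> pp L0 /andP[c0 cp]; have p0 := prime_gt0 pp.
pose g (a : 'I_p) : 'I_p := Ordinal (ltn_pmod (a * c) p0).
have ginj : injective g.
  have aux (a b : 'I_p) : a <= b -> g a = g b -> a = b.
    move=> ab /(congr1 val) /= /eqP e; apply/val_inj/eqP.
    rewrite eq_sym in e; rewrite eqn_mod_dvd ?leq_mul2r ?ab ?orbT// -mulnBl in e.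
    move: e; rewrite Gauss_dvdl; last by rewrite prime_coprime// gtnNdvd.
    have [|ba] := posnP (b - a); first by move=> /eqP; rewrite subn_eq0 => ba; rewrite eqn_leq ab ba.
    by rewrite gtnNdvd// (leq_ltn_trans (leq_subr _ _)).
  by move=> a b; case/orP: (leq_total a b) => ab e; [|apply/esym]; apply: aux.
pose S1 := [set d : 'I_p | (0 < d) && (d * L < p)].
pose S := [set d : 'I_p | (0 < d) && ((d * L < p) || ((p - d) * L < p))].
have -> : [set a : 'I_p | let d := a * c %% p in
      (0 < d) && ((d * L < p) || ((p - d) * L < p))] = g @^-1: S.
  by apply/setP => a; rewrite !inE.
rewrite (card_preimset _ ginj).
have S1K : #|S1| <= p %/ L.
  by apply: card_lt_div => // d d0 dL; rewrite leq_divRL// ltnW.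
have sub x : (0 < x < p) -> p - x < p by lia.
(* Only at d = 0 is p - d not below p; the default value d is taken there. *)
pose neg (d : 'I_p) : 'I_p := if ltnP (p - d) p is LtnNotGeq h then Ordinal h else d.
have negE (d : 'I_p) : 0 < d -> neg d = p - d :> nat.
  by move=> d0; rewrite /neg; case: ltnP => //=; have := ltn_ord d; lia.
have : S \subset S1 :|: neg @: S1.
  apply/fintype.subsetP => d; rewrite !inE => /andP[d0 /orP[h|h]]; first by rewrite d0 h.
  apply/orP; right; apply/imsetP; exists (neg d).
    by rewrite inE negE// h subn_gt0 ltn_ord.
  apply: val_inj; rewrite /= !negE ?subn_gt0//; have := ltn_ord d; lia.
move=> /subset_leq_card /leq_trans; apply.
apply: leq_trans (leq_card_setU _ _) _.
by rewrite mul2n -addnn leq_add// (leq_trans (leq_imset_card _ _)).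
Qed.

Lemma sub_divn_lt x y L p : 0 < p -> x * L %/ p = y * L %/ p -> y <= x ->
  (x - y) * L < p.
Proof.
move=> p0 e yx; rewrite mulnBl {1}(divn_eq (x * L) p) {1}(divn_eq (y * L) p) e.
by rewrite subnDl (leq_ltn_trans (leq_subr _ _)) ?ltn_pmod.
Qed.

(** Two points of one window are at distance less than p/L, and the difference of the residues of a
    j and a j' is d or d - p: hence the two alternatives. *)
Lemma bucket_collision p L a j j' : prime p -> 0 < L -> j' < j -> j < p -> 0 < a < p ->
  bucket p L (a * j %% p) = bucket p L (a * j' %% p) ->
  let d := a * (j - j') %% p in
  (0 < d) && ((d * L < p) || ((p - d) * L < p)).
Proof.
move=> pp L0 jj jp /andP[a0 ap]; have p0 := prime_gt0 pp.
rewrite /bucket; set i := a * j %% p; set i' := a * j' %% p => w /=.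
set d := _ %% p.
have d0 : 0 < d.
  rewrite lt0n /d -/(dvdn p _) Euclid_dvdM// negb_or !gtnNdvd ?subn_gt0//.
  by rewrite (leq_ltn_trans (leq_subr _ _)).
rewrite d0 /=.
have ip : i < p by exact: ltn_pmod.
have i'p : i' < p by exact: ltn_pmod.
have dp : d < p by exact: ltn_pmod.
have e : (d + i') %% p = i.
  by rewrite /d /i /i' modnDm -mulnDr subnK// ltnW.
have [lt|ge] := ltnP (d + i') p.
  rewrite modn_small// in e; apply/orP; left.
  by rewrite -[d](addnK i') e sub_divn_lt// -e leq_addl.
have ei : d + i' = i + p.
  rewrite -[d + i'](subnK ge) modnDr modn_small in e; first by rewrite -e subnK.
  by rewrite ltn_subLR//; clear -dp i'p; lia.
apply/orP; right; rewrite (_ : p - d = i' - i); last first.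
  by clearbody d i i'; clear -ei dp; lia.
by rewrite sub_divn_lt//; clearbody d i i'; clear -ei dp; lia.
Qed.

(** The origin of the constant 5: for each multiplier the diagonal pairs give m collisions, and over
    all multipliers the other pairs give at most 2 m p <= 4 m (p - 1), as p >= 2. *)
Let averaging_contradiction p m K : 1 < p ->
  p.-1 * (5 * m).+1 <= p.-1 * m + m * m * (2 * K) -> m * K <= p -> False.
Proof.
case: p => // -[//|n] _ /=; have -> : m * m * (2 * K) = 2 * m * (m * K) by lia.
set q := m * K => h1 h2; have : 2 * m * q <= 2 * m * n.+2 by rewrite leq_mul2l h2 orbT.
move: h1; clearbody q; clear h2; nia.
Qed.

(* The average over the multipliers of the number of collisions in A of the
   hash functions j |-> bucket (a j mod p) is O(|A|). *)
Lemma exists_multiplier p L (A : pred nat) : prime p -> 0 < L ->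
  \sum_(j < p) A j <= L ->
  exists2 a, 0 < a < p &
    \sum_(j < p) \sum_(j' < p)
      (A j && A j' && (bucket p L (a * j %% p) == bucket p L (a * j' %% p))) <=
    5 * \sum_(j < p) A j.
Proof.
move=> pp L0 mL; set m := \sum_(j < p) _ in mL *.
have p0 := prime_gt0 pp; have p1 := prime_gt1 pp.
pose N (a : nat) := \sum_(j < p) \sum_(j' < p)
      (A j && A j' && (bucket p L (a * j %% p) == bucket p L (a * j' %% p))).
have [/existsP[a /andP[a0 Na]]|/existsPn h] :=
  boolP [exists a : 'I_p, (0 < a) && (N a <= 5 * m)].
  by exists a => //; rewrite a0 ltn_ord.
exfalso.
have lower : p.-1 * (5 * m).+1 <= \sum_(a < p | 0 < a) N a.
  rewrite -[leqLHS](_ : \sum_(a < p | 0 < a) (5 * m).+1 = _); last first.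
    exact: sum_pos_const.
  by apply: leq_sum => a a0; rewrite ltnNge; have := h a; rewrite a0.
have upper : \sum_(a < p | 0 < a) N a <= p.-1 * m + m * m * (2 * (p %/ L)).
  rewrite /N exchange_big /=.
  apply: leq_trans (_ : \sum_(j < p) \sum_(j' < p)
     ((j == j') * A j * p.-1 + A j * A j' * (2 * (p %/ L))) <= _).
    apply: leq_sum => j _; rewrite exchange_big /=; apply: leq_sum => j' _.
    have [->|jj] := eqVneq j j'.
      rewrite mul1n; apply: leq_trans (leq_addr _ _).
      rewrite -[leqRHS](_ : \sum_(a < p | 0 < a) (A j' : nat) = _); last first.
        by rewrite sum_pos_const// mulnC.
      by apply: leq_sum => a _; rewrite eqxx andbT andbb.
    rewrite /= !mul0n ?add0n.
    have [Aj|] := boolP (A j); last by move=> _; rewrite big1.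
    have [Aj'|] := boolP (A j'); last by move=> _; rewrite big1.
    rewrite !mul1n /=.
    wlog lt : j j' jj Aj Aj' / j' < j.
      move=> H; case/orP: (leq_total j j') => le; last first.
        by apply: H => //; rewrite ltn_neqAle le eq_sym (inj_eq val_inj) jj.
      under eq_bigr do rewrite eq_sym.
      by apply: H => //; [rewrite eq_sym|rewrite ltn_neqAle le (inj_eq val_inj) jj].
    apply: leq_trans (card_collision (c := j - j') pp L0 _); last first.
      by rewrite subn_gt0 lt (leq_ltn_trans (leq_subr _ _)).
    rewrite -sum1_card big_mkcond [leqRHS]big_mkcond /=; apply: leq_sum => a _.
    rewrite inE; case: ifP => // a0; case: eqP => //= e.
    have ap : 0 < a < p by rewrite a0 ltn_ord.
    by have /= -> := bucket_collision pp L0 lt (ltn_ord _) ap e.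
  rewrite leq_eqVlt; apply/orP; left; apply/eqP.
  under eq_bigr do rewrite big_split /=.
  rewrite big_split /=; congr (_ + _).
    rewrite mulnC /m big_distrl /=; apply: eq_bigr => j _.
    rewrite (bigD1 j)//= eqxx mul1n big1 ?addn0// => i ij.
    by rewrite eq_sym (negbTE ij) !mul0n.
  under eq_bigr do rewrite -big_distrl -big_distrr /=.
  by rewrite -!big_distrl.
have KL : p %/ L * L <= p by exact: leq_divM.
have := leq_trans lower upper.
have mK : m * (p %/ L) <= p by rewrite mulnC (leq_trans _ KL)// leq_mul2l mL orbT.
by move=> h'; exact: (averaging_contradiction p1 h' mK).
Qed.

End hashing.

(** * Transforms of functions dominated by an indicator *)

Section restricted_type.
Context {R : realType} (X : completeNormedModType R[i]).
Variables (q D : R).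
Hypotheses (q2 : 2 <= q) (D0 : 0 < D).
Hypothesis dftD : forall (m : nat) (y : nat -> X),
    \sum_(0 <= l < 2 ^ m) rnorm (dft (2 ^ m) y l) `^ q <=
    D * ((2 ^ m)%:R * \sum_(0 <= w < 2 ^ m) rnorm (y w) ^+ 2) `^ (q / 2).
Local Notation e := (@circle_point R).

Let q0 : 0 < q. Proof. by move: q2; lra. Qed.

(** Squared occupation numbers count the colliding pairs; a bound on collisions thus becomes a bound
    on the l_2 norm of the bucket sums. *)
Lemma bucket_square_sum (p L : nat) (A : pred nat) (w : nat -> nat) :
  (forall j, (j < p)%N -> (w j < L)%N) ->
  (\sum_(0 <= v < L) (\sum_(j < p) (A j && (w j == v))) ^ 2 =
   \sum_(j < p) \sum_(j' < p) (A j && A j' && (w j == w j')))%N.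
Proof.
move=> wL; under eq_bigr => v _.
  rewrite expnS expn1 big_distrlr /=.
  over.
rewrite exchange_big /=; apply: eq_bigr => j _.
rewrite exchange_big /=; apply: eq_bigr => j' _.
rewrite big_mkord (bigD1 (Ordinal (wL j (ltn_ord j))))//= eqxx andbT.
rewrite big1 ?addn0 => [|v]; last first.
  by rewrite -val_eqE /= eq_sym => /negbTE ->; rewrite andbF.
by rewrite mulnb [w j' == _]eq_sym andbA.
Qed.

Lemma bucket_estimate (p s N : nat) (A : pred nat) (w : nat -> nat) (g : nat -> X) :
  (forall j, (j < p)%N -> (w j < 2 ^ s)%N) ->
  (forall j, (j < p)%N -> rnorm (g j) <= (A j)%:R) ->
  (\sum_(j < p) \sum_(j' < p) (A j && A j' && (w j == w j')) <= N)%N ->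
  \sum_(0 <= l < 2 ^ s)
    rnorm (\sum_(j < p) e ((w j * l)%:R / (2 ^ s)%:R) *: g j) `^ q <=
  D * ((2 ^ s * N)%:R) `^ (q / 2).
Proof.
move=> wL gA HN; set L := (2 ^ s)%N.
pose y v := \sum_(j < p | w j == v) g j.
have E l : \sum_(j < p) e ((w j * l)%:R / L%:R) *: g j = dft L y l.
  rewrite /dft big_mkord; under [RHS]eq_bigr do rewrite /y scaler_sumr big_mkcond /=.
  rewrite exchange_big /=; apply: eq_bigr => j _.
  rewrite (bigD1 (Ordinal (wL j (ltn_ord j))))//= eqxx big1 ?addr0// => v.
  by rewrite -val_eqE /= eq_sym => /negbTE ->.
under eq_bigr do rewrite E.
apply: le_trans (dftD s y) _; rewrite ler_pM2l//.
have Y0 : 0 <= \sum_(0 <= v < L) rnorm (y v) ^+ 2.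
  by apply: sumr_ge0 => v _; exact: sqr_ge0.
apply: ler_powR2r; [by move: q0; lra|by rewrite mulr_ge0|].
rewrite natrM ler_wpM2l//; apply: le_trans (_ : (_ <= (\sum_(0 <= v < L)
   (\sum_(j < p) (A j && (w j == v))) ^ 2)%N%:R) ) _; last first.
  by rewrite ler_nat bucket_square_sum.
rewrite natr_sum; apply: ler_sum => v _; rewrite natrX.
rewrite ler_sqr ?nnegrE ?rnorm_ge0//.
apply: le_trans (rnorm_sum _ _ _) _; rewrite natr_sum big_mkcond /=.
apply: ler_sum => j _; case: eqP => _; last by rewrite andbF.
by rewrite andbT gA.
Qed.

Lemma circle_point_telescope (t : R) n :
  e (n%:R * t) = 1 + \sum_(0 <= u < n) (e (u.+1%:R * t) - e (u%:R * t)).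
Proof. by rewrite telescope_sumr// mul0r circle_point0 addrC subrK. Qed.

(** The total weight of the decomposition in [block_estimate]: 1 for the main term, and p increments
    of size at most 4 pi / p. *)
Let kappa : R := 1 + 4 * pi.

(* The Fourier phases at the p-th roots of unity are compared with phases at
   the 2^s-th roots, over a range of frequencies of length 2^s. *)
Lemma block_estimate (p s N : nat) (A : pred nat) (i : nat -> nat) (g : nat -> X) :
  (0 < p)%N ->
  (forall j, (j < p)%N -> (i j < p)%N) ->
  (forall j, (j < p)%N -> rnorm (g j) <= (A j)%:R) ->
  (\sum_(j < p) \sum_(j' < p)
     (A j && A j' && (i j * 2 ^ s %/ p == i j' * 2 ^ s %/ p)) <= N)%N ->
  \sum_(0 <= l < 2 ^ s)
    rnorm (\sum_(j < p) e ((i j * l)%:R / p%:R) *: g j) `^ q <=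
  kappa `^ q * (D * ((2 ^ s * N)%:R) `^ (q / 2)).
Proof.
move=> p0 ip gA HN; set L := (2 ^ s)%N.
have L0 : (0 < L)%N by rewrite expn_gt0.
have Lr : L%:R != 0 :> R by rewrite pnatr_eq0 -lt0n.
have pr : p%:R != 0 :> R by rewrite pnatr_eq0 -lt0n.
have pi0 : 0 < pi :> R by exact: pi_gt0.
have kap0 : 0 < kappa by rewrite /kappa; lra.
pose w j := (i j * L %/ p)%N; pose r j := (i j * L %% p)%N.
have wL j : (j < p)%N -> (w j < L)%N.
  by move=> jp; rewrite /w ltn_divLR// mulnC ltn_pmul2l// ip.
pose G l (B : nat -> bool) := rnorm (\sum_(j < p) e ((w j * l)%:R / L%:R) *:
   (if B j then g j else 0)).
have GB (B : nat -> bool) : \sum_(0 <= l < L) G l B `^ q <= D * ((L * N)%:R) `^ (q / 2).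
  apply: (@bucket_estimate p s N A w (fun j => if B j then g j else 0)) => // j jp.
  by case: (B j); [exact: gA|rewrite rnorm0].
have step l : (l < L)%N ->
    rnorm (\sum_(j < p) e ((i j * l)%:R / p%:R) *: g j) <=
    G l xpredT + \sum_(0 <= u < p) (4 * pi / p%:R) * G l (fun j => u < r j)%N.
  move=> lL; pose t : R := l%:R / (p%:R * L%:R).
  (* The correcting phase depends on j through the remainder [r j]. Telescoping it leaves
     coefficients independent of j, and the dependence on j becomes the restriction u < r j of the
     function, which [bucket_estimate] allows. *)
  have phase j : (j < p)%N -> e ((i j * l)%:R / p%:R) =
      e ((w j * l)%:R / L%:R) * (1 + \sum_(0 <= u < p)
        if (u < r j)%N then e (u.+1%:R * t) - e (u%:R * t) else 0).
    move=> jp.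
    have -> : (i j * l)%:R / p%:R = (w j * l)%:R / L%:R + (r j)%:R * t :> R.
      have /(congr1 (fun n => n%:R : R)) := divn_eq (i j * L) p.
      rewrite natrD !natrM -/(w j) -/(r j) => E.
      have -> : (i j)%:R = ((w j)%:R * p%:R + (r j)%:R) / L%:R :> R.
        by rewrite -E mulfK.
      by rewrite /t; field; rewrite Lr pr.
    rewrite circle_pointD circle_point_telescope; congr (_ * (1 + _)).
    have rp : (r j <= p)%N by rewrite ltnW// ltn_pmod.
    rewrite (big_cat_nat (leq0n _) rp)//= [X in _ = _ + X]big_nat_cond [X in _ = _ + X]big1 ?addr0.
      by rewrite [RHS]big_nat_cond [LHS]big_nat_cond; apply: eq_bigr => u /andP[/andP[_ ->] _].
    by move=> u /andP[/andP[ru _] _]; rewrite ltnNge ru.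
  have -> : \sum_(j < p) e ((i j * l)%:R / p%:R) *: g j =
     \sum_(j < p) e ((w j * l)%:R / L%:R) *: g j +
     \sum_(0 <= u < p) (e (u.+1%:R * t) - e (u%:R * t)) *:
       \sum_(j < p) e ((w j * l)%:R / L%:R) *: (if (u < r j)%N then g j else 0).
    rewrite (eq_bigr (fun j : 'I_p => e ((w j * l)%:R / L%:R) *: g j +
       \sum_(0 <= u < p) (e (u.+1%:R * t) - e (u%:R * t)) *:
         (e ((w j * l)%:R / L%:R) *: (if (u < r j)%N then g j else 0)))); last first.
      move=> j _; rewrite phase// mulrDr mulr1 scalerDl mulr_sumr scaler_suml.
      congr (_ + _); apply: eq_bigr => u _; case: ifP => _.
        by rewrite mulrC scalerA.
      by rewrite mulr0 scale0r !scaler0.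
    rewrite big_split/=; congr (_ + _); rewrite exchange_big /=.
    by apply: eq_bigr => u _; rewrite scaler_sumr.
  apply: le_trans (rnormD _ _) _; rewrite lerD2l.
  apply: le_trans (rnorm_sum _ _ _) _; apply: ler_sum => u _.
  rewrite rnormZ ler_wpM2r ?rnorm_ge0//.
  apply: le_trans (circle_point_lipschitz _ _) _.
  have -> : u.+1%:R * t - u%:R * t = t by rewrite -natr1; ring.
  rewrite -!mulrA ler_pM2l// ler_pM2l// /t invfM mulrA ger0_norm; last first.
    by rewrite divr_ge0// divr_ge0.
  rewrite ler_pdivrMr ?ltr0n// mulrC ler_pM2l ?invr_gt0 ?ltr0n//.
  by rewrite ler_nat ltnW.
(* The main term is indexed by [None] and the increments by [Some u], so that a single use of
   [jensen_powR] covers all of them. *)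
pose c (o : option nat) : R := if o is Some _ then 4 * pi / p%:R else 1.
pose idx : seq (option nat) := None :: [seq Some u | u <- iota 0 p].
pose phi l (o : option nat) : R :=
  if o is Some u then G l (fun j => u < r j)%N else G l xpredT.
have c0 o : o \in idx -> 0 <= c o.
  by move=> _; case: o => [u|] /=; rewrite ?ler01// divr_ge0// mulr_ge0// ltW.
have phi0 l o : o \in idx -> 0 <= phi l o.
  by move=> _; case: o => [u|] /=; exact: rnorm_ge0.
have cs : \sum_(o <- idx) c o = kappa.
  rewrite big_cons big_map big_const_seq count_predT size_iota iter_addr_0 /c.
  by rewrite -[_ *+ p]mulr_natr divfK.
have phiE l : G l xpredT + \sum_(0 <= u < p) (4 * pi / p%:R) * G l (fun j => u < r j)%N
    = \sum_(o <- idx) c o * phi l o.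
  by rewrite big_cons big_map mul1r /index_iota subn0.
set B := D * _.
have q1 : 1 <= q by move: q2; lra.
apply: (@le_trans _ _ (\sum_(0 <= l < L)
   kappa `^ (q - 1) * \sum_(o <- idx) c o * phi l o `^ q)).
  rewrite big_nat [leRHS]big_nat; apply: ler_sum => l /andP[_ lL].
  apply: le_trans (ler_powR2r (ltW q0) (rnorm_ge0 _) (step l lL)) _.
  rewrite phiE -cs; apply: jensen_powR => //; first exact: phi0.
  by rewrite cs.
rewrite -mulr_sumr exchange_big /=.
have -> : kappa `^ q = kappa `^ (q - 1) * kappa.
  rewrite -{1}(subrK 1 q) (@powRD _ kappa (q - 1) 1) ?powRr1 ?(ltW kap0)//.
  by rewrite (gt_eqF kap0) implybT.
rewrite -mulrA ler_wpM2l ?powR_ge0// -cs mulr_suml.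
rewrite big_seq [leRHS]big_seq; apply: ler_sum => o io.
by rewrite -mulr_sumr ler_wpM2l ?c0//; case: o io => [u|] io; exact: GB.
Qed.

Lemma sum_blocks_le (V : numDomainType) (F : nat -> V) (p L n : nat) :
  (forall k, 0 <= F k) -> (p <= n * L)%N ->
  \sum_(0 <= k < p) F k <= \sum_(0 <= b < n) \sum_(0 <= l < L) F (b * L + l)%N.
Proof.
move=> F0 pn.
have -> : \sum_(0 <= b < n) \sum_(0 <= l < L) F (b * L + l)%N = \sum_(0 <= k < n * L) F k.
  elim: n {pn} => [|n IH]; first by rewrite mul0n !big_geq.
  rewrite big_nat_recr//= IH mulSn addnC [RHS](big_cat_nat (leq0n _) (leq_addr L (n * L)))//=.
  congr (_ + _); rewrite -{2}[(n * L)%N]add0n big_addn addKn.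
  by apply: eq_bigr => l _; rewrite addnC.
by rewrite (big_cat_nat (leq0n _) pn)//= lerDl sumr_ge0.
Qed.

Lemma dft_mod p (f : nat -> X) k : (0 < p)%N -> dft p f (k %% p) = dft p f k.
Proof.
move=> p0; rewrite [in RHS](divn_eq k p) addnC.
by elim: (k %/ p)%N => [|n IH]; rewrite ?mul0n ?addn0// mulSn [(p + _)%N]addnC addnA dft_periodic.
Qed.

(** Multiplying the frequencies by a has the same effect as multiplying the points by a, and it
    permutes the residues: the choice of the multiplier is free. *)
Lemma sum_dft_multiplier p a (f : nat -> X) (F : X -> R) : prime p -> (0 < a < p)%N ->
  \sum_(k < p) F (dft p f (a * k)) = \sum_(k < p) F (dft p f k).
Proof.
move=> pp /andP[a0 ap]; have p0 := prime_gt0 pp.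
pose g (k : 'I_p) : 'I_p := Ordinal (ltn_pmod (a * k) p0).
have ginj : injective g.
  have aux (x y : 'I_p) : (x <= y)%N -> g x = g y -> x = y.
    move=> xy /(congr1 val) /= /eqP E; apply/val_inj/eqP.
    rewrite eq_sym in E; rewrite eqn_mod_dvd ?leq_mul2l ?xy ?orbT// -mulnBr in E.
    move: E; rewrite Gauss_dvdr; last by rewrite prime_coprime// gtnNdvd.
    have [|ba] := posnP (y - x).
      by move=> /eqP; rewrite subn_eq0 => ba; rewrite eqn_leq xy ba.
    by rewrite gtnNdvd// (leq_ltn_trans (leq_subr _ _)).
  by move=> x y; case/orP: (leq_total x y) => xy E; [|apply/esym]; apply: aux.
rewrite [RHS](reindex_inj ginj); apply: eq_bigr => k _.
by rewrite /= dft_mod.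
Qed.

Lemma restricted_type : exists2 C : R, 0 < C &
  forall (p : nat) (A : pred nat) (f : nat -> X), prime p ->
    (forall j, (j < p)%N -> rnorm (f j) <= (A j)%:R) ->
    \sum_(k < p) rnorm (dft p f k) `^ q <=
    C * p%:R * ((\sum_(j < p) A j)%N%:R) `^ (q - 1).
Proof.
(* The 10 comes from L * 5 m <= 10 m^2; the 3 in the final constant bounds the number of blocks
   times m by 3 p. *)
pose B := kappa `^ q * (D * 10 `^ (q / 2)).
have pi0 : 0 < pi :> R by exact: pi_gt0.
have B0 : 0 < B by rewrite /B !mulr_gt0// powR_gt0// /kappa; lra.
exists (3 * B); first by rewrite mulr_gt0.
move=> p A f pp fA; have p0 := prime_gt0 pp.
set m := (\sum_(j < p) A j)%N.
have [m0|m0] := posnP m.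
  rewrite m0 powR0 ?mulr0; last by move: q2 => ?; rewrite gt_eqF//; lra.
  rewrite big1// => k _; rewrite [dft p f k](_ : _ = 0) ?rnorm0 ?powR0 ?gt_eqF//.
  rewrite /dft big_mkord big1// => j _.
  have /eqP := m0; rewrite sum_nat_eq0 => /forallP/(_ j) /eqP Aj.
  have := fA j (ltn_ord j); rewrite Aj => h.
  suff -> : f j = 0 by rewrite scaler0.
  by apply/eqP; rewrite -rnorm_eq0 eq_le h rnorm_ge0.
have mp : (m <= p)%N.
  by rewrite -[leqRHS]card_ord -sum1_card; apply: leq_sum => j _; exact: leq_b1.
have /andP[t1 t2] := trunc_log_bounds (isT : (1 < 2)%N) m0.
(* This makes m < L <= 2 m: L is large enough for the hashing and small enough for the bound on each
   block. *)
pose s := (trunc_log 2 m).+1; pose L := (2 ^ s)%N.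
have mL : (m <= L)%N by exact: ltnW.
have L2 : (L <= 2 * m)%N by rewrite /L /s expnS leq_mul2l t1.
have L0 : (0 < L)%N by rewrite expn_gt0.
have [a ap Na] := exists_multiplier pp L0 mL.
rewrite -(sum_dft_multiplier f (fun x => rnorm x `^ q) pp ap).
pose n := (p %/ L).+1.
rewrite -(big_mkord xpredT (fun k => rnorm (dft p f (a * k)) `^ q)).
apply: le_trans (sum_blocks_le (n := n) (L := L) _ _) _.
- by move=> k; exact: powR_ge0.
- by rewrite ltnW// ltn_ceil.
apply: (@le_trans _ _ (\sum_(0 <= b < n) B * m%:R `^ q)).
  apply: ler_sum => b _.
  (* The offset b L of the block is a modulation of [f], which preserves the norms of its values. *)
  have := @block_estimate p s (5 * m) A (fun j => a * j %% p)%N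
    (fun j => e (((a * j %% p) * (b * L))%:R / p%:R) *: f j) p0.
  move=> H; apply: le_trans (_ : kappa `^ q * (D * ((L * (5 * m))%:R) `^ (q / 2)) <= _).
    apply: le_trans (H _ _ Na).
    - rewrite le_eqVlt; apply/orP; left; apply/eqP; apply: eq_bigr => l _.
      congr (rnorm _ `^ q); rewrite /dft big_mkord; apply: eq_bigr => j _.
      rewrite scalerA -circle_pointD; congr (_ *: _).
      have -> : (a * j %% p * l)%:R / p%:R + (a * j %% p * (b * L))%:R / p%:R
          = (a * j %% p * (b * L + l))%:R / p%:R :> R.
        by rewrite -mulrDl -natrD -mulnDr [(l + _)%N]addnC.
      rewrite mulnCA mulnA {1}(divn_eq (a * j) p) mulnDl natrD mulrDl circle_pointD.
      set x := (a * j %/ p)%N.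
      have -> : (x * p * (b * L + l))%:R / p%:R = (x * (b * L + l))%:R :> R.
        by rewrite mulnAC natrM mulfK// pnatr_eq0 -lt0n.
      by rewrite circle_point_nat mul1r.
    - by move=> j _; exact: ltn_pmod.
    - by move=> j jp; rewrite rnormZ1 ?norm_circle_point// fA.
  rewrite /B -!mulrA; rewrite ler_wpM2l ?powR_ge0// ler_wpM2l ?(ltW D0)//.
  have -> : m%:R `^ q = (m%:R ^+ 2) `^ (q / 2) :> R.
    by rewrite -powR_mulrn// -powRrM; congr (_ `^ _); field.
  rewrite -powRM ?sqr_ge0//; apply: ler_powR2r; rewrite ?ler0n//; first by move: q0; lra.
  by rewrite -natrX -[10]/(10%:R) -natrM ler_nat; nia.
rewrite big_const_nat subn0 iter_addr_0 -[leLHS]mulr_natr.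
have -> : m%:R `^ q = m%:R `^ (q - 1) * m%:R :> R.
  rewrite -{1}(subrK 1 q) (@powRD _ m%:R (q - 1) 1) ?powRr1//.
  by rewrite pnatr_eq0 (gtn_eqF m0) implybT.
have -> : B * (m%:R `^ (q - 1) * m%:R) * n%:R = B * m%:R `^ (q - 1) * (n * m)%:R.
  by rewrite natrM; ring.
have -> : 3 * B * p%:R * m%:R `^ (q - 1) = B * m%:R `^ (q - 1) * (3 * p)%:R.
  by rewrite natrM; ring.
apply: ler_wpM2l; first by rewrite mulr_ge0 ?powR_ge0 ?(ltW B0).
rewrite ler_nat /n.
have := leq_divM p L; nia.
Qed.

End restricted_type.

(** * Real interpolation *)

Section marcinkiewicz.
Context {R : realType}.
Variables (q r C0 : R).
Hypotheses (q2 : 2 <= q) (qr : q < r) (C00 : 0 < C0).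

Local Notation t := ((r - 1)^-1).
Local Notation two a := ((2 : R) `^ a).

Let r1 : 0 < r - 1. Proof. by move: q2 qr; lra. Qed.
Let t0 : 0 < t. Proof. by rewrite invr_gt0. Qed.

Let twoD a b : two (a + b) = two a * two b.
Proof. by rewrite powRD// pnatr_eq0 implybT. Qed.
Let twoM a b : (two a) `^ b = two (a * b). Proof. by rewrite powRrM. Qed.
Let two_gt0 a : 0 < two a. Proof. by rewrite powR_gt0. Qed.
Let two_le a b : a <= b -> two a <= two b.
Proof. by move=> ab; apply: ler_powR => //; lra. Qed.
Let two_nat a (n : nat) : (two a) ^+ n = two (a * n%:R).
Proof. by rewrite -powR_mulrn ?powR_ge0// twoM. Qed.

Let two_gt1 a : 0 < a -> 1 < two a.
Proof.
move=> a0; rewrite /powR pnatr_eq0 /= expR_gt1 mulr_gt0// ln_gt0//; lra.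
Qed.

(** The weights 2^(s n) are for Jensen's inequality over the levels. Since s (q-1) = t (r-q) / 2,
    their total costs half of the gain 2^(- t (r-q) i), and the other half remains to sum over the
    points. *)
Let s : R := t * (r - q) / (2 * (q - 1)).
Let s0 : 0 < s.
Proof. by rewrite divr_gt0 ?mulr_gt0//; move: q2 qr; lra. Qed.
Let eta1 : 1 < two s.
Proof. exact: two_gt1. Qed.
Let c : R := two s / (two s - 1).

Let geometric_le N i : (N <= i.+1)%N ->
  \sum_(0 <= n < N) two (s * n%:R) <= c * two (s * i%:R).
Proof.
move=> Ni; have e0 : 0 < two s - 1 by rewrite subr_gt0.
under eq_bigr do rewrite -two_nat.
rewrite big_mkord /c mulrAC ler_pdivlMr// mulrC -subrX1.
apply: le_trans (_ : two s ^+ N <= _); first by rewrite lerBlDr lerDl.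
by rewrite -two_nat -exprS ler_weXn2l// ltW.
Qed.

Let minn_above i M n : ((minn i.+1 M <= n < M) && ~~ (i < n))%N = false.
Proof. clear; lia. Qed.

Let minn_below i M n : ((0 <= n < minn i.+1 M) && ~~ (i < n))%N = (0 <= n < minn i.+1 M)%N.
Proof. clear; lia. Qed.

(* An interpolation argument: at a point k of height x k, the levels beyond the
   index i with x k ~ 10 * 2^(- t i) contribute at most half of x k. *)
Lemma marcinkiewicz_sum (p M : nat) (phi : nat -> nat -> R) (mu x : nat -> R) :
  (forall n k, 0 <= phi n k) -> (forall n, 0 <= mu n) -> (forall k, 0 <= x k) ->
  (forall k, (k < p)%N -> x k <= \sum_(0 <= n < M) phi n k) ->
  (forall n k, (k < p)%N -> phi n k <= 2 ^+ n * mu n) ->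
  (forall n, \sum_(k < p) phi n k `^ q <= C0 * (2 ^+ n) `^ q * mu n `^ (q - 1)) ->
  \sum_(0 <= n < M) two ((1 + t) * n%:R) * mu n <= 5 ->
  \sum_(k < p) x k `^ r <=
  10 `^ (r - q) * 2 `^ q * c `^ (q - 1) * (C0 * 5 `^ (q - 2) * 5).
Proof.
move=> phi0 mu0 x0 x_le phi_le phi_q mu5.
have q0 : 0 < q by move: q2; lra.
have q1 : 1 <= q by move: q2; lra.
have qm1 : 0 < q - 1 by move: q2; lra.
have rq : 0 < r - q by rewrite subr_gt0.
have c0 : 0 < c by rewrite divr_gt0// subr_gt0.
set Kc := 10 `^ (r - q) * 2 `^ q * c `^ (q - 1).
have Kc0 : 0 < Kc by rewrite !mulr_gt0 ?powR_gt0//; lra.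
have two2 n : 2 ^+ n = two n%:R by rewrite powR_mulrn.
have tail J : \sum_(0 <= n < M | (J <= n)%N) 2 ^+ n * mu n <= 5 * two (- t * J%:R).
  apply: le_trans (_ : \sum_(0 <= n < M) (two ((1 + t) * n%:R) * mu n) * two (- t * J%:R) <= _); last first.
    by rewrite -mulr_suml ler_wpM2r// powR_ge0.
  rewrite big_mkcond /=; apply: ler_sum => n _.
  case: ifP => Jn; last by rewrite !mulr_ge0// powR_ge0.
  rewrite [leRHS]mulrAC ler_wpM2r// -twoD two2; apply: two_le.
  have : (J%:R : R) <= n%:R by rewrite ler_nat.
  by move: t0; nra.
have point k : (k < p)%N ->
    x k `^ r <= Kc * \sum_(0 <= n < M) two (- (t * (r - q) * n%:R)) * phi n k `^ q.
  move=> kp.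
  have sum_ge0 : 0 <= \sum_(0 <= n < M) two (- (t * (r - q) * n%:R)) * phi n k `^ q.
    by apply: sumr_ge0 => n _; rewrite mulr_ge0// powR_ge0.
  have := x0 k; rewrite le_eqVlt => /orP[/eqP <-|xk0].
    rewrite powR0; last by rewrite gt_eqF//; move: r1; lra.
    by rewrite mulr_ge0// ltW.
  have x5 : x k <= 5.
    apply: le_trans (x_le k kp) (le_trans _ mu5).
    apply: ler_sum => n _; apply: le_trans (phi_le n k kp) _.
    rewrite ler_wpM2r// two2; apply: two_le; rewrite mulrDl mul1r lerDl.
    by rewrite mulr_ge0// ltW.
  have exJ : exists J, 10 * two (- t * J%:R) <= x k.
    have b1 : two (- t) < 1.
      have -> : two (- t) = (two t)^-1.
        by rewrite -(powR_inv1 (powR_ge0 _ _)) twoM mulrN1.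
      by rewrite invf_lt1// two_gt1.
    have xk10 : 0 < x k / 10 by rewrite divr_gt0.
    have := @cvg_expr R (two (- t)); rewrite ger0_norm ?powR_ge0// => /(_ b1).
    move/cvgrPdist_lt => /(_ _ xk10) [J _ /(_ J (leqnn J))] /=.
    rewrite sub0r normrN ger0_norm ?exprn_ge0 ?powR_ge0// two_nat => h.
    by exists J; lra.
  (* J is positive because x k <= 5 < 10. Its predecessor i fails the inequality, so x k is at most
     10 * 2^(- t i), while the levels beyond i contribute at most 5 * 2^(- t J) <= x k / 2. *)
  have [J HJ minJ] := ex_minnP exJ.
  case: J HJ minJ => [|i] HJ minJ.
    by exfalso; move: HJ; rewrite mulr0 powRr0; lra.
  have xi : x k <= 10 * two (- t * i%:R).
    rewrite leNgt; apply/negP => h.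
    by have := minJ i (ltW h); rewrite ltnn.
  pose N := minn i.+1 M.
  have half : x k <= 2 * \sum_(0 <= n < N) phi n k.
    have := x_le k kp; rewrite (bigID (fun n => (i.+1 <= n)%N))/=.
    have h1 : \sum_(0 <= n < M | (i < n)%N) phi n k <= x k / 2.
      apply: le_trans (_ : \sum_(0 <= n < M | (i.+1 <= n)%N) 2 ^+ n * mu n <= _).
        by apply: ler_sum => n _; exact: phi_le.
      by apply: le_trans (tail _) _; lra.
    have h2 : \sum_(0 <= n < M | ~~ (i < n)%N) phi n k = \sum_(0 <= n < N) phi n k.
      rewrite (big_cat_nat (leq0n N) (geq_minr i.+1 M))/=.
      rewrite [X in _ + X]big_nat_cond [X in _ + X]big1 ?addr0; last first.
        by move=> n; rewrite minn_above.
      rewrite big_nat_cond [RHS]big_nat; apply: eq_bigl => n.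
      exact: minn_below.
    by rewrite h2; lra.
  have Ni : (N <= i.+1)%N by exact: geq_minl.
  pose W := \sum_(0 <= n < N) two (s * n%:R).
  have N0 : (0 < N)%N.
    rewrite lt0n; apply/eqP => N0; move: half; rewrite N0 big_geq// mulr0; lra.
  have W0 : 0 < W.
    rewrite /W -(prednK N0) big_nat_recr//= ltr_wpDl//.
    by apply: sumr_ge0 => n _; exact: ltW.
  have J1 : (\sum_(0 <= n < N) phi n k) `^ q <=
      W `^ (q - 1) * \sum_(0 <= n < N) two (- (t * (r - q) / 2 * n%:R)) * phi n k `^ q.
    have := @jensen_powR R nat (index_iota 0 N) (fun n => two (s * n%:R))
      (fun n => phi n k / two (s * n%:R)) q q1.
    have E1 : \sum_(0 <= n < N) two (s * n%:R) * (phi n k / two (s * n%:R)) =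
        \sum_(0 <= n < N) phi n k.
      by apply: eq_bigr => n _; rewrite mulrC divfK// gt_eqF.
    have E2 : \sum_(0 <= n < N) two (s * n%:R) * (phi n k / two (s * n%:R)) `^ q =
        \sum_(0 <= n < N) two (- (t * (r - q) / 2 * n%:R)) * phi n k `^ q.
      apply: eq_bigr => n _.
      rewrite powRM ?invr_ge0 ?powR_ge0// mulrCA mulrC; congr (_ * _).
      rewrite -(powR_inv1 (powR_ge0 _ _)) !twoM -twoD; congr (_ `^ _).
      rewrite /s; field; by rewrite (gt_eqF r1) (gt_eqF qm1).
    rewrite E1 E2; apply => // n _.
    by rewrite divr_ge0// powR_ge0.
  have Wc : W `^ (q - 1) <= c `^ (q - 1) * two (t * (r - q) / 2 * i%:R).
    apply: le_trans (ler_powR2r (ltW qm1) (ltW W0) (geometric_le Ni)) _.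
    rewrite powRM ?powR_ge0 ?(ltW c0)// twoM.
    have -> : s * i%:R * (q - 1) = t * (r - q) / 2 * i%:R; last by [].
    rewrite /s; field; by rewrite (gt_eqF r1) (gt_eqF qm1).
  have xr : x k `^ r = x k `^ (r - q) * x k `^ q.
    by rewrite -powRD ?(gt_eqF xk0) ?implybT ?subrK.
  have xrq : x k `^ (r - q) <= 10 `^ (r - q) * two (- (t * (r - q) * i%:R)).
    apply: le_trans (ler_powR2r (ltW rq) (x0 k) xi) _.
    rewrite powRM ?powR_ge0// twoM.
    by have -> : - t * i%:R * (r - q) = - (t * (r - q) * i%:R) by ring.
  have S0 : 0 <= \sum_(0 <= n < N) phi n k by apply: sumr_ge0.
  have xq : x k `^ q <= 2 `^ q * (c `^ (q - 1) * two (t * (r - q) / 2 * i%:R) *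
      \sum_(0 <= n < N) two (- (t * (r - q) / 2 * n%:R)) * phi n k `^ q).
    apply: le_trans (ler_powR2r (ltW q0) (x0 k) half) _.
    rewrite powRM// ler_wpM2l ?powR_ge0//; apply: le_trans J1 _.
    rewrite ler_wpM2r//; apply: sumr_ge0 => n _.
    by rewrite mulr_ge0// powR_ge0.
  rewrite xr; apply: le_trans (ler_pM (powR_ge0 _ _) (powR_ge0 _ _) xrq xq) _.
  set Sg := \sum_(0 <= n < N) _.
  have -> : 10 `^ (r - q) * two (- (t * (r - q) * i%:R)) *
      (2 `^ q * (c `^ (q - 1) * two (t * (r - q) / 2 * i%:R) * Sg)) =
      Kc * (two (- (t * (r - q) / 2 * i%:R)) * Sg).
    have -> : two (- (t * (r - q) / 2 * i%:R)) =
       two (- (t * (r - q) * i%:R)) * two (t * (r - q) / 2 * i%:R).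
      by rewrite -twoD; congr (_ `^ _); field; rewrite (gt_eqF r1).
    by rewrite /Kc; ring.
  rewrite ler_pM2l//.
  apply: le_trans (_ : \sum_(0 <= n < N) two (- (t * (r - q) * n%:R)) * phi n k `^ q <= _).
    rewrite /Sg mulr_sumr big_nat [leRHS]big_nat; apply: ler_sum => n /andP[_ nN].
    rewrite mulrA ler_wpM2r ?powR_ge0// -twoD; apply: two_le.
    have : (n%:R : R) <= i%:R by rewrite ler_nat -ltnS (leq_trans nN).
    have : 0 < t * (r - q) by rewrite mulr_gt0.
    by nra.
  rewrite [leRHS](big_cat_nat (leq0n N) (geq_minr i.+1 M))/= lerDl.
  by apply: sumr_ge0 => n _; rewrite mulr_ge0// powR_ge0.
apply: (@le_trans _ _ (\sum_(k < p)
    Kc * \sum_(0 <= n < M) two (- (t * (r - q) * n%:R)) * phi n k `^ q)).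
  by apply: ler_sum => k _; exact: point.
rewrite -mulr_sumr ler_pM2l// exchange_big /=.
apply: (@le_trans _ _ (\sum_(0 <= n < M)
    (C0 * 5 `^ (q - 2)) * (two ((1 + t) * n%:R) * mu n))); last first.
  by rewrite -mulr_sumr ler_wpM2l// mulr_ge0 ?powR_ge0// ltW.
rewrite big_nat [leRHS]big_nat; apply: ler_sum => n /andP[_ nM].
rewrite -mulr_sumr; apply: le_trans (ler_wpM2l (powR_ge0 _ _) (phi_q n)) _.
rewrite two2 twoM.
have mu_n : mu n <= 5 * two (- ((1 + t) * n%:R)).
  have : two ((1 + t) * n%:R) * mu n <= 5.
    apply: le_trans mu5; rewrite (bigD1_seq n) ?mem_index_iota ?iota_uniq//=.
    by rewrite lerDl sumr_ge0// => i _; rewrite mulr_ge0// powR_ge0.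
  have -> : two (- ((1 + t) * n%:R)) = (two ((1 + t) * n%:R))^-1.
    by rewrite -(powR_inv1 (powR_ge0 _ _)) twoM mulrN1.
  by rewrite ler_pdivlMr// mulrC.
(* One factor mu n is kept for the final sum over n; the remaining power q - 2 is bounded by
   [mu_n]. *)
have mu_q : mu n `^ (q - 1) <= mu n * (5 `^ (q - 2) * two (- ((1 + t) * n%:R * (q - 2)))).
  have -> : mu n `^ (q - 1) = mu n * mu n `^ (q - 2).
    have [->|mn] := eqVneq (mu n) 0; first by rewrite mul0r powR0// gt_eqF.
    rewrite -{2}(powRr1 (mu0 n)) -powRD; last by rewrite mn implybT.
    by congr (_ `^ _); ring.
  rewrite ler_wpM2l//.
  have q20 : 0 <= q - 2 by rewrite subr_ge0.
  apply: le_trans (ler_powR2r q20 (mu0 n) mu_n) _.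
  by rewrite powRM ?powR_ge0// twoM mulNr.
apply: le_trans (ler_wpM2l (powR_ge0 _ _) (ler_wpM2l _ mu_q)) _.
  by rewrite mulr_ge0 ?powR_ge0// ltW.
rewrite le_eqVlt; apply/orP; left; apply/eqP.
have -> : two ((1 + t) * n%:R) = two (- (t * (r - q) * n%:R)) * two (n%:R * q) *
    two (- ((1 + t) * n%:R * (q - 2))).
  by rewrite -!twoD; congr (_ `^ _); field; rewrite (gt_eqF r1).
ring.
Qed.

End marcinkiewicz.

(** * Fourier cotype on the circle *)

Section circle_translation.
Context {R : realType}.
Local Notation mR := (measurableTypeR R).
Local Notation mu := (@lebesgue_measure R).
Local Notation e := (@circle_point R).

Lemma ge0_integral_translate_itv (a b c : R) (g : mR -> \bar R) :
  measurable_fun setT g -> (forall x, 0 <= g x)%E ->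
  (\int[mu]_(x in `[a, b[) g (x + c)%R = \int[mu]_(x in `[(a + c)%R, (b + c)%R[) g x)%E.
Proof.
move=> mg g0.
rewrite integral_mkcond [RHS]integral_mkcond.
rewrite -[RHS](ge0_integral_translate c).
- apply: eq_integral => x _; rewrite !patchE !mem_setE !in_itv/=.
  by rewrite lerD2r ltrD2r.
- by apply/(measurable_restrictT g (measurable_itv _)); exact: measurable_funTS.
- by move=> x; rewrite patchE; case: ifP.
Qed.

Lemma integral_circle_prob (g : mR -> \bar R) :
  measurable_fun setT g -> (forall x, 0 <= g x)%E ->
  (\int[circle_prob]_x g x = \int[mu]_(x in `[0%R, 1%R[) g x)%E.
Proof.
move=> mg g0; rewrite [LHS]integral_uniform// subr0 invr1 mul1e.
by rewrite -integral_itv_bndo_bndc//; exact: measurable_funTS.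
Qed.

Lemma integral_circle_translate (s : R) (g : mR -> \bar R) :
  measurable_fun setT g -> (forall x, 0 <= g x)%E ->
  (forall x, g (x + 1)%R = g x) ->
  (\int[circle_prob]_x g (x + s)%R = \int[circle_prob]_x g x)%E.
Proof.
move=> mg g0 g1.
(* By periodicity the shift is replaced by its fractional part. *)
wlog /andP[s0 s1] : s / 0 <= s < 1.
  move=> H; pose f := s - (Num.floor s)%:~R.
  have f01 : 0 <= f < 1.
    have := floor_itv s; rewrite intrD /f => /andP[h1 h2].
    by apply/andP; split; lra.
  rewrite -(H f f01); apply: eq_integral => x _.
  have gn (n : nat) y : g (y + n%:R)%R = g y.
    elim: n y => [|n IH] y; first by rewrite addr0.
    by rewrite -natr1 addrA g1 IH.
  rewrite /f addrA; case: (Num.floor s) => n.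
    by rewrite -[RHS](gn n) /= -pmulrn subrK.
  by rewrite NegzE mulrNz opprK -pmulrn gn.
have mgs : measurable_fun setT (fun x : mR => g (x + s)).
  exact: measurableT_comp mg (measurable_addr s).
rewrite !integral_circle_prob// ge0_integral_translate_itv// add0r.
have mD (D : set mR) : measurable_fun D g by exact: measurable_funTS.
have split3 (a b c : R) : a <= b -> b <= c ->
    (\int[mu]_(x in `[a, c[) g x =
     \int[mu]_(x in `[a, b[) g x + \int[mu]_(x in `[b, c[) g x)%E.
  move=> ab bc; rewrite -ge0_integral_setU//=; last first.
    apply/disj_setPS => x [/=]; rewrite !in_itv/= => /andP[_ xb] /andP[bx _].
    by have := lt_le_trans xb bx; rewrite ltxx.
  congr (integral mu _ g); apply/seteqP; split => x /=; rewrite !in_itv/=.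
    by case/andP => ax xc; have [xb|bx] := ltP x b; [left; rewrite ax|right].
  by case=> /andP[h1 h2]; rewrite ?h1 ?h2 ?andbT/=; [exact: lt_le_trans bc|exact: le_trans h1].
(* The interval [s, 1 + s[ is cut at 1, and its right part is brought back to [0, s[ by
   periodicity. *)
rewrite (split3 s 1)//; [|by rewrite ltW|by rewrite lerDl].
rewrite (split3 0 s)//; last by rewrite ltW.
have -> : (\int[mu]_(x in `[1%R, (1 + s)%R[) g x = \int[mu]_(x in `[0%R, s[) g (x + 1)%R)%E.
  by rewrite ge0_integral_translate_itv// add0r [(s + 1)%R]addrC.
by rewrite addeC; congr (_ + _)%E; apply: eq_integral => x _; rewrite g1.
Qed.

Lemma circle_point_neq1 (s : R) : 0 < s < 1 -> e s != 1.
Proof.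
move=> /andP[s0 s1]; apply/eqP => /(congr1 (@complex.Re R)) /=.
have -> : 2 * pi * s = pi * s + pi * s by ring.
have sp : 0 < sin (pi * s).
  apply: sin_gt0_pi; have p0 := pi_gt0 R.
  by rewrite mulr_gt0//= gtr_pMr.
rewrite cosD; have := cos2Dsin2 (pi * s); nra.
Qed.

Lemma sum_roots_of_unity (p c : nat) : (0 < p)%N -> ~~ (p %| c)%N ->
  \sum_(0 <= j < p) e ((j * c)%:R / p%:R) = 0.
Proof.
move=> p0 pc; have pr : 0 < p%:R :> R by rewrite ltr0n.
pose z := e (c%:R / p%:R).
have zE j : e ((j * c)%:R / p%:R) = z ^+ j.
  by rewrite /z -circle_pointMn natrM -mulrA mulr_natl.
under eq_bigr do rewrite zE.
have z1 : z != 1.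
  rewrite /z {1}(divn_eq c p) natrD natrM mulrDl mulfK ?(gt_eqF pr)//.
  rewrite circle_pointD circle_point_nat mul1r; apply: circle_point_neq1.
  apply/andP; split; first by rewrite divr_gt0// ltr0n lt0n.
  by rewrite ltr_pdivrMr// mul1r ltr_nat ltn_pmod.
have : (z - 1) * \sum_(0 <= j < p) z ^+ j = 0.
  by rewrite big_mkord -subrX1 -zE mulnC natrM mulfK ?(gt_eqF pr)// circle_point_nat subrr.
by move/eqP; rewrite mulf_eq0 subr_eq0 (negbTE z1) => /eqP.
Qed.

End circle_translation.

(** * The Fourier cotype inequality on Z/p *)

Section fourier_cyclic.
Context {R : realType} (X : completeNormedModType R[i]).
Variables (q r : R).
Hypotheses (q2 : 2 <= q) (qr : q < r).
Local Notation t := ((r - 1)^-1).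

Let r1 : 0 < r - 1. Proof. by move: q2 qr; lra. Qed.
Let t0 : 0 < t. Proof. by rewrite invr_gt0. Qed.

Let t1 : t <= 1.
Proof. by rewrite invf_le1//; move: q2 qr; lra. Qed.

(** A dyadic level: 0 for x < 1, and otherwise the n such that 2^(n-1) <= x < 2^n. Grouping all
    small values in level 0 keeps the number of levels finite. *)
Definition level (x : R) : nat :=
  if Num.truncn x is m.+1 then (trunc_log 2 m.+1).+1 else 0.

Lemma level_lt (x : R) : 0 <= x -> x < 2 ^+ level x.
Proof.
move=> x0; have /andP[_] := truncn_itv x0; rewrite /level.
case: (Num.truncn x) => [//|m] /lt_le_trans; apply.
rewrite -natrX ler_nat.
by have /andP[] := trunc_log_bounds (isT : (1 < 2)%N) (isT : (0 < m.+1)%N).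
Qed.

Lemma level_le (x : R) : 0 <= x -> 2 ^+ level x <= 1 + 2 * x.
Proof.
move=> x0; have /andP[+ _] := truncn_itv x0; rewrite /level.
case: (Num.truncn x) => [_|m mx]; first by rewrite expr0 lerDl mulr_ge0.
rewrite exprS; apply: le_trans (_ : 2 * x <= _); last by rewrite lerDr.
rewrite ler_pM2l//; apply: le_trans mx; rewrite -natrX ler_nat.
by have /andP[] := trunc_log_bounds (isT : (1 < 2)%N) (isT : (0 < m.+1)%N).
Qed.

(** The term 1 pays for level 0, and 4 bounds 2^(1+t), as t <= 1. *)
Lemma level_powR (x : R) : 0 <= x ->
  2 `^ ((1 + t) * (level x)%:R) <= 1 + 4 * x `^ (1 + t).
Proof.
move=> x0; have := level_lt x0; have := level_le x0.
case E : (level x) => [|m].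
  by move=> _ _; rewrite mulr0 powRr0 lerDl mulr_ge0// powR_ge0.
have x1 : 2 ^+ m.+1 <= 2 * x.
  move: E; rewrite /level; have /andP[+ _] := truncn_itv x0.
  case: (Num.truncn x) => // k kx [<-].
  rewrite exprS ler_pM2l//; apply: le_trans kx; rewrite -natrX ler_nat.
  by have /andP[] := trunc_log_bounds (isT : (1 < 2)%N) (isT : (0 < k.+1)%N).
move=> _ _; rewrite mulrC powRrM powR_mulrn//.
have t10 : 0 <= 1 + t by rewrite addr_ge0// ltW.
apply: le_trans (ler_powR2r t10 (exprn_ge0 _ _) x1) _ => //.
rewrite powRM//; apply: le_trans (_ : 4 * x `^ (1 + t) <= _); last by rewrite lerDr.
rewrite ler_wpM2r ?powR_ge0//.
apply: le_trans (ler_powR _ (_ : 1 + t <= 2)) _; [lra|by move: t1; lra|].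
by rewrite powR_mulrn//; lra.
Qed.

Lemma dft_sum (I : Type) (s : seq I) n (f : I -> nat -> X) k :
  dft n (fun j => \sum_(i <- s) f i j) k = \sum_(i <- s) dft n (f i) k.
Proof.
rewrite /dft exchange_big /=; apply: eq_bigr => j _.
by rewrite scaler_sumr.
Qed.

Lemma eq_dft n (f g : nat -> X) k :
  (forall j, (j < n)%N -> f j = g j) -> dft n f k = dft n g k.
Proof.
move=> fg; rewrite /dft big_nat [RHS]big_nat; apply: eq_bigr => j /andP[_ jn].
by rewrite fg.
Qed.

Lemma dftZ n (f : nat -> X) (c : R[i]) k :
  dft n (fun j => c *: f j) k = c *: dft n f k.
Proof.
rewrite /dft scaler_sumr; apply: eq_bigr => j _.
by rewrite !scalerA mulrC.
Qed.

Lemma rnorm_dft_le n (f : nat -> X) k :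
  rnorm (dft n f k) <= \sum_(j < n) rnorm (f j).
Proof.
rewrite /dft big_mkord; apply: le_trans (rnorm_sum _ _ _) _.
by apply: ler_sum => j _; rewrite rnormZ1// norm_circle_point.
Qed.

Hypothesis restr : exists2 C : R, 0 < C &
  forall (p : nat) (A : pred nat) (f : nat -> X), prime p ->
    (forall j, (j < p)%N -> rnorm (f j) <= (A j)%:R) ->
    \sum_(k < p) rnorm (dft p f k) `^ q <=
    C * p%:R * ((\sum_(j < p) A j)%N%:R) `^ (q - 1).

(** Up to the factor 2^n, the piece of f on its n-th level set is dominated by an indicator. The
    hypothesis [restr] controls the q-norm of its transform and the triangle inequality the sup
    norm: these are the two ends of the interpolation. *)
Lemma fourier_cyclic_normalized : exists2 C : R, 0 < C &
  forall (p : nat) (f : nat -> X), prime p ->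
    (\sum_(j < p) rnorm (f j) `^ (1 + t)) / p%:R <= 1 ->
    \sum_(k < p) (rnorm (dft p f k) / p%:R) `^ r <= C.
Proof.
have [C0 C00 HC] := restr.
(* The constant is the one produced by [marcinkiewicz_sum]; its positivity is checked at the end. *)
eexists; last first.
  move=> p f pp f1; have p0 : 0 < p%:R :> R by rewrite ltr0n prime_gt0.
  pose lev j := level (rnorm (f j)).
  pose fn n j := if lev j == n then f j else 0.
  pose M := (\max_(j < p) lev j).+1.
  pose mu n : R := (\sum_(j < p) (lev j == n))%N%:R / p%:R.
  have fn_le n j : rnorm (fn n j) <= 2 ^+ n * (lev j == n)%:R.
    rewrite /fn; case: eqP => [<-|_]; last by rewrite rnorm0 mulr0.
    by rewrite mulr1 ltW// level_lt// rnorm_ge0.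
  apply: (@marcinkiewicz_sum R q r C0 q2 qr C00 p M
    (fun n k => rnorm (dft p (fn n) k) / p%:R) mu (fun k => rnorm (dft p f k) / p%:R)).
  - by move=> n k; rewrite divr_ge0 ?rnorm_ge0// ltW.
  - by move=> n; rewrite divr_ge0// ltW.
  - by move=> k; rewrite divr_ge0 ?rnorm_ge0// ltW.
  - move=> k kp; rewrite -mulr_suml ler_wpM2r ?invr_ge0 ?(ltW p0)//.
    rewrite (eq_dft (g := fun j => \sum_(n <- index_iota 0 M) fn n j)).
      by rewrite dft_sum; exact: rnorm_sum.
    move=> j jp; have lM : (lev j < M)%N.
      by rewrite ltnS; exact: (leq_bigmax (Ordinal jp)).
    rewrite (bigD1_seq (lev j)) ?mem_index_iota ?iota_uniq//= /fn eqxx.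
    by rewrite big1 ?addr0// => n; rewrite eq_sym => /negbTE ->.
  - move=> n k _; rewrite /mu mulrA ler_wpM2r ?invr_ge0 ?(ltW p0)//.
    apply: le_trans (rnorm_dft_le _ _ _) _; rewrite natr_sum mulr_sumr.
    by apply: ler_sum => j _; exact: fn_le.
  - move=> n; have two0 : 0 < 2 ^+ n :> R by rewrite exprn_gt0.
    pose m := (\sum_(j < p) (lev j == n))%N.
    have H : \sum_(k < p) rnorm (dft p (fun j => ((2 ^+ n)^-1)%:C%C *: fn n j) k) `^ q <=
        C0 * p%:R * m%:R `^ (q - 1).
      apply: (HC p (fun j => lev j == n) _ pp) => j _; rewrite rnormZr ger0_norm ?invr_ge0 ?(ltW two0)//.
      by rewrite ler_pdivrMl//; exact: fn_le.
    have -> : \sum_(k < p) (rnorm (dft p (fn n) k) / p%:R) `^ q =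
      (2 ^+ n) `^ q / p%:R `^ q * \sum_(k < p)
        rnorm (dft p (fun j => ((2 ^+ n)^-1)%:C%C *: fn n j) k) `^ q.
      rewrite mulr_sumr; apply: eq_bigr => k _.
      rewrite dftZ rnormZr ger0_norm ?invr_ge0 ?(ltW two0)//.
      rewrite powRM ?rnorm_ge0 ?invr_ge0 ?(ltW p0)//.
      rewrite [in RHS]powRM ?rnorm_ge0 ?invr_ge0 ?(ltW two0)//.
      rewrite !powR_invr ?(ltW p0) ?(ltW two0)//.
      by field; rewrite !gt_eqF// powR_gt0.
    apply: le_trans (ler_wpM2l _ H) _.
      by rewrite divr_ge0// powR_ge0.
    rewrite /mu powRM// ?invr_ge0 ?(ltW p0)// powR_invr ?(ltW p0)//.
    rewrite -/m le_eqVlt; apply/orP; left; apply/eqP.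
    have -> : p%:R `^ q = p%:R `^ (q - 1) * p%:R :> R.
      rewrite -{1}(subrK 1 q) (@powRD _ p%:R (q - 1) 1) ?powRr1 ?(ltW p0)//.
      by rewrite (gt_eqF p0) implybT.
    by field; rewrite (gt_eqF p0) gt_eqF// powR_gt0.
  (* The 5 required by the interpolation is 1 + 4, from [level_powR] and the normalization of f. *)
  - rewrite (_ : \sum_(0 <= n < M) _ = (\sum_(j < p) 2 `^ ((1 + t) * (lev j)%:R)) / p%:R).
      rewrite ler_pdivrMr//.
      apply: le_trans (_ : \sum_(j < p) (1 + 4 * rnorm (f j) `^ (1 + t)) <= _).
        by apply: ler_sum => j _; exact/level_powR/rnorm_ge0.
      rewrite big_split /= -mulr_sumr sumr_const card_ord.
      by move: f1; rewrite ler_pdivrMr// => f1; lra.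
    under eq_bigr do rewrite /mu mulrA.
    rewrite -mulr_suml; congr (_ / _).
    under eq_bigr do rewrite natr_sum mulr_sumr.
    rewrite exchange_big /=; apply: eq_bigr => j _.
    have lM : (lev j < M)%N by rewrite ltnS; exact: (leq_bigmax j).
    rewrite (bigD1_seq (lev j)) ?mem_index_iota ?iota_uniq//= eqxx mulr1.
    by rewrite big1 ?addr0// => n; rewrite eq_sym => /negbTE ->; rewrite mulr0.
rewrite !mulr_gt0 ?powR_gt0//; try lra.
rewrite divr_gt0 ?powR_gt0// subr_gt0.
have -> : (2 : R) `^ (t * (r - q) / (2 * (q - 1))) =
   expR (t * (r - q) / (2 * (q - 1)) * ln 2) by rewrite /powR pnatr_eq0.
rewrite expR_gt1 mulr_gt0// ?ln_gt0//; last lra.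
by rewrite divr_gt0// mulr_gt0//; move: q2 qr; lra.
Qed.

(** Homogeneity: f is divided by its normalized norm of exponent 1 + t, and r / (1 + t) = r - 1. *)
Lemma fourier_cyclic : exists2 C : R, 0 < C &
  forall (p : nat) (f : nat -> X), prime p ->
    \sum_(k < p) (rnorm (dft p f k) / p%:R) `^ r <=
    C * ((\sum_(j < p) rnorm (f j) `^ (1 + t)) / p%:R) `^ (r - 1).
Proof.
have [C C0 H] := fourier_cyclic_normalized; exists C => // p f pp.
have p0 : 0 < p%:R :> R by rewrite ltr0n prime_gt0.
have t10 : 0 < 1 + t by rewrite addr_gt0.
set S := _ / p%:R.
have S0 : 0 <= S.
  by rewrite divr_ge0 ?(ltW p0)//; apply: sumr_ge0 => j _; exact: powR_ge0.
have rr0 : r != 0 by rewrite gt_eqF//; move: r1; lra.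
move: S0; rewrite le_eqVlt => /orP[/eqP SE|S0].
  rewrite -SE big1 ?mulr_ge0 ?powR_ge0 ?(ltW C0)// => k _.
  rewrite (eq_dft (g := fun=> 0)).
    by rewrite /dft big1 ?rnorm0 ?mul0r ?powR0// => j _; rewrite scaler0.
  move=> j jp; apply/eqP; rewrite -rnorm_eq0; apply/eqP.
  have := esym SE; rewrite /S => /eqP; rewrite mulf_eq0 invr_eq0 (gt_eqF p0) orbF.
  rewrite psumr_eq0 => [/allP/(_ (Ordinal jp))|i _]; last exact: powR_ge0.
  by rewrite mem_index_enum => /(_ isT) /= /eqP/powR_eq0_eq0.
pose sg := S `^ (1 + t)^-1.
have sg0 : 0 < sg by rewrite powR_gt0.
have := H p (fun j => (sg^-1)%:C%C *: f j) pp.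
have scale x : rnorm ((sg^-1)%:C%C *: x : X) = rnorm x / sg.
  by rewrite rnormZr ger0_norm ?invr_ge0 ?(ltW sg0)// mulrC.
have E1 : (\sum_(j < p) rnorm ((sg^-1)%:C%C *: f j) `^ (1 + t)) / p%:R = 1.
  under eq_bigr do rewrite scale powRM ?rnorm_ge0 ?invr_ge0 ?(ltW sg0)//
    powR_invr ?(ltW sg0)//.
  rewrite -mulr_suml mulrAC -/S /sg powRrVK ?(ltW S0) ?gt_eqF//.
  by rewrite divff// gt_eqF.
rewrite E1 => /(_ (lexx _)).
have -> : \sum_(k < p) (rnorm (dft p (fun j => (sg^-1)%:C%C *: f j) k) / p%:R) `^ r =
   (\sum_(k < p) (rnorm (dft p f k) / p%:R) `^ r) / sg `^ r.
  rewrite mulr_suml; apply: eq_bigr => k _; rewrite dftZ scale mulrAC.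
  have D0 : 0 <= rnorm (dft p f k) / p%:R by rewrite divr_ge0 ?rnorm_ge0 ?(ltW p0).
  have s0 : 0 <= sg^-1 by rewrite invr_ge0 ltW.
  by rewrite (powRM _ D0 s0) powR_invr ?(ltW sg0).
rewrite ler_pdivrMr ?powR_gt0//.
suff -> : sg `^ r = S `^ (r - 1) by [].
rewrite /sg -powRrM; congr (_ `^ _).
have r0' : r - 1 + 1 != 0 by rewrite subrK.
by field; rewrite (gt_eqF r1) subrK.
Qed.

End fourier_cyclic.

Section fourier_cotype.
Context {R : realType} (X : completeNormedModType R[i]).
Local Notation e := (@circle_point R).
Local Notation mR := (measurableTypeR R).
Local Notation P := (@circle_prob R).

Definition trig_poly N (x : 'I_N -> X) (t : R) : X :=
  \sum_(k < N) e t ^+ k.+1 *: x k.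

Lemma curve_trig_poly N (x : 'I_N -> X) :
  curve (trig_poly x : mR -> X).
Proof.
apply: curve_sum => k; apply: curveZ.
exact: cmeasurable_exp cmeasurable_circle_point.
Qed.

Lemma trig_poly_periodic N (x : 'I_N -> X) t : trig_poly x (t + 1) = trig_poly x t.
Proof. by apply: eq_bigr => k _; rewrite circle_pointD circle_point1 mulr1. Qed.

Lemma rnorm_trig_poly N (x : 'I_N -> X) t :
  rnorm (trig_poly x t) <= \sum_(k < N) rnorm (x k).
Proof.
apply: le_trans (rnorm_sum _ _ _) _; apply: ler_sum => k _.
by rewrite rnormZ1// normrX norm_circle_point expr1n.
Qed.

(** Orthogonality of the characters of Z/p: evaluation at the opposite of k + 1 isolates this
    frequency, since 1, ..., N are distinct modulo p. *)
Lemma dft_trig_poly N (x : 'I_N -> X) p (tau : R) (k : 'I_N) : (N < p)%N ->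
  dft p (fun j => trig_poly x (tau + j%:R / p%:R)) (p - k.+1) =
  p%:R *: (e tau ^+ k.+1 *: x k).
Proof.
move=> Np; have kp : (k < p)%N := ltn_trans (ltn_ord k) Np.
have p0 : (0 < p)%N by exact: leq_ltn_trans kp.
have pr : p%:R != 0 :> R by rewrite pnatr_eq0 -lt0n.
rewrite /dft /trig_poly; under eq_bigr do rewrite scaler_sumr.
rewrite exchange_big /=.
have E (k' : 'I_N) : \sum_(0 <= j < p) e ((j * (p - k.+1))%:R / p%:R) *:
    (e (tau + j%:R / p%:R) ^+ k'.+1 *: x k') =
    (\sum_(0 <= j < p) e ((j * (p - k.+1 + k'.+1))%:R / p%:R)) *: (e tau ^+ k'.+1 *: x k').
  rewrite scaler_suml; apply: eq_bigr => j _.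
  rewrite [LHS]scalerA [RHS]scalerA -!circle_pointMn -!circle_pointD; congr (e _ *: _).
  rewrite mulnDr natrD mulrDl mulrnDl -addrA; congr (_ + _); rewrite addrC.
  by congr (_ + _); rewrite natrM mulrAC mulr_natr.
rewrite (eq_bigr _ (fun k' _ => E k')) (bigD1 k)//= [X in _ + X]big1 ?addr0 => [|k' k'k].
  congr (_ *: _); rewrite subnK//.
  rewrite (eq_bigr (fun=> 1)) ?big_const_nat ?subn0 ?iter_addr_0// => j _.
  by rewrite natrM mulfK// circle_point_nat.
rewrite sum_roots_of_unity ?scale0r//.
have k'p : (k' < p)%N := ltn_trans (ltn_ord k') Np.
have kk : (k' != k :> nat) by [].
apply/negP => /dvdnP[d]; move: kk k'p kp; clear.
case: d => [|[|d]]; first by lia.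
  by lia.
by rewrite !mulSn; lia.
Qed.

(* The coefficients are recovered from the values at tau + j/p for j < p, where p
   is a prime greater than N, and the inequality obtained is averaged over tau. *)
Lemma fourier_cotype_of_cotype (q r : R) : 2 <= q -> q < r ->
  has_type2 X -> has_cotype X q -> has_fourier_cotype X r.
Proof.
move=> q2 qr hT hC.
have [D D0 HD] := dft_estimate q2 hT hC.
have [C C0 HC] := fourier_cyclic q2 qr (restricted_type q2 D0 HD).
have r1 : 0 < r - 1 by lra.
have r0 : 0 < r by lra.
pose t := (r - 1)^-1; have t0 : 0 < t by rewrite invr_gt0.
have conjE : conj_exponent r = 1 + t.
  have rn : r != 0 by rewrite gt_eqF.
  have -> : conj_exponent r = ((r - 1) / r)^-1 by rewrite /conj_exponent; congr (_^-1); field.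
  by rewrite /t; field; rewrite rn (gt_eqF r1).
have conjV : (conj_exponent r)^-1 = (r - 1) * r^-1.
  by rewrite /conj_exponent invrK mulrBl divff ?gt_eqF// mul1r.
exists (C `^ r^-1); first by rewrite powR_gt0.
move=> N x; rewrite conjV.
pose G (s : mR) : R := rnorm (trig_poly x s) `^ (1 + t).
have G0 s : 0 <= G s by exact: powR_ge0.
have mG : measurable_fun setT (fun s : mR => (G s)%:E).
  by have [_ H] := curve_measurable_powR X (1 + t); apply: H; exact: curve_trig_poly.
set I := (\int[P]_s (G s)%:E)%E.
have Ifin : I \is a fin_num.
  rewrite ge0_fin_numE; last by apply: integral_ge0 => s _; rewrite lee_fin.
  apply: (@le_lt_trans _ _ (\int[P]_s ((\sum_(k < N) rnorm (x k)) `^ (1 + t))%:E)%E).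
    apply: ge0_le_integral => //.
    - by move=> s _; rewrite lee_fin.
    - move=> s _; rewrite lee_fin; apply: ler_powR2r.
      + by rewrite addr_ge0// ltW.
      + exact: rnorm_ge0.
      + exact: rnorm_trig_poly.
  rewrite (integral_cst P measurableT) [X in (_ * X)%E](_ : _ = 1%E) ?mule1 ?ltry//.
  exact: (probability_setT P).
rewrite [X in _ * X `^ _](_ : _ = fine I); last first.
  by rewrite /I /Rintegral; congr fine; apply: eq_integral => s _; rewrite conjE.
have [p Np pp] := prime_above N.
have p0 : 0 < p%:R :> R by rewrite ltr0n prime_gt0.
set Y := \sum_(k < N) rnorm (x k) `^ r.
have Y0 : 0 <= Y by apply: sumr_ge0 => k _; exact: powR_ge0.
pose S tau := (\sum_(j < p) G (tau + j%:R / p%:R)) / p%:R.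
have S0 tau : 0 <= S tau.
  by rewrite divr_ge0 ?(ltW p0)//; apply: sumr_ge0 => j _.
have YS tau : Y <= C * S tau `^ (r - 1).
  apply: le_trans (HC p (fun j => trig_poly x (tau + j%:R / p%:R)) pp).
  (* Reversal moves the frequency p - (k + 1), where the k-th coefficient is read, to index k; the
     terms of index at least N are then dropped. *)
  rewrite (reindex_inj rev_ord_inj) /=.
  rewrite -(big_mkord xpredT (fun l => (rnorm (dft p
    (fun j => trig_poly x (tau + j%:R / p%:R)) (p - l.+1)) / p%:R) `^ r)).
  rewrite (big_cat_nat (leq0n N) (ltnW Np))/= -[leLHS]addr0; apply: lerD; last first.
    by apply: sumr_ge0 => l _; exact: powR_ge0.
  rewrite big_mkord le_eqVlt; apply/orP; left; apply/eqP; apply: eq_bigr => k _.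
  rewrite dft_trig_poly//; congr (_ `^ _).
  rewrite rnormZ normr_nat -(rmorph_nat (real_complex R)) /=.
  by rewrite rnormZ1 ?normrX ?norm_circle_point ?expr1n// mulrC mulKf// gt_eqF.
(* Taking the power t = 1/(r-1) makes the bound linear in [S tau], whose mean over tau is I by
   translation invariance. *)
pose y := (Y / C) `^ t.
have yS tau : y <= S tau.
  have : Y / C <= S tau `^ (r - 1) by rewrite ler_pdivrMr// mulrC.
  move=> /(ler_powR2r (ltW t0) (divr_ge0 Y0 (ltW C0))).
  by rewrite -powRrM mulfV ?gt_eqF// powRr1.
have yI : (y%:E <= I)%E.
  apply: (@le_trans _ _ (\int[P]_s (S s)%:E)%E).
    rewrite [leLHS](_ : _ = (\int[P]_s y%:E)%E); last first.
      rewrite (integral_cst P measurableT) [X in (_ * X)%E](_ : _ = 1%E) ?mule1//.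
      exact: (probability_setT P).
    apply: ge0_le_integral => //.
    - by move=> s _; rewrite lee_fin powR_ge0.
    - apply/measurable_EFinP; apply: measurable_funM => //.
      apply: measurable_sum => j; apply/measurable_EFinP.
      exact: measurableT_comp mG (measurable_addr _).
    - by move=> s _; rewrite lee_fin.
  rewrite le_eqVlt; apply/orP; left; apply/eqP.
  transitivity (\int[P]_s ((p%:R^-1)%:E * \sum_(j < p) (G (s + j%:R / p%:R))%:E))%E.
    by apply: eq_integral => s _; rewrite /S sumEFin -EFinM mulrC.
  have mGj (j : 'I_p) : measurable_fun setT (fun s : mR => (G (s + j%:R / p%:R))%:E).
    exact: measurableT_comp mG (measurable_addr _).
  rewrite ge0_integralZl//.
  - rewrite ge0_integral_sum//; last by move=> j s _; rewrite lee_fin.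
    rewrite (eq_bigr (fun=> I)); last first.
      move=> j _; apply: (integral_circle_translate (j%:R / p%:R) mG).
      + by move=> s; rewrite lee_fin.
      + by move=> s; rewrite /G trig_poly_periodic.
    rewrite -(fineK Ifin) sumEFin sumr_const card_ord -EFinM; congr EFin.
    by rewrite -[fine I *+ p]mulr_natl mulKf// gt_eqF.
  - exact: emeasurable_sum.
  - by move=> s _; apply: sume_ge0 => j _; rewrite lee_fin.
have yf : y <= fine I by rewrite -lee_fin fineK.
have I0 : 0 <= fine I by apply: le_trans yf; exact: powR_ge0.
have YI : Y <= C * fine I `^ (r - 1).
  have := ler_powR2r (ltW r1) (powR_ge0 _ _) yf.
  rewrite /y -powRrM mulVf ?gt_eqF// powRr1; last by rewrite divr_ge0// ltW.
  by rewrite ler_pdivrMr// mulrC.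
have rV0 : 0 <= r^-1 by rewrite invr_ge0 ltW.
apply: le_trans (ler_powR2r rV0 Y0 YI) _.
by rewrite powRM ?powR_ge0 ?(ltW C0)// -powRrM.
Qed.

End fourier_cotype.

(** * Polynomials on the infinite torus *)

Section torus_measures.
Context {R : realType}.
Local Notation mR := (measurableTypeR R).
Local Notation P := (@circle_prob R).

Definition tuple_box n (A : nat -> set mR) : set (n.-tuple mR) :=
  [set t | forall i : 'I_n, A i (tnth t i)].
Arguments tuple_box : clear implicits.

Lemma measurable_tuple_box n (A : nat -> set mR) :
  (forall i, measurable (A i)) -> measurable (tuple_box n A).
Proof.
move=> mA; rewrite (_ : tuple_box n A = \bigcap_(i : 'I_n) (fun t => tnth t i) @^-1` A i).
  apply: fin_bigcap_measurable => [|i _]; first exact: finite_finset.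
  by rewrite -[X in measurable X]setTI; exact: measurable_tnth.
by apply/seteqP; split => t /= h => [i _|i]; exact: h.
Qed.

Lemma torus_prob_box n (A : nat -> set mR) : (forall i, measurable (A i)) ->
  torus_prob n (tuple_box n A) = (\prod_(i < n) P (A i))%E.
Proof.
rewrite /torus_prob; elim: n A => [|n IH] A mA.
  rewrite big_ord0 /= diracE mem_set//; first by move=> [].
have mB : measurable (tuple_box n (fun i => A i.+1)) by exact: measurable_tuple_box.
rewrite big_ord_recl /= -(IH (fun i => A i.+1)) //.
rewrite -(product_measure1E P (power_prob P n) (mA 0%N) mB).
rewrite /distribution /pushforward; congr (_ _).
apply/seteqP; split => -[x t] /=.
  move=> h; split; first exact: (h ord0).
  by move=> i; have := h (lift ord0 i); rewrite tnthS.
move=> [h0 h] i; have [j ->|->] := unliftP ord0 i; last exact: h0.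
by rewrite tnthS; exact: (h j).
Qed.

Definition seq_tuple n (z : nat -> R) : n.-tuple mR := [tuple z i | i < n].

Lemma measurable_seq_tuple n :
  measurable_fun setT (seq_tuple n : sequence_space mR -> n.-tuple mR).
Proof.
apply/measurable_fun_tnthP => i.
move=> _ Y mY; rewrite setTI; apply: sub_sigma_algebra.
exists (i : nat), Y; split => //.
by apply/seteqP; split => z /=; rewrite tnth_mktuple.
Qed.

(** Boxes are stable under intersection and generate the sigma-algebra of tuples, and both measures
    give them the product of the masses of their sides. *)
Lemma torus_oo_seq_tuple n (B : set (n.-tuple mR)) : measurable B ->
  pushforward torus_oo_prob (seq_tuple n : sequence_space mR -> n.-tuple mR) B = torus_prob n B.
Proof.
move=> mB.
pose nu : {measure set (n.-tuple mR) -> \bar R} := pushforward torus_oo_prob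
  (seq_tuple n : sequence_space mR -> n.-tuple mR).
pose G : set (set (n.-tuple mR)) := [set B | exists A : nat -> set mR,
   (forall i, measurable (A i)) /\ B = tuple_box n A].
refine (@measure_unique _ R _ G (fun=> setT) _ _ _ _ (nu (@measurable_seq_tuple n))
  (torus_prob n) _ _ B mB).
- apply/seteqP; split => [C|C].
    apply: smallest_sub; first exact: smallest_sigma_algebra.
    rewrite -bigcup_seq; apply: bigcup_sub => i _ _ [D mD <-].
    apply: sub_sigma_algebra; exists (fun k => if k == i :> nat then D else setT); split.
      by move=> k; case: ifP.
    apply/seteqP; split => t /=.
      by move=> [_ Dt] k; case: eqP => // /val_inj ->.
    by move=> h; split => //; have := h i; rewrite eqxx.
  apply: smallest_sub; first exact: sigma_algebra_measurable.
  by move=> _ [A [mA ->]]; exact: measurable_tuple_box.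
- move=> _ _ [A [mA ->]] [A' [mA' ->]]; exists (fun i => A i `&` A' i); split.
    by move=> i; exact: measurableI.
  apply/seteqP; split => t /=; first by move=> [h h'] i; split; [exact: h|exact: h'].
  by move=> h; split => i; case: (h i).
- move=> _; exists (fun=> setT); split => //.
  by apply/seteqP; split.
- by rewrite bigcup_const//; exists 0%N.
- move=> _ [A [mA ->]]; apply: (eq_trans _ (esym (torus_prob_box n mA))).
  rewrite -torus_oo_probE//.
  rewrite /nu /= /pushforward; congr (_ _); apply/seteqP; split => z /=.
    by move=> h i ni; have := h (Ordinal ni); rewrite tnth_mktuple.
  by move=> h i; rewrite tnth_mktuple; exact: h.
- move=> _; rewrite /nu /= /pushforward preimage_setT.
  by rewrite (probability_setT torus_oo_prob) ltry.
Qed.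

Lemma integral_torus_oo n (f : n.-tuple mR -> \bar R) :
  measurable_fun setT f -> (forall t, 0 <= f t)%E ->
  (\int[torus_oo_prob]_z f (seq_tuple n z) = \int[torus_prob n]_t f t)%E.
Proof.
move=> mf f0; have ms := @measurable_seq_tuple n.
rewrite [RHS](eq_measure_integral (pushforward torus_oo_prob
  (seq_tuple n : sequence_space mR -> n.-tuple mR))); last first.
  by move=> A mA _; apply/esym; exact: torus_oo_seq_tuple.
by rewrite ge0_integral_pushforward.
Qed.

Definition tuple_shift n (th : nat -> R) (t : n.-tuple mR) : n.-tuple mR :=
  [tuple tnth t i + th i | i < n].

Lemma measurable_tuple_shift n th : measurable_fun setT (@tuple_shift n th).
Proof.
apply/measurable_fun_tnthP => i.
rewrite (_ : _ \o _ = fun t : n.-tuple mR => tnth t i + th i).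
  by apply: measurable_funD => //; exact: measurable_tnth.
by apply/funext => t /=; rewrite tnth_mktuple.
Qed.

(** Tuples hold angles, which leave [0, 1] under a shift; the condition says that f depends only on
    the point of the torus. *)
Definition circle_invariant n (f : n.-tuple mR -> \bar R) :=
  forall t u : n.-tuple mR,
    (forall i, circle_point (tnth t i) = circle_point (tnth u i)) -> f t = f u.

Lemma integral_torus_succ n (f : n.+1.-tuple mR -> \bar R) :
  measurable_fun setT f -> (forall t, 0 <= f t)%E ->
  (\int[torus_prob n.+1]_t f t =
   \int[P]_x \int[torus_prob n]_t f (tuple_cons (x, t)))%E.
Proof.
move=> mf f0; rewrite [LHS]ge0_integral_distribution//.
have mg : measurable_fun setT (f \o @tuple_cons _ mR n).
  by apply: measurableT_comp mf _; exact: measurable_cons.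
exact: (@fubini_tonelli1 _ _ _ _ _ P (power_prob P n) (f \o @tuple_cons _ mR n) mg
  (fun p => f0 _)).
Qed.

Lemma integral_torus_translate n (th : nat -> R) (f : n.-tuple mR -> \bar R) :
  measurable_fun setT f -> (forall t, 0 <= f t)%E -> circle_invariant f ->
  (\int[torus_prob n]_t f (tuple_shift th t) = \int[torus_prob n]_t f t)%E.
Proof.
elim: n th f => [|n IH] th f mf f0 fi.
  by apply: eq_integral => t _; congr f; apply/eq_from_tnth => -[].
have mcons : measurable_fun setT (@tuple_cons _ mR n) by exact: measurable_cons.
have mfc : measurable_fun setT (f \o @tuple_cons _ mR n) by exact: measurableT_comp mf mcons.
have consE x (t : n.-tuple mR) :
    tuple_shift th (tuple_cons (x, t)) = tuple_cons (x + th 0%N, tuple_shift (fun i => th i.+1) t).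
  apply/eq_from_tnth => i; rewrite tnth_mktuple.
  have [j ->|->] := unliftP ord0 i; last by rewrite !tnth0.
  by rewrite !tnthS tnth_mktuple.
rewrite integral_torus_succ//; last first.
  exact: measurableT_comp mf (@measurable_tuple_shift _ th).
rewrite [RHS]integral_torus_succ//.
pose g (x : mR) := (\int[torus_prob n]_t f (tuple_cons (x, t)))%E.
transitivity (\int[P]_x g (x + th 0%N)%R)%E.
  apply: eq_integral => x _; under eq_integral do rewrite consE.
  apply: (IH (fun i => th i.+1) (fun t => f (tuple_cons (x + th 0%N, t)))).
  - exact: (measurable_fun_pair2 (x + th 0%N) mfc).
  - by move=> t; exact: f0.
  - move=> t u tu; apply: fi => i.
    have [j ->|->] := unliftP ord0 i; last by rewrite !tnth0.
    by rewrite !tnthS.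
apply: integral_circle_translate.
- exact: (@measurable_fun_fubini_tonelli_F _ _ _ _ _ (torus_prob n) _ mfc (fun p => f0 _)).
- by move=> x; exact: integral_ge0.
- move=> x; apply: eq_integral => t _; apply: fi => i.
  have [j ->|->] := unliftP ord0 i; first by rewrite !tnthS.
  by rewrite !tnth0 circle_pointD circle_point1 mulr1.
Qed.

(** The tangent of x^p at a, given by [powR_bernoulli], is integrated. Since its slope is
    nonnegative, a lower bound a can stand for the mean, which may be infinite. *)
Lemma jensen_integral d (T : measurableType d) (mu : probability T R)
    (f : T -> R) (p a : R) :
  1 <= p -> measurable_fun setT f -> (forall t, 0 <= f t) -> 0 <= a ->
  (a%:E <= \int[mu]_t (f t)%:E)%E ->
  ((a `^ p)%:E <= \int[mu]_t (f t `^ p)%:E)%E.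
Proof.
move=> p1 mf f0 a0 af.
have p0 : 0 < p by lra.
have mfp : measurable_fun setT (fun t => (f t `^ p)%:E).
  by apply/measurable_EFinP; exact: measurableT_comp (measurable_powR p) mf.
move: a0; rewrite le_eqVlt => /orP[/eqP ae|a0].
  by rewrite -ae powR0 ?gt_eqF//; apply: integral_ge0 => t _; rewrite lee_fin powR_ge0.
pose b := a `^ p; have b0 : 0 < b by rewrite powR_gt0.
have c0 : 0 <= p * b / a by rewrite divr_ge0 ?mulr_ge0 ?(ltW a0) ?(ltW p0) ?(ltW b0).
have cstE (c : R) : (\int[mu]_t c%:E)%E = c%:E.
  rewrite (integral_cst mu measurableT) [X in (_ * X)%E](_ : _ = 1%E) ?mule1//.
  exact: (probability_setT mu).
(* The constant term of the tangent is put on the right, so that both integrands are nonnegative. *)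
have : (\int[mu]_t ((p * b / a)%:E * (f t)%:E) <=
        \int[mu]_t ((f t `^ p)%:E + ((p - 1) * b)%:E))%E.
  apply: ge0_le_integral => //.
  - by move=> t _; rewrite -EFinM lee_fin mulr_ge0.
  - by apply: emeasurable_funM => //; exact/measurable_EFinP.
  - exact: emeasurable_funD.
  - move=> t _; rewrite -EFinM -EFinD lee_fin.
    have fa : 0 <= f t / a by rewrite divr_ge0 ?(ltW a0).
    have := powR_bernoulli p1 fa.
    rewrite powRM ?invr_ge0 ?(ltW a0)// powR_invr ?(ltW a0)// -/b ler_pdivlMr//.
    move=> h; have -> : p * b / a * f t = (1 + p * (f t / a - 1)) * b + (p - 1) * b.
      by field; rewrite gt_eqF.
    by rewrite lerD2r.
rewrite ge0_integralZl//; last 2 first.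
- exact/measurable_EFinP.
- by move=> t _; rewrite lee_fin.
rewrite ge0_integralD//; last 2 first.
- by move=> t _; rewrite lee_fin powR_ge0.
- by move=> t _; rewrite lee_fin mulr_ge0// ?(ltW b0)//; lra.
rewrite cstE => h.
have h1 : ((p * b)%:E <= \int[mu]_t (f t `^ p)%:E + ((p - 1) * b)%:E)%E.
  apply: le_trans h; apply: le_trans (_ : ((p * b / a)%:E * a%:E <= _)%E).
    by rewrite -EFinM divfK ?gt_eqF.
  by rewrite lee_wpmul2l// lee_fin.
move: h1; rewrite -leeBlDr// -EFinB.
by have -> : p * b - (p - 1) * b = b by ring.
Qed.

End torus_measures.

(** * Multi-indices and base M expansions *)

Section mindices.

Definition bounded_support n (a : mindex) := all (fun i => i < n)%N (finsupp a).

Lemma big_finsupp (V : Type) (idx : V) (op : Monoid.com_law idx) n (a : mindex)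
    (F : nat -> V) : bounded_support n a -> (forall i, a i = 0%N -> F i = idx) ->
  \big[op/idx]_(i <- finsupp a) F i = \big[op/idx]_(0 <= i < n) F i.
Proof.
move=> /allP an F0.
rewrite [RHS](bigID (fun i => i \in finsupp a))/= [X in op _ X]big1 ?Monoid.mulm1.
  rewrite -[RHS]big_filter; apply: perm_big; apply: uniq_perm.
  - exact: fset_uniq.
  - by rewrite filter_uniq// iota_uniq.
  - move=> i; rewrite mem_filter mem_index_iota /=.
    by case: (boolP (i \in finsupp a)) => // /an ->.
by move=> i; rewrite memNfinsupp => /eqP /F0.
Qed.

Lemma mdegE n (a : mindex) : bounded_support n a ->
  mdeg a = (\sum_(0 <= i < n) a i)%N.
Proof. by move=> an; apply: big_finsupp. Qed.

Lemma monomialE (R : realType) n (a : mindex) (z : nat -> R[i]) : bounded_support n a ->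
  monomial a z = \prod_(0 <= i < n) z i ^+ a i.
Proof. by move=> an; apply: big_finsupp => // i ->; rewrite expr0. Qed.

Lemma mindex_inj n (a b : mindex) : bounded_support n a -> bounded_support n b ->
  (forall i, (i < n)%N -> a i = b i) -> a = b.
Proof.
move=> /allP an /allP bn ab; apply/fsfunP => i.
have [/ab //|ni] := ltnP i n.
have out (c : mindex) : {in finsupp c, forall i, (i < n)%N} -> c i = 0%N.
  move=> cn; apply/eqP; rewrite -memNfinsupp; apply/negP => /cn.
  by rewrite ltnNge ni.
by rewrite !out.
Qed.

Lemma digits_inj n M (a b : nat -> nat) : (forall i, a i < M)%N -> (forall i, b i < M)%N ->
  (\sum_(0 <= i < n) a i * M ^ i = \sum_(0 <= i < n) b i * M ^ i)%N ->
  forall i, (i < n)%N -> a i = b i.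
Proof.
move=> aM bM.
have M0 : (0 < M)%N by exact: leq_ltn_trans (aM 0%N).
elim: n a b aM bM => // n IH a b aM bM.
have split c : (\sum_(0 <= i < n.+1) c i * M ^ i =
    c 0 + (\sum_(0 <= i < n) c i.+1 * M ^ i) * M)%N.
  rewrite big_nat_recl// expn0 muln1 big_distrl /=; congr addn.
  by apply: eq_bigr => i _; rewrite expnSr mulnA.
rewrite !split => E.
have E0 : a 0%N = b 0%N.
  have := congr1 (modn^~ M) E.
  by rewrite /= ![(_ + _ * M)%N]addnC !modnMDl !modn_small.
move: E; rewrite E0 => /addnI /eqP; rewrite eqn_pmul2r// => /eqP E.
case=> [//|i ni]; exact: (IH (fun i => a i.+1) (fun i => b i.+1)).
Qed.

Lemma exists_support_bound (D : seq mindex) :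
  exists n, {in D, forall a, bounded_support n a}.
Proof.
elim: D => [|a D [n nD]]; first by exists 0%N.
exists (maxn n (\max_(i <- finsupp a) i.+1)) => b.
rewrite inE => /orP[/eqP ->|bD]; apply/allP => i ib.
  by rewrite leq_max orbC (leq_bigmax_seq (F := succn)).
by rewrite leq_max; move/allP: (nD b bD) => ->.
Qed.

Definition unit_mindex (k : nat) : mindex := [fsfun i in [fset k]%fset => 1%N].

Lemma unit_mindexE k i : unit_mindex k i = (i == k).
Proof. by rewrite /unit_mindex fsfunE in_fset1; case: eqP. Qed.

Lemma unit_mindex_support n k : (k < n)%N -> bounded_support n (unit_mindex k).
Proof.
move=> kn; apply/allP => i; rewrite mem_finsupp unit_mindexE.
by have [->|] := eqVneq i k.
Qed.

Lemma mdeg_unit_mindex k : mdeg (unit_mindex k) = 1%N.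
Proof.
rewrite (mdegE (unit_mindex_support (ltnSn k))) big_nat_recr//= unit_mindexE eqxx.
rewrite big_nat big1 ?add0n// => i /andP[_ ik].
by rewrite unit_mindexE ltn_eqF.
Qed.

Lemma unit_mindex_inj : injective unit_mindex.
Proof.
move=> j k /(congr1 (fun a : mindex => a j)); rewrite !unit_mindexE eqxx.
by case: eqP.
Qed.

End mindices.

(** * Hypercontractive cotype between cotype and Fourier cotype *)

Section hyp_cotype.
Context {R : realType} (X : completeNormedModType R[i]).
Local Notation e := (@circle_point R).
Local Notation mR := (measurableTypeR R).
Local Notation P := (@circle_prob R).
Implicit Types (D : seq mindex) (x : mindex -> X).

Definition torus_poly n D x (t : n.-tuple mR) : X :=
  \sum_(a <- D) (\prod_(i < n) e (tnth t i) ^+ a i) *: x a.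

Lemma curve_torus_poly n D x d (T : measurableType d) (t : T -> n.-tuple mR) :
  measurable_fun setT t -> curve (fun p => torus_poly D x (t p)).
Proof.
move=> mt; apply: curve_sum => a; apply: curveZ; apply: cmeasurable_prod => i.
apply: cmeasurable_exp; apply: (cmeasurable_comp cmeasurable_circle_point).
exact: (measurableT_comp (measurable_tnth i) mt).
Qed.

Lemma rnorm_torus_poly n D x (t : n.-tuple mR) :
  rnorm (torus_poly D x t) <= \sum_(a <- D) rnorm (x a).
Proof.
apply: le_trans (rnorm_sum _ _ _) _; apply: ler_sum => a _.
rewrite rnormZ1// normr_prod big1// => i _.
by rewrite normrX norm_circle_point expr1n.
Qed.

Let sqn (v : X) : \bar R := (rnorm v ^+ 2)%:E.

Lemma measurable_torus_poly n D x d (T : measurableType d) (t : T -> n.-tuple mR) :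
  measurable_fun setT t -> measurable_fun setT (fun p => sqn (torus_poly D x (t p))).
Proof.
move=> mt; have [_ H] := curve_measurable_sqr X; apply: H.
exact: curve_torus_poly.
Qed.

Lemma integral_torus_poly_fin n D x :
  (\int[torus_prob n]_t sqn (torus_poly D x t))%E \is a fin_num.
Proof.
rewrite ge0_fin_numE; last by apply: integral_ge0 => t _; rewrite lee_fin sqr_ge0.
apply: (@le_lt_trans _ _ (\int[torus_prob n]_t ((\sum_(a <- D) rnorm (x a)) ^+ 2)%:E)%E).
  apply: ge0_le_integral => //.
  - by move=> t _; rewrite lee_fin sqr_ge0.
  - exact: (measurable_torus_poly D x (@measurable_id _ _ setT)).
  - move=> t _; rewrite lee_fin ler_sqr ?nnegrE ?rnorm_ge0 ?rnorm_torus_poly//.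
    by apply: sumr_ge0 => a _; exact: rnorm_ge0.
rewrite (integral_cst (torus_prob n) measurableT) [X in (_ * X)%E](_ : _ = 1%E).
  by rewrite mule1 ltry.
exact: (probability_setT (torus_prob n)).
Qed.

Lemma Rintegral_torus_oo n D x : {in D, forall a, bounded_support n a} ->
  \int[torus_oo_prob]_t
     (rnorm (\sum_(a <- D) monomial a (fun i => e (t i)) *: x a) ^+ 2) =
  fine (\int[torus_prob n]_t sqn (torus_poly D x t))%E.
Proof.
move=> Dn; rewrite /Rintegral; congr fine.
have m0 := measurable_torus_poly D x (@measurable_id _ (n.-tuple mR) setT).
rewrite -(integral_torus_oo m0); last by move=> t; rewrite lee_fin sqr_ge0.
apply: eq_integral => z _; rewrite /sqn; congr ((rnorm _ ^+ 2)%:E).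
rewrite /torus_poly big_seq [RHS]big_seq; apply: eq_bigr => a aD.
congr (_ *: _); rewrite (monomialE _ (Dn a aD)) big_mkord.
by apply: eq_bigr => i _; rewrite tnth_mktuple.
Qed.

Lemma fsbig_mdeg (V : nmodType) (F : mindex -> V) m D : uniq D ->
  {in D, forall a, mdeg a = m} ->
  (forall a, mdeg a = m -> a \notin D -> F a = 0) ->
  \sum_(a \in [set a | mdeg a = m]) F a = \sum_(a <- D) F a.
Proof.
move=> Du Dm F0; rewrite (fsbig_seq _ _ Du); apply/esym; apply: fsbig_widen.
  by move=> a /= aD; exact: Dm.
by move=> a [/= am] /negP aD; exact: F0.
Qed.

Lemma cotype_of_hyp q : 0 < q -> has_hyp_cotype X q -> has_cotype X q.
Proof.
move=> q0 [C C0 H]; exists C => // N x.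
have qn0 : q != 0 by rewrite gt_eqF.
pose D := [seq unit_mindex (k : 'I_N) | k <- enum 'I_N].
have Du : uniq D.
  rewrite map_inj_uniq ?enum_uniq// => j k /unit_mindex_inj; exact: val_inj.
(* The sum has at most one term: it inverts [unit_mindex] on its image and is 0 elsewhere. *)
pose y (a : mindex) : X := \sum_(k < N | unit_mindex k == a) x k.
have yE (k : 'I_N) : y (unit_mindex k) = x k.
  rewrite /y (big_pred1 k)// => j /=.
  by rewrite (inj_eq unit_mindex_inj) (inj_eq val_inj).
have y0 a : a \notin D -> y a = 0.
  move=> aD; rewrite /y big_pred0// => k; apply/negP => /eqP ka.
  by move/negP: aD; apply; rewrite -ka; apply: (map_f (fun k : 'I_N => unit_mindex k)); rewrite mem_enum.
have Dm : {in D, forall a, mdeg a = 1%N}.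
  by move=> a /mapP[k _ ->]; exact: mdeg_unit_mindex.
have fin : finite_set [set a | mdeg a = 1%N /\ y a != 0].
  apply: (@sub_finite_set _ _ [set` D]); last exact: finite_seq.
  by move=> a /= [_ ya]; apply: contraT => /y0 ya0; rewrite ya0 eqxx in ya.
have sumD (V : nmodType) (F : mindex -> V) :
    \sum_(a <- D) F a = \sum_(k < N) F (unit_mindex k).
  by rewrite /D big_map big_enum.
have := H 1%N y isT fin.
rewrite (fsbig_mdeg Du Dm); last first.
  by move=> a _ /y0 ->; rewrite rnorm0 powR0.
rewrite sumD; under eq_bigr do rewrite yE.
rewrite expr1 => /le_trans; apply; rewrite ler_pM2l//.
rewrite /linear_L2 [X in Num.sqrt X <= _](_ : _ =
  \int[torus_oo_prob]_t (rnorm (\sum_(a <- D) monomial a (fun i => e (t i)) *: y a) ^+ 2)); last first.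
  apply: eq_Rintegral => t _; rewrite (fsbig_mdeg Du Dm)//.
  by move=> a _ /y0 ->; rewrite scaler0.
have DN : {in D, forall a, bounded_support N a}.
  by move=> a /mapP[k _ ->]; exact: unit_mindex_support.
rewrite (Rintegral_torus_oo _ DN) le_eqVlt; apply/orP; left; apply/eqP.
congr (Num.sqrt (fine _)); apply: eq_integral => t _.
rewrite /sqn; congr ((rnorm _ ^+ 2)%:E); rewrite /torus_poly sumD.
apply: eq_bigr => k _; rewrite yE; congr (_ *: _).
rewrite (bigD1 k)//= unit_mindexE eqxx expr1 big1 ?mulr1// => i ik.
by rewrite unit_mindexE -[_ == _ :> nat]/(i == k) (negbTE ik) expr0.
Qed.

(* Substituting z_i w^(M^i) for z_i, with M larger than the degree, separates
   the monomials by their degree in w. *)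
Lemma hyp_of_fourier_cotype q : 2 <= q ->
  has_fourier_cotype X q -> has_hyp_cotype X q.
Proof.
move=> q2 [C C0 H]; have q0 : 0 < q by lra.
have qn0 : q != 0 by rewrite gt_eqF.
(* The Fourier constant C serves for every m; its maximum with 1 is at most its own m-th power, as m
   > 0. *)
exists (Num.max C 1); first by rewrite lt_max C0.
move=> m x m0 fin.
pose D : seq mindex := fset_set [set a | mdeg a = m /\ x a != 0].
have DP a : reflect (mdeg a = m /\ x a != 0) (a \in D).
  by rewrite /D in_fset_set//; apply: (iffP idP); rewrite inE.
have Du : uniq D by exact: fset_uniq.
have Dm : {in D, forall a, mdeg a = m} by move=> a /DP[].
have x0 a : mdeg a = m -> a \notin D -> x a = 0.
  by move=> am /DP h; apply/eqP; apply: contraT => xa; case: h.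
have [n Dn] := exists_support_bound D.
rewrite (fsbig_mdeg Du Dm); last first.
  by move=> a am /(x0 a am) ->; rewrite rnorm0 powR0.
rewrite [X in _ * Num.sqrt X](_ : _ =
  \int[torus_oo_prob]_t (rnorm (\sum_(a <- D) monomial a (fun i => e (t i)) *: x a) ^+ 2)); last first.
  apply: eq_Rintegral => t _; rewrite (fsbig_mdeg Du Dm)//.
  by move=> a am /(x0 a am) ->; rewrite scaler0.
rewrite (Rintegral_torus_oo _ Dn); set V := (\int[_]_t _)%E.
have Vfin : V \is a fin_num by exact: integral_torus_poly_fin.
set A := _ `^ q^-1; have A0 : 0 <= A by exact: powR_ge0.
suff AV : A <= C * Num.sqrt (fine V).
  apply: le_trans AV _; rewrite ler_wpM2r ?sqrtr_ge0//.
  have C1 : C <= Num.max C 1 by rewrite le_max lexx.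
  apply: le_trans C1 _; rewrite -[leLHS]expr1 ler_weXn2l// le_max lexx orbT//.
pose M := m.+1.
pose kap (a : mindex) := (\sum_(0 <= i < n) a i * M ^ i)%N.
have aM a : a \in D -> forall i, (a i < M)%N.
  move=> aD i; rewrite ltnS -(Dm a aD) (mdegE (Dn a aD)).
  have [lt|ge] := ltnP i n; first by rewrite big_mkord (bigD1 (Ordinal lt))//= leq_addr.
  suff -> : a i = 0%N by [].
  apply/eqP; rewrite -memNfinsupp; apply/negP => ia.
  by move/allP: (Dn a aD) => /(_ i ia); rewrite ltnNge ge.
have kap_inj : {in D &, injective kap}.
  move=> a b aD bD kab; apply: (mindex_inj (Dn a aD) (Dn b bD)).
  exact: (digits_inj (aM a aD) (aM b bD) kab).
(* The frequencies in the Fourier inequality start at 1, so the degree in w must be positive; this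
   is where m > 0 enters. *)
have kap_gt0 a : a \in D -> (0 < kap a)%N.
  move=> aD; rewrite lt0n; apply/eqP => k0.
  have : mdeg a = 0%N.
    rewrite (mdegE (Dn a aD)) big_nat big1// => i /andP[_ ni].
    move/eqP: k0; rewrite /kap big_mkord sum_nat_eq0 => /forallP/(_ (Ordinal ni)) /=.
    by rewrite muln_eq0 expn_eq0 orbF => /eqP.
  by rewrite (Dm a aD) => mz; rewrite mz in m0.
pose N := (\max_(a <- D) kap a)%N.
have kapN a : a \in D -> (kap a <= N)%N by move=> aD; rewrite /N (leq_bigmax_seq (F := kap)).
have single (V' : nmodType) (F : mindex -> V') a k : a \in D -> kap a = k ->
    \sum_(b <- D | kap b == k) F b = F a.
  move=> aD ak; rewrite big_mkcond (bigD1_seq a)//= ak eqxx.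
  rewrite big1_seq ?addr0// => b /andP[ba bD]; case: eqP => // bk.
  by rewrite (kap_inj b a) ?eqxx ?bk// in ba.
pose th (s : R) (i : nat) : R := s *+ (M ^ i).
pose c (t : n.-tuple mR) (a : mindex) : R[i] := \prod_(i < n) e (tnth t i) ^+ a i.
have c1 t a : `|c t a| = 1.
  rewrite normr_prod big1// => i _.
  by rewrite normrX norm_circle_point expr1n.
pose Xk t (k : 'I_N) : X := \sum_(a <- D | kap a == k.+1) c t a *: x a.
have sumX t : \sum_(k < N) rnorm (Xk t k) `^ q = \sum_(a <- D) rnorm (x a) `^ q.
  transitivity (\sum_(k < N) \sum_(a <- D | kap a == k.+1) rnorm (x a) `^ q).
    apply: eq_bigr => k _; rewrite /Xk.
    have [/hasP[a aD /eqP ak]|/hasPn no] := boolP (has (fun a => kap a == k.+1) D).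
      by rewrite !(single _ _ a)// rnormZ1.
    rewrite big_seq_cond big1 ?rnorm0 ?powR0//; last first.
      by move=> b /andP[/no /negbTE ->].
    by rewrite big_seq_cond big1// => b /andP[/no /negbTE ->].
  rewrite (exchange_big_dep xpredT)//= big_seq [RHS]big_seq; apply: eq_bigr => a aD.
  have kN : ((kap a).-1 < N)%N by rewrite prednK ?kap_gt0// kapN.
  rewrite (big_pred1 (Ordinal kN))// => k /=.
  by rewrite -val_eqE /= -[in LHS](prednK (kap_gt0 a aD)) eqSS eq_sym.
have polyE t s : \sum_(k < N) e s ^+ k.+1 *: Xk t k =
    torus_poly D x (tuple_shift (th s) t).
  transitivity (\sum_(k < N) \sum_(a <- D | kap a == k.+1) (e s ^+ kap a * c t a) *: x a).
    apply: eq_bigr => k _; rewrite scaler_sumr; apply: eq_bigr => a /eqP <-.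
    by rewrite scalerA.
  rewrite (exchange_big_dep xpredT)//= /torus_poly big_seq [RHS]big_seq; apply: eq_bigr => a aD.
  have kN : ((kap a).-1 < N)%N by rewrite prednK ?kap_gt0// kapN.
  rewrite (big_pred1 (Ordinal kN)) => [|k /=]; last first.
    by rewrite -val_eqE /= -[in LHS](prednK (kap_gt0 a aD)) eqSS eq_sym.
  congr (_ *: _); rewrite /c /kap big_mkord -prodrXr -big_split /=.
  apply: eq_bigr => i _; rewrite tnth_mktuple circle_pointD exprMn mulrC /th.
  by rewrite circle_pointMn -exprM mulnC.
pose q' := conj_exponent q.
have q'E : q' = q / (q - 1).
  by rewrite /q' /conj_exponent; field; rewrite gt_eqF ?gt_eqF//; lra.
have q'0 : 0 < q' by rewrite q'E divr_gt0//; lra.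
(* The exponent of Jensen's inequality from L^(q') to L^2: it is at least 1 because q' <= 2. *)
have q'2 : 1 <= 2 / q'.
  by rewrite ler_pdivlMr// mul1r q'E ler_pdivrMr; lra.
pose B := A / C; have B0 : 0 <= B by rewrite divr_ge0// ltW.
have key (t : n.-tuple mR) : ((B ^+ 2)%:E <= \int[P]_s sqn (torus_poly D x (tuple_shift (th s) t)))%E.
  pose f (s : mR) : R := rnorm (torus_poly D x (tuple_shift (th s) t)) `^ q'.
  have ms : measurable_fun setT (fun s : mR => tuple_shift (th s) t).
    apply/measurable_fun_tnthP => i.
    rewrite (_ : _ \o _ = fun s : mR => tnth t i + s * (M ^ i)%:R).
      by apply: measurable_funD => //; exact: measurable_funM.
    by apply/funext => s /=; rewrite tnth_mktuple /th mulr_natr.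
  have mf : measurable_fun setT f.
    apply/measurable_EFinP; have [_ h] := curve_measurable_powR X q'; apply: h.
    exact: curve_torus_poly.
  have f0 s : 0 <= f s by exact: powR_ge0.
  have Bf : ((B `^ q')%:E <= \int[P]_s (f s)%:E)%E.
    have := H N (Xk t); rewrite sumX -/A -/q'.
    rewrite [X in _ * X `^ _](_ : _ = fine (\int[P]_s (f s)%:E)%E); last first.
      by rewrite /Rintegral; congr fine; apply: eq_integral => s _; rewrite /f -polyE.
    set J := (\int[P]_s (f s)%:E)%E => h.
    have J0 : (0 <= J)%E by apply: integral_ge0 => s _; rewrite lee_fin.
    (* At infinity [fine] takes the value 0, and the inequality still holds. *)
    have fJ : ((fine J)%:E <= J)%E by case: J J0 {h} => //= _; rewrite leey.
    apply: le_trans fJ; rewrite lee_fin.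
    have : B <= fine J `^ q'^-1 by rewrite /B ler_pdivrMr// mulrC.
    move=> /(ler_powR2r (ltW q'0) B0); rewrite powRrVK ?fine_ge0//.
    by rewrite gt_eqF.
  have := jensen_integral q'2 mf f0 (powR_ge0 _ _) Bf.
  have e2 : q' * (2 / q') = 2 by field; rewrite gt_eqF.
  rewrite -powRrM e2 powR_mulrn// => /le_trans; apply.
  rewrite le_eqVlt; apply/orP; left; apply/eqP; apply: eq_integral => s _.
  by rewrite /f -powRrM e2 powR_mulrn// rnorm_ge0.
pose g (p : n.-tuple mR * mR) := sqn (torus_poly D x (tuple_shift (th p.2) p.1)).
have mg : measurable_fun setT g.
  apply: measurable_torus_poly; apply/measurable_fun_tnthP => i.
  rewrite (_ : _ \o _ = fun p : n.-tuple mR * mR => tnth p.1 i + p.2 * (M ^ i)%:R).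
    apply: measurable_funD.
      exact: (measurableT_comp (measurable_tnth i) measurable_fst).
    by apply: measurable_funM => //; exact: measurable_snd.
  by apply/funext => p /=; rewrite tnth_mktuple /th mulr_natr.
have g0 p : (0 <= g p)%E by rewrite lee_fin sqr_ge0.
have BV : ((B ^+ 2)%:E <= V)%E.
  apply: (@le_trans _ _ (\int[torus_prob n]_t \int[P]_s
      sqn (torus_poly D x (tuple_shift (th s) t)))%E).
    rewrite [leLHS](_ : _ = (\int[torus_prob n]_t (B ^+ 2)%:E)%E); last first.
      rewrite (integral_cst (torus_prob n) measurableT) [X in (_ * X)%E](_ : _ = 1%E).
        by rewrite mule1.
      exact: (probability_setT (torus_prob n)).
    apply: ge0_le_integral => //.
    - by move=> t _; rewrite lee_fin sqr_ge0.
    - exact: (@measurable_fun_fubini_tonelli_F _ _ _ _ _ P g mg g0).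
  rewrite le_eqVlt; apply/orP; left; apply/eqP.
  apply: (eq_trans (@fubini_tonelli _ _ _ _ _ (torus_prob n) P g mg g0)).
  transitivity (\int[P]_s V)%E.
    apply: eq_integral => s _.
    apply: (@integral_torus_translate _ n (th s) (fun t => sqn (torus_poly D x t))).
    - exact: (measurable_torus_poly D x (@measurable_id _ _ setT)).
    - by move=> t; rewrite lee_fin sqr_ge0.
    - move=> t u tu; congr ((rnorm _ ^+ 2)%:E); apply: eq_bigr => a _.
      by congr (_ *: _); apply: eq_bigr => i _; rewrite tu.
  rewrite (integral_cst P measurableT) [X in (_ * X)%E](_ : _ = 1%E) ?mule1//.
  exact: (probability_setT P).
have : B ^+ 2 <= fine V by rewrite -lee_fin fineK.
move=> h; rewrite mulrC -ler_pdivrMr// -/B -[B]ger0_norm// -sqrtr_sqr.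
exact: ler_wsqrtr.
Qed.

End hyp_cotype.

(** * Comparison of the three exponents *)

Lemma le_inf_exponent (R : realType) (p p' : R -> Prop) :
  (forall q r, 2 <= q -> q < r -> p q -> p' r) ->
  (inf_exponent p' <= inf_exponent p)%E.
Proof.
move=> pp'; apply: le_ereal_inf_tmp => _ [q [q2 pq] <-].
apply/lee_addgt0Pr => eps eps0; apply: ereal_inf_lbound.
exists (q + eps); last by rewrite EFinD.
by split; [lra|apply: (pp' q) => //; lra].
Qed.

Lemma sub_inf_exponent (R : realType) (p p' : R -> Prop) :
  (forall q, 2 <= q -> p q -> p' q) -> (inf_exponent p' <= inf_exponent p)%E.
Proof.
move=> pp'; apply: ereal_inf_le_tmp => _ [q [q2 pq] <-].
by exists q => //; split => //; exact: pp'.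
Qed.

Theorem mainTheorem7 (R : realType) (X : completeNormedModType R[i])
    (hX : has_type2 X) :
  cot X = cot_fourier X /\ cot_fourier X = cot_hyp X.
Proof.
have h1 : (cot_fourier X <= cot X)%E.
  apply: le_inf_exponent => q r q2 qr hq.
  exact: fourier_cotype_of_cotype q2 qr hX hq.
have h2 : (cot_hyp X <= cot_fourier X)%E.
  by apply: sub_inf_exponent => q; exact: hyp_of_fourier_cotype.
have h3 : (cot X <= cot_hyp X)%E.
  by apply: sub_inf_exponent => q q2; apply: cotype_of_hyp; lra.
have e1 : cot X = cot_fourier X by apply/le_anti; rewrite h1 (le_trans h3 h2).
by split => //; apply/le_anti; rewrite h2 -e1 h3.
Qed.
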